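(* Let $H$ be a bornological quantum group with dual quantum group $\hat H$. Every essential left $H$-module is an essential right $\hat H$-comodule in a natural way, via $\lambda \mapsto D(\lambda)$, and vice versa, every essential right $\hat H$-comodule is an essential left $H$-module in a natural way, via $\eta\mapsto D(\eta)$ and the identification $\hat{\hat H}\cong H$ (the constructions $D$ are described in the context). This yields inverse isomorphisms between the category of essential $H$-modules (with bounded $H$-linear maps) and the category of essential $\hat H$-comodules (with bounded $\hat H$-colinear maps). These isomorphisms are compatible with tensor products.
   Context: Conventions. Vector spaces are complex. A bornological vector space is a vector space with a convex bornology, whose members are called small sets; it is always assumed complete (every small set lies in a small disk $T$ whose linear span $\langle T\rangle$ is a Banach space for the Minkowski gauge of $T$). $\mathrm{Hom}(V,W)$ is the space of bounded linear maps (those mapping small sets to small sets) with the equibounded bornology; all linear maps considered are bounded and isomorphisms are bounded with bounded inverse. $\hat\otimes$ is the completed bornological tensor product (universal for bounded bilinear maps), $\tau$ is the flip, and leg numbering notation is used. $V$ has the approximation property if for each compact disk $S\subset V$ (i.e. compact in some Banach space $\langle T\rangle$, $T$ a small disk) there is a sequence of bounded finite rank operators $f_n:V\to V$ with $f_n\to\mathrm{id}$ in $\mathrm{Hom}(\langle S\rangle,V)$. A bornological algebra is a bornological vector space $H$ with a bounded associative multiplication $\mu:H\hat\otimes H\to H$ (no unit required). For a right $H$-module $M$ and a left $H$-module $V$, $M\hat\otimes_H V$ is the quotient of $M\hat\otimes V$ by the closure of the span of all $mh\otimes v-m\otimes hv$. A left $H$-module $V$ is essential if the action induces an isomorphism $H\hat\otimes_H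 V\cong V$ (similarly for right modules); $H$ is essential if it is nonzero and $\mu$ induces an isomorphism $H\hat\otimes_H H\cong H$. The multiplier algebra $M(H)$ consists of pairs $(L,R)$ of bounded linear maps $H\to H$ with $L(fg)=L(f)g$, $R(fg)=fR(g)$, $fL(g)=R(f)g$, with the bornology and multiplication inherited from left and right multipliers. A homomorphism $f:H\to M(K)$ is essential if it turns $K$ into an essential left and right $H$-module; for essential $K$ it extends uniquely to a unital homomorphism $M(H)\to M(K)$, denoted by the same letter. A bounded functional $\omega$ on $H$ is faithful if ($\omega(fg)=0$ for all $g$) implies $f=0$ and ($\omega(fg)=0$ for all $f$) implies $g=0$. Bornological quantum groups. Let $H$ be an essential bornological algebra with the approximation property and a faithful bounded functional; then $H\subset M(H)$, and similarly for tensor powers. A comultiplication is an essential homomorphism $\Delta:H\to M(H\hat\otimes H)$ with $(\Delta\hat\otimes\mathrm{id})\Delta=(\mathrm{id}\hat\otimes\Delta)\Delta$. Its Galois maps $H\hat\otimes H\to M(H\hat\otimes H)$ are $\gamma_l(f\otimes g)=\Delta(f)(g\otimes 1)$, $\gamma_r(f\otimes g)=\Delta(f)(1\otimes g)$, $\rho_l(f\otimes g)=(f\otimes 1)\Delta(g)$, $\rho_r(f\otimes g)=(1\otimes f)\Delta(g)$. If these are bounded maps into $H\hat\otimes H$, then for a bounded functional $\omega$ the multiplier $(\mathrm{id}\hat\otimes\omega)\Delta(f)\in M(H)$ is defined by $(\mathrm{id}\hat\otimes\omega)\Delta(f)\cdot g=(\mathrm{id}\hat\otimes\omega)\gamma_l(f\otimes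 g)$, $g\cdot(\mathrm{id}\hat\otimes\omega)\Delta(f)=(\mathrm{id}\hat\otimes\omega)\rho_l(g\otimes f)$, and $(\omega\hat\otimes\mathrm{id})\Delta(f)\in M(H)$ by $(\omega\hat\otimes\mathrm{id})\Delta(f)\cdot g=(\omega\hat\otimes\mathrm{id})\gamma_r(f\otimes g)$, $g\cdot(\omega\hat\otimes\mathrm{id})\Delta(f)=(\omega\hat\otimes\mathrm{id})\rho_r(g\otimes f)$. A bounded functional $\phi$ is left invariant if $(\mathrm{id}\hat\otimes\phi)\Delta(f)=\phi(f)1$ for all $f$, and $\psi$ is right invariant if $(\psi\hat\otimes\mathrm{id})\Delta(f)=\psi(f)1$ for all $f$. A bornological quantum group is an essential bornological algebra with the approximation property together with a comultiplication all of whose four Galois maps are isomorphisms of $H\hat\otimes H$ onto itself, and a faithful left invariant functional $\phi$. It has a unique counit (essential homomorphism $\epsilon:H\to\mathbb{C}$ with $(\epsilon\hat\otimes\mathrm{id})\Delta=\mathrm{id}=(\mathrm{id}\hat\otimes\epsilon)\Delta$) and antipode (an isomorphism $S:H\to H$, antimultiplicative and anticomultiplicative, with $\mu(S\hat\otimes\mathrm{id})\gamma_r=\epsilon\hat\otimes\mathrm{id}$, $\mu(\mathrm{id}\hat\otimes S)\rho_l=\mathrm{id}\hat\otimes\epsilon$). The dual. Let $\phi$ be a faithful left invariant functional and $\psi$ a faithful right invariant functional on $H$ (e.g. $\psi=\phi\circ S$). Define maps $H\to H'=\mathrm{Hom}(H,\mathbb{C})$ by $\mathcal{F}_l(f)(h)=\phi(hf)$,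 $\mathcal{F}_r(f)(h)=\phi(fh)$, $\mathcal{G}_l(f)(h)=\psi(hf)$, $\mathcal{G}_r(f)(h)=\psi(fh)$. These are injective and have the same image $\hat H\subset H'$; $\hat H$ carries the bornology transported from $H$ along any of them (all give the same bornology). The product of $\hat H$ is $\hat\mu(\mathcal{F}_l(f)\otimes\mathcal{F}_l(g))=\mathcal{F}_l((\mathrm{id}\hat\otimes\phi)\gamma_l^{-1}(f\otimes g))$. The comultiplication $\hat\Delta:\hat H\to M(\hat H\hat\otimes\hat H)$ is the unique one whose Galois maps $\hat\gamma_r,\hat\rho_l$ are $\hat\gamma_r(\mathcal{F}_l(f)\otimes\mathcal{F}_l(g))=(\mathcal{F}_l\hat\otimes\mathcal{F}_l)\tau\gamma_l^{-1}(f\otimes g)$ and $\hat\rho_l(\mathcal{G}_r(g)\otimes\mathcal{G}_r(f))=(\mathcal{G}_r\hat\otimes\mathcal{G}_r)\tau\rho_r^{-1}(g\otimes f)$. With the faithful left invariant functional $\hat\phi(\mathcal{G}_r(f))=\epsilon(f)$, $\hat H$ is a bornological quantum group. The map $P:H\to\hat{\hat H}$, $P(f)(\omega)=\omega(f)$, is an isomorphism of bornological quantum groups, used to identify $\hat{\hat H}$ with $H$. Comodules. An essential (right) $H$-comodule is a bornological vector space $V$ with a coaction, i.e. a bounded linear map $\eta:V\to\mathrm{Hom}_H(H,V\hat\otimes H)$ (right $H$-linear maps), equivalently a right $H$-linear map $\eta:V\hat\otimes H\to V\hat\otimes H$, which (in the latter form) is an isomorphism and satisfies $(\mathrm{id}\otimes\gamma_r)\eta_{12}(\mathrm{id}\otimes\gamma_r^{-1})=\eta_{12}\eta_{13}$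 on $V\hat\otimes H\hat\otimes H$. A bounded map $f:V\to W$ is colinear if $\eta_W(f\otimes\mathrm{id})=(f\otimes\mathrm{id})\eta_V$. Tensor products. For essential $H$-modules $V,W$, $V\hat\otimes W$ is an essential $H\hat\otimes H$-module and becomes an essential $H$-module through $\Delta$, i.e. via $H\hat\otimes_H(V\hat\otimes W)\cong H\hat\otimes_H(H\hat\otimes H)\hat\otimes_{H\hat\otimes H}(V\hat\otimes W)\cong V\hat\otimes W$. For comodules, $\eta_{V\hat\otimes W}=\eta_V^{13}\eta_W^{23}$ on $V\hat\otimes W\hat\otimes H$. The constructions $D$ (for any bornological quantum group $H$). For an essential $H$-comodule $\eta$ on $V$, the left $\hat H$-module $D(\eta):\hat H\hat\otimes V\to V$ is $D(\eta)(\mathcal{F}_l(f)\otimes v)=(\mathrm{id}\hat\otimes\phi)\eta(v\otimes f)$. For an essential left $H$-module $\lambda:H\hat\otimes V\to V$, let $\lambda^{-1}$ be the inverse of the induced isomorphism $H\hat\otimes_HV\cong V$; the right $\hat H$-coaction $D(\lambda):V\hat\otimes\hat H\to V\hat\otimes\hat H$ is $D(\lambda)(v\otimes\mathcal{F}_l(f))=(\mathrm{id}\hat\otimes\mathcal{F}_l)\tau(\mathrm{id}\hat\otimes\lambda)(\gamma_l^{-1}\tau\hat\otimes\mathrm{id})(\mathrm{id}\hat\otimes\lambda^{-1})(f\otimes v)$ (well defined since $\gamma_l^{-1}\tau$ is right $H$-linear in the second factor). On morphisms both constructions are the identity on underlying maps. *)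

(* Defs.v *)
From HB Require Import structures.
From mathcomp Require Import all_boot all_order all_algebra.
From mathcomp Require Import complex.
From mathcomp Require Import all_classical all_reals topology normedtype sequences.
Set Implicit Arguments.
Unset Strict Implicit.
Unset Printing Implicit Defensive.
Import Order.TTheory GRing.Theory Num.Theory numFieldNormedType.Exports.
Local Open Scope classical_set_scope.
Local Open Scope ring_scope.
Local Open Scope complex_scope.

Section Disks.
Variables (R : realType) (V : lmodType R[i]).
Implicit Types (S : set V) (x : V).

(* A nonempty set is circled and convex iff it is stable under the
   combinations below. *)
Definition disk S : Prop :=
  S 0 /\ forall (a b : R[i]) x y, `|a| + `|b| <= 1 -> S x -> S y ->
         S (a *: x + b *: y).

Definition lspan S : set V :=
  [set x | exists n (c : 'I_n -> R[i]) (s : 'I_n -> V),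
     (forall i, S (s i)) /\ x = \sum_i c i *: s i].

(* Minkowski gauge; only meaningful on [lspan S] for a disk [S]. *)
Definition gauge S x : R :=
  inf [set r | 0 < r /\ exists2 s, S s & x = r%:C *: s].

(* Disks [S] whose linear span is a Banach space for the gauge of [S]. *)
Definition banach_disk S : Prop :=
  [/\ disk S,
      forall x, lspan S x -> gauge S x = 0 -> x = 0
    & forall u : nat -> V, (forall n, lspan S (u n)) ->
      (forall e, 0 < e -> exists N, forall m n, (N <= m)%N -> (N <= n)%N ->
         gauge S (u m - u n) < e) ->
      exists2 l, lspan S l & gauge S (u n - l) @[n --> \oo] --> (0 : R)].

Lemma disk0 S : disk S -> S 0. Proof. by case. Qed.

Lemma disk_scale S (a : R[i]) x : disk S -> `|a| <= 1 -> S x -> S (a *: x).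
Proof.
move=> [S0 SD] a1 Sx; have := SD a 0 x 0; rewrite normr0 addr0 scaler0 addr0.
exact.
Qed.

Lemma real_complex_ge0 (r : R) : 0 <= r -> `|r%:C| = r%:C :> R[i].
Proof. by move=> r0; rewrite ger0_norm // lecE /= eqxx. Qed.

Lemma disk_le S x (r s : R) : disk S -> 0 < r -> r <= s ->
  (exists2 y, S y & x = r%:C *: y) -> exists2 y, S y & x = s%:C *: y.
Proof.
move=> dS r0 rs [y Sy ->]; have s0 := lt_le_trans r0 rs.
exists ((r / s)%:C *: y).
  apply: disk_scale => //; rewrite real_complex_ge0 ?divr_ge0 ?(ltW r0) ?(ltW s0) //.
  by rewrite -[1]/(1%:C) lecR ler_pdivrMr // mul1r.
by rewrite scalerA -rmorphM /= mulrCA divff ?mulr1 // gt_eqF.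
Qed.

Lemma lspanP S x : disk S -> lspan S x <-> exists2 r : R, 0 < r &
  exists2 y, S y & x = r%:C *: y.
Proof.
move=> dS; split; last first.
  move=> [r r0 [y Sy ->]]; exists 1%N, (fun=> r%:C), (fun=> y); split => //.
  by rewrite big_ord_recl big_ord0 addr0.
case=> n [c [s [Ss ->]]]; elim: n c s Ss => [|n IH] c s Ss.
  by rewrite big_ord0; exists 1; rewrite ?ltr01//; exists 0; rewrite ?scaler0 //; apply: disk0.
rewrite big_ord_recl /=.
have [|r r0 [y Sy ->]] := IH (fun i => c (lift ord0 i)) (fun i => s (lift ord0 i)).
  by move=> i; apply: Ss.
pose a := complex.Re `|c ord0|.
have aE : `|c ord0| = a%:C by rewrite RRe_real // normr_real.
have a0 : 0 <= a by rewrite -lecR -aE normr_ge0.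
have ar0 : 0 < a + r by rewrite ltr_wpDl.
exists (a + r) => //.
have neq : (a + r)%:C != 0 :> R[i] by rewrite eq_complex /= negb_and gt_eqF.
exists ((c ord0 / (a + r)%:C) *: s ord0 + (r%:C / (a + r)%:C) *: y).
  case: dS => _; apply => //; rewrite 2!normf_div aE.
  rewrite !real_complex_ge0 ?(ltW r0)// ?(ltW ar0)//.
  by rewrite -mulrDl -rmorphD /= divff.
by rewrite scalerDr !scalerA !(mulrC (a + r)%:C) !divfK.
Qed.

Lemma gauge_le S x (r : R) : 0 < r -> (exists2 y, S y & x = r%:C *: y) ->
  gauge S x <= r.
Proof.
move=> r0 h; apply: ge_inf; last by split.
by exists 0 => t [t0 _]; exact: ltW.
Qed.

Lemma gauge_ge0 S x : 0 <= gauge S x.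
Proof.
rewrite /gauge; set A := [set _ | _].
have [->|/set0P A0] := eqVneq A set0; first by rewrite inf0.
by apply: lb_le_inf => // t [t0 _]; exact: ltW.
Qed.

Lemma gauge_lt S x (r : R) : disk S -> lspan S x -> gauge S x < r ->
  exists2 y, S y & x = r%:C *: y.
Proof.
move=> dS /lspanP => /(_ dS) [t t0 tx] gr.
have hi : has_inf [set r | 0 < r /\ exists2 s, S s & x = r%:C *: s].
  by split; [exists t | exists 0 => ? [? _]; exact: ltW].
have [|q [q0 qx] qr] := @inf_adherent _ _ (r - gauge S x) _ hi.
  by rewrite subr_gt0.
apply: (disk_le dS q0 _ qx); move: qr; rewrite -/(gauge S x) addrC subrK; exact: ltW.
Qed.

Lemma gauge_eq0 S x : (forall e : R, 0 < e -> exists2 y, S y & x = e%:C *: y) ->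
  gauge S x = 0.
Proof.
move=> h; apply/eqP; rewrite eq_le gauge_ge0 andbT; apply/ler_addgt0Pl => e e0.
by rewrite addr0; apply: gauge_le => //; exact: h.
Qed.

Lemma gauge_cvg0 S (u : nat -> V) :
  (forall e : R, 0 < e -> exists N, forall n, (N <= n)%N ->
     exists2 y, S y & u n = e%:C *: y) ->
  gauge S (u n) @[n --> \oo] --> (0 : R).
Proof.
move=> h; apply/cvgr0Pnorm_le => e e0.
have [N hN] := h e e0; exists N => // n Nn.
by rewrite ger0_norm ?gauge_ge0 //; apply: gauge_le => //; exact: hN.
Qed.

Lemma disk_combine S (r s : R) (a b : R[i]) x y : disk S -> 0 < r -> 0 < s ->
  `|a| <= 1 -> `|b| <= 1 -> S x -> S y ->
  exists2 z, S z & a *: (r%:C *: x) + b *: (s%:C *: y) = (r + s)%:C *: z.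
Proof.
move=> dS r0 s0 a1 b1 Sx Sy; have rs0 : 0 < r + s by exact: addr_gt0.
have neq : (r + s)%:C != 0 :> R[i] by rewrite eq_complex /= negb_and gt_eqF.
exists ((r%:C / (r + s)%:C * a) *: x + (s%:C / (r + s)%:C * b) *: y).
  case: dS => _; apply => //; rewrite !normrM !normfV !real_complex_ge0 ?(ltW r0) ?(ltW s0) ?(ltW rs0) //.
  apply: (@le_trans _ _ (r%:C / (r + s)%:C + s%:C / (r + s)%:C)).
    apply: lerD; rewrite ler_piMr // divr_ge0 // -[0]/(0%:C) lecR ltW //.
  by rewrite -mulrDl -rmorphD /= divff.
have e (t c : R[i]) : (r + s)%:C * (t / (r + s)%:C * c) = c * t.
  by rewrite mulrA [_ * (t / _)]mulrC divfK // mulrC.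
by rewrite scalerDr !scalerA !e.
Qed.

Lemma lspanB S x y : disk S -> lspan S x -> lspan S y -> lspan S (x - y).
Proof.
move=> dS /(lspanP _ dS)[r r0 [x' Sx ->]] /(lspanP _ dS)[s s0 [y' Sy ->]].
apply/(lspanP _ dS); exists (r + s); first exact: addr_gt0.
have [||z Sz zE] := @disk_combine S r s 1 (-1) x' y' dS r0 s0 _ _ Sx Sy.
- by rewrite normr1.
- by rewrite normrN1.
by exists z => //; rewrite -zE scale1r scaleN1r.
Qed.

End Disks.

(* Complex vector spaces with a complete convex bornology; convexity, i.e.
   that small sets have small disked hulls, is contained in [small_banach]. *)
HB.mixin Record isBornological (R : realType) V of GRing.Lmodule R[i] V := {
  small : set (set V) ;
  small1 : forall x, small [set x] ;
  smallS : forall A B, A `<=` B -> small B -> small A ;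
  smallU : forall A B, small A -> small B -> small (A `|` B) ;
  smallD : forall A B, small A -> small B -> small [set x + y | x in A & y in B] ;
  smallZ : forall (a : R[i]) A, small A -> small [set a *: x | x in A] ;
  small_banach : forall A, small A ->
    exists B, [/\ small B, banach_disk B & A `<=` B] }.

#[short(type="bornType")]
HB.structure Definition Bornological (R : realType) :=
  {V of GRing.Lmodule R[i] V & isBornological R V}.


Arguments small1 {R s} x.
Arguments smallS {R s} [A B].
Arguments smallU {R s} [A B].
Arguments smallD {R s} [A B].
Arguments smallZ {R s} a [A].
Arguments small_banach {R s} [A].

Section Convergence.
Variables (R : realType) (V : bornType R).

(* Bornological (Mackey) convergence. *)
Definition born_cvg (u : nat -> V) (l : V) : Prop :=
  exists2 B, small B & forall e : R, 0 < e -> exists N, forall n, (N <= n)%N ->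
    exists2 b, B b & u n - l = e%:C *: b.

Lemma small_sep (B : set V) x : small B ->
  (forall e : R, 0 < e -> exists2 b, B b & x = e%:C *: b) -> x = 0.
Proof.
move=> /small_banach[S [_ [dS sep _] BS]] h.
have h' (e : R) : 0 < e -> exists2 b, S b & x = e%:C *: b.
  by move=> /h[b Bb ->]; exists b => //; exact: BS.
apply: sep; last exact: gauge_eq0.
by apply/(lspanP _ dS); exists 1; [exact: ltr01|exact: h'].
Qed.

Lemma born_cvg_lin u l v k (a : R[i]) : born_cvg u l -> born_cvg v k ->
  born_cvg (fun n => a *: u n + v n) (a *: l + k).
Proof.
move=> [A sA hA] [B sB hB].
exists [set x + y | x in [set a *: x | x in A] & y in B].
  by apply: smallD => //; exact: smallZ.
move=> e e0; have [N hN] := hA e e0; have [M hM] := hB e e0.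
exists (maxn N M) => n; rewrite geq_max => /andP[/hN[x Ax xE] /hM[y By yE]].
exists (a *: x + y); first by exists (a *: x); [exists x|exists y].
rewrite scalerDr scalerA mulrC -scalerA -xE -yE scalerBr.
by rewrite opprD addrACA.
Qed.

Lemma born_cvg_unique u l k : born_cvg u l -> born_cvg u k -> l = k.
Proof.
move=> ul uk; have [B sB hB] := born_cvg_lin (-1) ul uk.
apply/eqP; rewrite -subr_eq0; apply/eqP; apply: (small_sep sB) => e e0.
have [N /(_ N (leqnn N))[b Bb bE]] := hB e e0; exists b => //.
by rewrite -bE !scaleN1r addNr sub0r opprD opprK.
Qed.
End Convergence.

Section Bounded.
Variable R : realType.

Definition bounded_fun (V W : bornType R) (f : V -> W) : Prop :=
  forall A, small A -> small (f @` A).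

Record blin (V W : bornType R) := Blin {
  blin_fun :> V -> W;
  blin_lin : linear blin_fun;
  blin_bnd : bounded_fun blin_fun }.

HB.instance Definition _ V W (f : blin V W) :=
  GRing.isLinear.Build R[i] V W *:%R (blin_fun f) (@blin_lin _ _ f).

Lemma blin_eq V W (f g : blin V W) : f =1 g -> f = g.
Proof.
case: f g => [f lf bf] [g lg bg] /= /funext efg; subst g.
by congr Blin; exact: Prop_irrelevance.
Qed.

Lemma bid_bnd (V : bornType R) : bounded_fun (@idfun V).
Proof. by move=> A sA; rewrite image_id. Qed.
Definition bid (V : bornType R) : blin V V :=
  Blin (fun a x y => erefl (a *: x + y)) (@bid_bnd V).

Lemma bcomp_lin (U V W : bornType R) (g : blin V W) (f : blin U V) : linear (g \o f).
Proof. by move=> a x y /=; rewrite !linearP. Qed.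
Lemma bcomp_bnd (U V W : bornType R) (g : blin V W) (f : blin U V) :
  bounded_fun (g \o f).
Proof. by move=> A /(blin_bnd f)/(blin_bnd g); rewrite image_comp. Qed.
Definition bcomp (U V W : bornType R) (g : blin V W) (f : blin U V) : blin U W :=
  Blin (bcomp_lin g f) (bcomp_bnd g f).
Lemma bcompE (U V W : bornType R) (g : blin V W) (f : blin U V) x :
  bcomp g f x = g (f x).
Proof. by []. Qed.

Record biso (V W : bornType R) := Biso {
  biso_fun :> blin V W;
  biso_inv : blin W V;
  biso_funK : cancel biso_fun biso_inv;
  biso_invK : cancel biso_inv biso_fun }.
End Bounded.

(* The space Hom(V, W) of bounded linear maps, i.e. the type [blin V W],
   with the equibounded bornology. *)
Section Hom.
Variables (R : realType) (V W : bornType R).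
Implicit Types f g : blin V W.

HB.instance Definition _ := gen_eqMixin (blin V W).
HB.instance Definition _ := gen_choiceMixin (blin V W).

Lemma hzero_lin : linear (fun _ : V => 0 : W).
Proof. by move=> a x y; rewrite scaler0 addr0. Qed.
Lemma hzero_bnd : bounded_fun (fun _ : V => 0 : W).
Proof. by move=> A _; apply: smallS (small1 0) => _ [x _ <-]. Qed.
Definition hzero : blin V W := Blin hzero_lin hzero_bnd.

Lemma hadd_lin f g : linear (fun x => f x + g x).
Proof. by move=> a x y; rewrite !linearP scalerDr addrACA. Qed.
Lemma hadd_bnd f g : bounded_fun (fun x => f x + g x).
Proof.
move=> A sA; apply: smallS (smallD (blin_bnd f sA) (blin_bnd g sA)).
by move=> _ [x Ax <-]; exists (f x); [exists x|exists (g x); [exists x|]].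
Qed.
Definition hadd f g : blin V W := Blin (hadd_lin f g) (hadd_bnd f g).

Lemma hscale_lin (c : R[i]) f : linear (fun x => c *: f x).
Proof. by move=> a x y; rewrite linearP scalerDr !scalerA mulrC. Qed.
Lemma hscale_bnd (c : R[i]) f : bounded_fun (fun x => c *: f x).
Proof.
move=> A sA; apply: smallS (smallZ c (blin_bnd f sA)).
by move=> _ [x Ax <-]; exists (f x) => //; exists x.
Qed.
Definition hscale (c : R[i]) f : blin V W := Blin (hscale_lin c f) (hscale_bnd c f).

Lemma haddA : associative hadd.
Proof. by move=> f g h; apply: blin_eq => x /=; rewrite addrA. Qed.
Lemma haddC : commutative hadd.
Proof. by move=> f g; apply: blin_eq => x /=; rewrite addrC. Qed.
Lemma hadd0 : left_id hzero hadd.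
Proof. by move=> f; apply: blin_eq => x /=; rewrite add0r. Qed.
Lemma haddN : left_inverse hzero (hscale (-1)) hadd.
Proof. by move=> f; apply: blin_eq => x /=; rewrite scaleN1r addNr. Qed.
HB.instance Definition _ := GRing.isZmodule.Build (blin V W) haddA haddC hadd0 haddN.

Lemma hscaleA a b f : hscale a (hscale b f) = hscale (a * b) f.
Proof. by apply: blin_eq => x /=; rewrite scalerA. Qed.
Lemma hscale1 : left_id 1 hscale.
Proof. by move=> f; apply: blin_eq => x /=; rewrite scale1r. Qed.
Lemma hscaleDr : right_distributive hscale +%R.
Proof. by move=> a f g; apply: blin_eq => x /=; rewrite scalerDr. Qed.
Lemma hscaleDl f : {morph hscale^~ f : a b / a + b}.
Proof. by move=> a b; apply: blin_eq => x /=; rewrite scalerDl. Qed.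
HB.instance Definition _ := GRing.Zmodule_isLmodule.Build R[i] (blin V W)
  hscaleA hscale1 hscaleDr hscaleDl.

Lemma haddE f g x : (f + g) x = f x + g x. Proof. by []. Qed.
Lemma hscaleE a f x : (a *: f) x = a *: f x. Proof. by []. Qed.
Lemma hsubE f g x : (f - g) x = f x - g x.
Proof. by rewrite /= scaleN1r. Qed.

Definition equibounded : set (set (blin V W)) :=
  [set F | forall A, small A -> small [set (f : blin V W) x | f in F & x in A]].

Lemma equibounded1 f : equibounded [set f].
Proof.
move=> A /(blin_bnd f); apply: smallS => _ [_ -> [x Ax <-]].
by exists x.
Qed.
Lemma equiboundedS F G : F `<=` G -> equibounded G -> equibounded F.
Proof.
move=> FG eG A /eG; apply: smallS => _ [f Ff [x Ax <-]].
by exists f; [exact: FG|exists x].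
Qed.
Lemma equiboundedU F G : equibounded F -> equibounded G -> equibounded (F `|` G).
Proof.
move=> eF eG A sA; apply: smallS (smallU (eF A sA) (eG A sA)) => _ [f [] Ff [x Ax <-]].
  by left; exists f => //; exists x.
by right; exists f => //; exists x.
Qed.
Lemma equiboundedD F G : equibounded F -> equibounded G ->
  equibounded [set f + g | f in F & g in G].
Proof.
move=> eF eG A sA; apply: smallS (smallD (eF A sA) (eG A sA)).
move=> _ [_ [f Ff [g Gg <-]] [x Ax <-]].
by exists (f x); [exists f => //; exists x|exists (g x) => //; exists g => //; exists x].
Qed.
Lemma equiboundedZ (a : R[i]) F : equibounded F -> equibounded [set a *: f | f in F].
Proof.
move=> eF A sA; apply: smallS (smallZ a (eF A sA)) => _ [_ [f Ff <-] [x Ax <-]].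
by exists (f x) => //; exists f => //; exists x.
Qed.

Lemma equibounded_banach F : equibounded F ->
  exists G, [/\ equibounded G, banach_disk G & F `<=` G].
Proof.
move=> eF.
have /choice[B hB] (A : set V) : exists B : set W, small A ->
    [/\ small B, banach_disk B & [set (f : blin V W) x | f in F & x in A] `<=` B].
  by case: (pselect (small A)) => [/eF/small_banach[B ?]|nA]; [exists B|exists set0].
pose G : set (blin V W) := [set g | forall A, small A -> g @` A `<=` B A].
have dB A : small A -> disk (B A) by move=> /hB[_ []].
have dG : disk G.
  split=> [A sA _ [x Ax <-]|a b f g ab Gf Gg A sA _ [x Ax <-] /=].
    exact: disk0 (dB A sA).
  by case: (dB A sA) => _; apply => //; [apply: (Gf A)|apply: (Gg A)] => //; exists x.
have scG A x (e : R) g : small A -> A x -> (exists2 h, G h & g = e%:C *: h) ->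
    exists2 b, B A b & g x = e%:C *: b.
  by move=> sA Ax [h Gh ->]; exists (h x) => //; apply: (Gh A) => //; exists x.
exists G; split; last first.
- by move=> f Ff A sA _ [x Ax <-]; have [_ _] := hB A sA; apply; exists f => //; exists x.
- split => // [g lg g0|u lu cu].
    apply: blin_eq => x /=; have s1 := small1 x.
    have [_ [_ sep _] _] := hB _ s1; apply: sep.
      apply/(lspanP _ (dB _ s1)); move/(lspanP _ dG): lg => [r r0 /(scG _ x _ _ s1 erefl) ?].
      by exists r.
    by apply: gauge_eq0 => e e0; apply: scG => //; apply: gauge_lt => //; rewrite g0.
  have {}cu (e : R) : 0 < e -> exists N, forall m n, (N <= m)%N -> (N <= n)%N ->
      exists2 h, G h & u m - u n = e%:C *: h.
    move=> /cu[N hN]; exists N => m n Nm Nn; apply: gauge_lt => //; last exact: hN.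
    exact: lspanB.
  have lim A x : small A -> A x -> exists l, forall e : R, 0 < e -> exists N,
      forall n, (N <= n)%N -> exists2 b, B A b & u n x - l = e%:C *: b.
    move=> sA Ax; have [_ [_ _ cpl] _] := hB A sA.
    have lx n : lspan (B A) (u n x).
      apply/(lspanP _ (dB A sA)); move/(lspanP _ dG): (lu n) => [r r0 /(scG A x _ _ sA Ax) ?].
      by exists r.
    have [//|e e0|l ll /cvgr0Pnorm_lt hl] := cpl (fun n => u n x).
      have e20 : 0 < e / 2 by rewrite divr_gt0.
      have [N hN] := cu _ e20; exists N => m n Nm Nn.
      apply: (@le_lt_trans _ _ (e / 2)); last by rewrite ltr_pdivrMr // ltr_pMr // ltr1n.
      apply: gauge_le => //; rewrite -hsubE; apply: scG => //; exact: hN.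
    exists l => e e0; have [N _ hN] := hl e e0; exists N => n Nn.
    apply: gauge_lt; [exact: dB|apply: lspanB => //; exact: dB|].
    by have := hN n Nn; rewrite ger0_norm ?gauge_ge0.
  have /choice[l hl] x : exists l, forall e : R, 0 < e -> exists N,
      forall n, (N <= n)%N -> exists2 b, B [set x] b & u n x - l = e%:C *: b.
    exact: lim (small1 x) _.
  have cl x : born_cvg (fun n => u n x) (l x).
    by have [sB _ _] := hB _ (small1 x); exists (B [set x]); last exact: hl.
  have unif (e : R) : 0 < e -> exists N, forall n A x, (N <= n)%N -> small A -> A x ->
      exists2 b, B A b & u n x - l x = e%:C *: b.
    move=> e0; have e20 : 0 < e / 2 by rewrite divr_gt0.
    have [N hN] := cu _ e20; exists N => n A x Nn sA Ax.
    have [l' hl'] := lim A x sA Ax.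
    have -> : l x = l'.
      apply: born_cvg_unique (cl x) _; exists (B A) => //; by have [] := hB _ sA.
    have [M hM] := hl' _ e20; pose m := maxn N M.
    have [b Bb bE] := hM m (leq_maxr _ _).
    have [c Bc cE] := scG A x _ _ sA Ax (hN n m Nn (leq_maxl _ _)).
    have [||z Bz zE] := @disk_combine _ _ (B A) (e / 2) (e / 2) 1 1 c b (dB A sA) e20 e20
      _ _ Bc Bb; rewrite ?normr1 //.
    exists z => //; move: zE; rewrite !scale1r -cE -bE -splitr => <-.
    by rewrite hsubE addrA subrK.
  have ll : linear l.
    move=> a x y; apply: born_cvg_unique (cl _) _.
    have := born_cvg_lin a (cl x) (cl y).
    by congr born_cvg; apply/funext => n; rewrite linearP.
  have bl : bounded_fun l.
    move=> A sA; have [N hN] := unif 1 ltr01.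
    have [sB _ _] := hB A sA.
    apply: smallS (smallD (blin_bnd (u N) sA) (smallZ (-1) sB)) => _ [x Ax <-].
    have [b Bb bE] := hN N A x (leqnn N) sA Ax.
    exists (u N x); first by exists x.
    exists (- b); first by exists b => //; rewrite scaleN1r.
    by move: bE; rewrite scale1r => <-; rewrite opprB addrC subrK.
  pose L := Blin ll bl.
  have cL (e : R) : 0 < e -> exists N, forall n, (N <= n)%N ->
      exists2 h, G h & u n - L = e%:C *: h.
    move=> e0; have [N hN] := unif e e0; exists N => n Nn.
    have neq : e%:C != 0 :> R[i] by rewrite eq_complex /= negb_and gt_eqF.
    exists (e%:C^-1 *: (u n - L)); last by rewrite scalerA divff // scale1r.
    move=> A sA _ [x Ax <-]; rewrite hscaleE hsubE.
    have [b Bb ->] := hN n A x Nn sA Ax; by rewrite scalerA mulVf // scale1r.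
  exists L; last exact: gauge_cvg0.
  have [N hN] := cL 1 ltr01; have -> : L = u N - (u N - L) by rewrite opprB addrC subrK.
  by apply: lspanB => //; apply/(lspanP _ dG); exists 1 => //; exact: hN.
- move=> A sA; have [sB _ _] := hB A sA; apply: smallS sB => _ [g Gg [x Ax <-]].
  by apply: (Gg A) => //; exists x.
Qed.

HB.instance Definition _ := isBornological.Build R (blin V W)
  equibounded1 equiboundedS equiboundedU equiboundedD equiboundedZ equibounded_banach.
End Hom.

Section Scalars.
Variable R : realType.
Local Notation C := R[i]^o.
Implicit Types (A B : set C) (z : C).

Definition scalar_small : set (set C) :=
  [set A | exists M : R, forall z, A z -> `|z| <= M%:C].

Definition cmod (z : R[i]) : R := complex.Re `|z|.
Lemma cmodE (z : R[i]) : `|z| = (cmod z)%:C.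
Proof. by rewrite /cmod RRe_real // normr_real. Qed.
Lemma cmod_ge0 (z : R[i]) : 0 <= cmod z.
Proof. by rewrite -lecR -cmodE normr_ge0. Qed.
Lemma cmodM (z w : R[i]) : cmod (z * w) = cmod z * cmod w.
Proof. by apply/(@complexI R); rewrite rmorphM /= -!cmodE normrM. Qed.
Lemma cmodD (z w : R[i]) : cmod (z + w) <= cmod z + cmod w.
Proof. by rewrite -lecR rmorphD /= -!cmodE ler_normD. Qed.
Lemma cmod_real (r : R) : 0 <= r -> cmod r%:C = r.
Proof. by move=> r0; apply/(@complexI R); rewrite -cmodE real_complex_ge0. Qed.

Lemma scalar_smallP A : scalar_small A <-> exists M : R, forall z, A z -> cmod z <= M.
Proof.
by split=> -[M h]; exists M => z /h; rewrite cmodE lecR.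
Qed.

Lemma scalar_small1 z : scalar_small [set z].
Proof. by apply/scalar_smallP; exists (cmod z) => _ ->. Qed.
Lemma scalar_smallS A B : A `<=` B -> scalar_small B -> scalar_small A.
Proof. by move=> AB [M h]; exists M => z /AB/h. Qed.
Lemma scalar_smallU A B : scalar_small A -> scalar_small B -> scalar_small (A `|` B).
Proof.
move=> /scalar_smallP[M hM] /scalar_smallP[N hN]; apply/scalar_smallP.
by exists (Num.max M N) => z [/hM|/hN] h; rewrite le_max h ?orbT.
Qed.
Lemma scalar_smallD A B : scalar_small A -> scalar_small B ->
  scalar_small [set x + y | x in A & y in B].
Proof.
move=> /scalar_smallP[M hM] /scalar_smallP[N hN]; apply/scalar_smallP.
exists (M + N) => _ [x /hM hx [y /hN hy <-]].
by apply: le_trans (cmodD _ _) _; exact: lerD.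
Qed.
Lemma scalar_smallZ (a : R[i]) A : scalar_small A -> scalar_small [set a *: x | x in A].
Proof.
move=> /scalar_smallP[M hM]; apply/scalar_smallP; exists (cmod a * M) => _ [x /hM hx <-].
by rewrite cmodM ler_wpM2l // cmod_ge0.
Qed.

Lemma scalar_banach A : scalar_small A ->
  exists B, [/\ scalar_small B, banach_disk B & A `<=` B].
Proof.
move=> /scalar_smallP[M hM]; pose r := Num.max 1 M.
have r0 : 0 < r by rewrite lt_max ltr01.
pose B : set C := [set z | cmod z <= r].
have dB : disk B.
  split=> [|a b x y ab Bx By]; first by rewrite /B /= (cmod_real (lexx 0)) ltW.
  apply: le_trans (cmodD _ _) _; rewrite !cmodM.
  apply: (@le_trans _ _ (cmod a * r + cmod b * r)).
    by apply: lerD; apply: ler_wpM2l => //; exact: cmod_ge0.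
  rewrite -mulrDl ler_piMl // ?(ltW r0) //.
  by move: ab; rewrite !cmodE -rmorphD -[1]/(1%:C) lecR.
have sc (t : R) z : 0 < t -> (exists2 y, B y & z = t%:C *: y) <-> cmod z <= t * r.
  move=> t0; split=> [[y By ->]|zt].
    by rewrite cmodM cmod_real ?(ltW t0) // ler_wpM2l // ltW.
  have neq : t%:C != 0 :> R[i] by rewrite eq_complex /= negb_and gt_eqF.
  exists (t%:C^-1 *: z); last by rewrite scalerA divff // scale1r.
  rewrite /B /= cmodM -fmorphV /= cmod_real ?invr_ge0 ?(ltW t0) //.
  by rewrite mulrC ler_pdivrMr // mulrC.
have spanB z : lspan B z.
  apply/(lspanP _ dB); exists (cmod z / r + 1).
    by rewrite ltr_wpDl // divr_ge0 ?cmod_ge0 // ltW.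
  apply/sc; first by rewrite ltr_wpDl // divr_ge0 ?cmod_ge0 // ltW.
  by rewrite mulrDl divfK ?gt_eqF // mul1r lerDl ltW.
have gaugeB z (t : R) : gauge B z < t -> cmod z <= t * r.
  move=> zt; apply/sc; first exact: le_lt_trans (gauge_ge0 _ _) zt.
  exact: gauge_lt.
exists B; split.
- by apply/scalar_smallP; exists r.
- split => // [z _ z0|u _ cu].
    apply/eqP; rewrite -normr_eq0 cmodE eq_complex /= eqxx andbT eq_le cmod_ge0 andbT.
    apply/ler_addgt0Pl => e e0; rewrite addr0.
    have rn : r != 0 by rewrite gt_eqF.
    by rewrite -[e](divfK rn); apply: gaugeB; rewrite z0 divr_gt0.
  have cR (f : R[i] -> R) : (forall x y, f (x - y) = f x - f y) ->
      (forall x, `|f x| <= cmod x) -> cvg ((fun n => f (u n)) @ \oo).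
    move=> fB fle; apply/cauchy_cvgP/cauchy_exP => e e0.
    have [|N hN] := cu (e / 2 / r); first by rewrite !divr_gt0.
    exists (f (u N)); exists N => // n Nn /=.
    rewrite /ball /= -fB; apply: le_lt_trans (fle _) _.
    apply: le_lt_trans (gaugeB _ _ (hN N n (leqnn N) Nn)) _.
    by rewrite divfK ?gt_eqF // ltr_pdivrMr // ltr_pMr // ltr1n.
  have reB (x y : R[i]) : complex.Re (x - y) = complex.Re x - complex.Re y.
    by case: x y => [? ?] [? ?].
  have imB (x y : R[i]) : complex.Im (x - y) = complex.Im x - complex.Im y.
    by case: x y => [? ?] [? ?].
  have rele (x : R[i]) : `|complex.Re x| <= cmod x.
    by rewrite -lecR -cmodE normc_ge_Re.
  have imle (x : R[i]) : `|complex.Im x| <= cmod x.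
    have := rele (x * 'i); rewrite ReiNIm normrN cmodM => /le_trans; apply.
    suff -> : cmod 'i = 1 by rewrite mulr1.
    by rewrite /cmod normc_def /= expr0n expr1n add0r sqrtr1.
  have /cvg_ex[a ha] := cR _ reB rele; have /cvg_ex[b hb] := cR _ imB imle.
  exists (a +i* b : C); first exact: spanB.
  apply: gauge_cvg0 => e e0.
  have e2 : 0 < e * r / 2 by rewrite divr_gt0 // mulr_gt0.
  move/cvgrPdist_le : ha => /(_ _ e2)[N _ hN].
  move/cvgrPdist_le : hb => /(_ _ e2)[K _ hK].
  exists (maxn N K) => n; rewrite geq_max => /andP[/hN /= h1 /hK /= h2].
  apply/sc => //.
  have -> : u n - (a +i* b : C) =
      (complex.Re (u n) - a)%:C + 'i * (complex.Im (u n) - b)%:C :> R[i].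
    by case: (u n) => x y; simpc.
  apply: le_trans (cmodD _ _) _; rewrite cmodM.
  have -> : cmod 'i = 1 by rewrite /cmod normc_def /= expr0n expr1n add0r sqrtr1.
  rewrite mul1r (splitr (e * r)).
  have cr (x : R) : cmod x%:C = `|x|.
    by rewrite /cmod normc_def /= expr0n addr0 sqrtr_sqr.
  by rewrite !cr lerD // distrC.
- by move=> z /hM h; rewrite /B /= le_max h orbT.
Qed.

HB.instance Definition _ := isBornological.Build R C
  scalar_small1 scalar_smallS scalar_smallU scalar_smallD scalar_smallZ scalar_banach.
End Scalars.

Section Bilinear.
Variable R : realType.
Implicit Types U V W X : bornType R.

Record bbilin U V W (b : U -> V -> W) : Prop := BBilin {
  bbilin_linl : forall y, linear (b^~ y);
  bbilin_linr : forall x, linear (b x);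
  bbilin_bnd : forall A B, small A -> small B -> small [set b x y | x in A & y in B] }.

Lemma uncurryP U V W (F : blin U (blin V W)) : bbilin (fun x y => F x y).
Proof.
split=> [y a x x'|x a y y'|A B sA sB]; rewrite ?linearP //.
apply: smallS (blin_bnd F sA B sB) => _ [x Ax [y By <-]].
by exists (F x); [exists x|exists y].
Qed.

Section Curry.
Variables (U V W : bornType R) (b : U -> V -> W) (hb : bbilin b).
Lemma curry_bnd x : bounded_fun (b x).
Proof.
move=> A sA; apply: smallS (bbilin_bnd hb (small1 x) sA) => _ [y Ay <-].
by exists x => //; exists y.
Qed.
Definition curry1 x : blin V W := Blin (bbilin_linr hb x) (curry_bnd x).
Lemma curry1_lin : linear curry1.
Proof. by move=> a x y; apply: blin_eq => z /=; rewrite (bbilin_linl hb). Qed.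
Lemma curry1_bnd : bounded_fun curry1.
Proof.
move=> A sA B sB; apply: smallS (bbilin_bnd hb sA sB) => _ [_ [x Ax <-] [y By <-]].
by exists x => //; exists y.
Qed.
Definition curry : blin U (blin V W) := Blin curry1_lin curry1_bnd.
End Curry.

Lemma bbilin_flip U V W (b : U -> V -> W) : bbilin b -> bbilin (fun y x => b x y).
Proof.
case=> l r h; split=> // A B sA sB.
by apply: smallS (h B A sB sA) => _ [y Ay [x Bx <-]]; exists x => //; exists y.
Qed.

Lemma bbilin_comp U V W U' V' W' (b : U -> V -> W) (h : blin W W')
  (f : blin U' U) (g : blin V' V) : bbilin b -> bbilin (fun x y => h (b (f x) (g y))).
Proof.
case=> l r bb; split=> [y a x x'|x a y y'|A B sA sB].
- by rewrite linearP l linearP.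
- by rewrite linearP r linearP.
apply: smallS (blin_bnd h (bb _ _ (blin_bnd f sA) (blin_bnd g sB))).
move=> _ [x Ax [y By <-]]; exists (b (f x) (g y)) => //.
by exists (f x); [exists x|exists (g y) => //; exists y].
Qed.
End Bilinear.

(* The completed bornological tensor product, i.e. a choice of universal
   bounded bilinear maps [V * W -> V (x) W] into complete bornological vector
   spaces. It is determined up to unique isomorphism by these fields. *)
Record tensor_product (R : realType) := TensorProduct {
  tobj : bornType R -> bornType R -> bornType R;
  tpair : forall V W : bornType R, V -> W -> tobj V W;
  tpairP : forall V W : bornType R, bbilin (@tpair V W);
  tlift : forall (V W U : bornType R) (b : V -> W -> U), bbilin b -> blin (tobj V W) U;
  tliftE : forall (V W U : bornType R) (b : V -> W -> U) (hb : bbilin b) v w,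
    tlift hb (tpair v w) = b v w;
  tens_ext : forall (V W U : bornType R) (f g : blin (tobj V W) U),
    (forall v w, f (tpair v w) = g (tpair v w)) -> f =1 g }.
Arguments tpair {R} t {V W}.

Section Tensor.
Variables (R : realType) (T : tensor_product R).
Implicit Types U V W X : bornType R.
Local Notation "V ⊗ W" := (tobj T V W) (at level 40, left associativity).
Local Notation "v ⊠ w" := (tpair T v w) (at level 40, left associativity).

Definition pairl V W (v : V) : blin W (V ⊗ W) := curry (tpairP T V W) v.
Definition pairr V W (w : W) : blin V (V ⊗ W) := curry (bbilin_flip (tpairP T V W)) w.

Definition tmap U V U' V' (f : blin U U') (g : blin V V') : blin (U ⊗ V) (U' ⊗ V') :=
  tlift T (bbilin_comp (bid (U' ⊗ V')) f g (tpairP T U' V')).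
Lemma tmapE U V U' V' (f : blin U U') (g : blin V V') u v :
  tmap f g (u ⊠ v) = f u ⊠ g v.
Proof. by rewrite tliftE. Qed.

Definition tswap U V : blin (U ⊗ V) (V ⊗ U) := tlift T (bbilin_flip (tpairP T V U)).
Lemma tswapE U V (u : U) (v : V) : tswap U V (u ⊠ v) = v ⊠ u.
Proof. by rewrite tliftE. Qed.

Section Assoc.
Variables U V W : bornType R.

Lemma assoc_bilin : bbilin (fun u v => bcomp (pairl (V ⊗ W) u) (pairl W v) :
  blin W (U ⊗ (V ⊗ W))).
Proof.
split=> [v a u u'|u a v v'|A B sA sB].
- by apply: blin_eq => w; rewrite /= (bbilin_linl (tpairP T _ _)).
- by apply: blin_eq => w; rewrite /= (bbilin_linl (tpairP T _ _)) (bbilin_linr (tpairP T _ _)).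
move=> C sC; apply: smallS (bbilin_bnd (tpairP T _ _) sA (bbilin_bnd (tpairP T V W) sB sC)).
move=> _ [_ [u Au [v Bv <-]] [w Cw <-]]; exists u => //; exists (v ⊠ w) => //.
by exists v => //; exists w.
Qed.
Definition tassoc : blin ((U ⊗ V) ⊗ W) (U ⊗ (V ⊗ W)) :=
  tlift T (uncurryP (tlift T assoc_bilin)).
Lemma tassocE (u : U) (v : V) (w : W) : tassoc ((u ⊠ v) ⊠ w) = u ⊠ (v ⊠ w).
Proof. by rewrite tliftE tliftE. Qed.

Lemma assocV_bilin : bbilin (fun v w => bcomp (pairr (U ⊗ V) w) (pairr U v) :
  blin U ((U ⊗ V) ⊗ W)).
Proof.
split=> [w a v v'|v a w w'|A B sA sB].
- by apply: blin_eq => u; rewrite /= (bbilin_linr (tpairP T _ _)) (bbilin_linl (tpairP T _ _)).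
- by apply: blin_eq => u; rewrite /= (bbilin_linr (tpairP T _ _)).
move=> C sC; apply: smallS (bbilin_bnd (tpairP T _ _) (bbilin_bnd (tpairP T U V) sC sA) sB).
move=> _ [_ [v Av [w Bw <-]] [u Cu <-]]; exists (u ⊠ v); last by exists w.
by exists u => //; exists v.
Qed.
Definition tassocV : blin (U ⊗ (V ⊗ W)) ((U ⊗ V) ⊗ W) :=
  tlift T (bbilin_flip (uncurryP (tlift T assocV_bilin))).
Lemma tassocVE (u : U) (v : V) (w : W) : tassocV (u ⊠ (v ⊠ w)) = (u ⊠ v) ⊠ w.
Proof. by rewrite tliftE tliftE. Qed.
End Assoc.
Arguments tassoc {U V W}.
Arguments tassocV {U V W}.
Arguments tswap {U V}.

Definition tmid U V W X : blin ((U ⊗ V) ⊗ (W ⊗ X)) ((U ⊗ W) ⊗ (V ⊗ X)) :=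
  bcomp tassocV (bcomp (tmap (bid U) (bcomp tassoc
    (bcomp (tmap tswap (bid X)) tassocV))) tassoc).
Lemma tmidE U V W X (u : U) (v : V) (w : W) (x : X) :
  tmid U V W X ((u ⊠ v) ⊠ (w ⊠ x)) = (u ⊠ w) ⊠ (v ⊠ x).
Proof.
by rewrite /= tassocE tmapE /= tassocVE tmapE tswapE tassocE tassocVE.
Qed.
Arguments tmid {U V W X}.

Lemma slice_r_bilin V W (w : blin W R[i]^o) : bbilin (fun v x => w x *: v : V).
Proof.
split=> [x a v v'|v a x x'|A B sA sB].
- by rewrite scalerDr !scalerA mulrC.
- by rewrite linearP scalerDl -scalerA.
have [D [sD dD AD]] := small_banach sA.
have [M hM] := blin_bnd w sB.
pose r := Num.max 1 M; have r0 : 0 < r by rewrite lt_max ltr01.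
have rn : r%:C != 0 :> R[i] by rewrite eq_complex /= negb_and gt_eqF.
apply: smallS (smallZ r%:C sD) => _ [v /AD Dv [x Bx <-]].
exists ((r%:C^-1 * w x) *: v); last by rewrite scalerA mulrA divff // mul1r.
case: dD => dD _ _; apply: disk_scale => //.
rewrite normrM normfV real_complex_ge0 ?(ltW r0) // mulrC ler_pdivrMr; last first.
  by rewrite -[0]/(0%:C) ltcR.
rewrite mul1r; apply: le_trans (hM (w x) _) _; first by exists x.
by rewrite lecR le_max lexx orbT.
Qed.
Definition slice_r V W (w : blin W R[i]^o) : blin (V ⊗ W) V :=
  tlift T (slice_r_bilin V w).
Definition slice_l V W (w : blin V R[i]^o) : blin (V ⊗ W) W :=
  tlift T (bbilin_flip (slice_r_bilin W w)).

Lemma tens_ext3 U V W X (f g : blin ((U ⊗ V) ⊗ W) X) :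
  (forall u v w, f ((u ⊠ v) ⊠ w) = g ((u ⊠ v) ⊠ w)) -> f =1 g.
Proof.
move=> h; apply: tens_ext => x w.
suff /(_ x) : bcomp f (pairr (U ⊗ V) w) =1 bcomp g (pairr (U ⊗ V) w) by [].
by apply: tens_ext => u v; exact: h.
Qed.

(* Leg numbering for maps [V (x) H -> V (x) H], on [V (x) H (x) H] ... *)
Definition leg12 V H (e : blin (V ⊗ H) (V ⊗ H)) :
    blin (V ⊗ (H ⊗ H)) (V ⊗ (H ⊗ H)) :=
  bcomp tassoc (bcomp (tmap e (bid H)) tassocV).
Definition leg13 V H (e : blin (V ⊗ H) (V ⊗ H)) :
    blin (V ⊗ (H ⊗ H)) (V ⊗ (H ⊗ H)) :=
  bcomp (tmap (bid V) tswap) (bcomp (leg12 e) (tmap (bid V) tswap)).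
(* ... and on [V (x) W (x) H]. *)
Definition coleg23 V W H (e : blin (W ⊗ H) (W ⊗ H)) :
    blin ((V ⊗ W) ⊗ H) ((V ⊗ W) ⊗ H) :=
  bcomp tassocV (bcomp (tmap (bid V) e) tassoc).
Definition coleg13 V W H (e : blin (V ⊗ H) (V ⊗ H)) :
    blin ((V ⊗ W) ⊗ H) ((V ⊗ W) ⊗ H) :=
  bcomp (tmap tswap (bid H)) (bcomp (coleg23 W e) (tmap tswap (bid H))).
End Tensor.
Arguments tassoc {R T U V W}.
Arguments tassocV {R T U V W}.
Arguments tswap {R T U V}.
Arguments tmid {R T U V W X}.
Arguments slice_r {R T} V {W} w.
Arguments slice_l {R T V} W w.
Arguments pairl {R T V} W v.
Arguments pairr {R T} V {W} w.

Section ClosureQuotient.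
Variables (R : realType) (V W : bornType R).

Definition born_closed (F : set V) : Prop :=
  forall u l, (forall n, F (u n)) -> born_cvg u l -> F l.
Definition born_closure (A : set V) : set V :=
  [set x | forall F, A `<=` F -> born_closed F -> F x].

(* [q] vanishes on [N] and induces an isomorphism of bornological vector
   spaces from the quotient [V / N] onto [W]; the small subsets of [V / N] are
   the images of the small subsets of [V]. *)
Definition induces_iso (q : blin V W) (N : set V) : Prop :=
  (forall x, q x = 0 <-> N x) /\
  (forall A, small A -> exists2 B, small B & A = q @` B).
End ClosureQuotient.

Section ApproximationProperty.
Variables (R : realType) (V : bornType R).
Implicit Types (S B : set V).

Definition gauge_open B (U : set V) : Prop := forall x, lspan B x -> U x ->
  exists2 e, 0 < e & forall y, lspan B y -> gauge B (y - x) < e -> U y.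

(* Compactness of [S] in the normed space [lspan B] with norm [gauge B]. *)
Definition gauge_compact B S : Prop := S `<=` lspan B /\
  forall O : set (set V), (forall U, O U -> gauge_open B U) ->
    S `<=` \bigcup_(U in O) U ->
    exists O', [/\ O' `<=` O, finite_set O' & S `<=` \bigcup_(U in O') U].

Definition compact_disk S : Prop :=
  disk S /\ exists B, [/\ small B, banach_disk B & gauge_compact B S].

Definition finite_rank (f : blin V V) : Prop :=
  exists n (s : 'I_n -> V), forall x, lspan (range s) (f x).

(* Bornological convergence of the restrictions of [f n] to the restriction of
   [g] in Hom(<S>, V); here [F] is an equibounded set of maps on <S>. *)
Definition hom_cvg S (f : nat -> blin V V) (g : blin V V) : Prop :=
  exists F : set (V -> V),
    (forall r : R, 0 < r ->
       small [set phi (r%:C *: x) | phi in F & x in S]) /\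
    forall e : R, 0 < e -> exists N, forall n, (N <= n)%N ->
      exists2 phi, F phi & forall x, lspan S x -> f n x - g x = e%:C *: phi x.

Definition approximation_property : Prop :=
  forall S, compact_disk S ->
    exists f : nat -> blin V V, (forall n, finite_rank (f n)) /\ hom_cvg S f (bid V).
End ApproximationProperty.

Section Algebras.
Variables (R : realType) (T : tensor_product R).
Local Notation "V ⊗ W" := (tobj T V W) (at level 40, left associativity).
Local Notation "v ⊠ w" := (tpair T v w) (at level 40, left associativity).
Local Notation C := (R[i]^o : bornType R).

Record balg := BAlg {
  balg_sort :> bornType R;
  amul : blin (balg_sort ⊗ balg_sort) balg_sort;
  amulA : forall x y z, amul (amul (x ⊠ y) ⊠ z) = amul (x ⊠ amul (y ⊠ z)) }.
Local Notation "x ∙ y" := (amul _ (x ⊠ y)) (at level 40, left associativity).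

Definition lmulb (A : balg) (a : A) : blin A A := bcomp (amul A) (pairl A a).
Definition rmulb (A : balg) (a : A) : blin A A := bcomp (amul A) (pairr A a).

(* The subspace of [M (x) V] such that [M (x)_A V] is the quotient by it, for a
   right action [rho] on [M] and a left action [lam] on [V]. *)
Definition balanced (A : balg) (M V : bornType R) (rho : blin (M ⊗ A) M)
    (lam : blin (A ⊗ V) V) : set (M ⊗ V) :=
  born_closure (lspan [set z | exists m a v,
    z = rho (m ⊠ a) ⊠ v - m ⊠ lam (a ⊠ v)]).

Definition ess_left (A : balg) (V : bornType R) (lam : blin (A ⊗ V) V) : Prop :=
  induces_iso lam (balanced (amul A) lam).
Definition ess_right (A : balg) (V : bornType R) (rho : blin (V ⊗ A) V) : Prop :=
  induces_iso rho (balanced rho (amul A)).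
Definition ess_algebra (A : balg) : Prop :=
  (exists x : A, x <> 0) /\ induces_iso (amul A) (balanced (amul A) (amul A)).

Section TensorAlgebra.
Variables A B : balg.
Definition tmul : blin ((A ⊗ B) ⊗ (A ⊗ B)) (A ⊗ B) :=
  bcomp (tmap T (amul A) (amul B)) tmid.
Lemma tmulE a b a' b' : tmul ((a ⊠ b) ⊠ (a' ⊠ b')) = (a ∙ a') ⊠ (b ∙ b').
Proof. by rewrite bcompE tmidE tmapE. Qed.
Lemma tmulA x y z : tmul (tmul (x ⊠ y) ⊠ z) = tmul (x ⊠ tmul (y ⊠ z)).
Proof.
move: x; apply: (@tens_ext _ T _ _ _
  (bcomp tmul (bcomp (pairr _ z) (bcomp tmul (pairr _ y))))
  (bcomp tmul (pairr _ (tmul (y ⊠ z))))) => a b.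
move: y; apply: (@tens_ext _ T _ _ _
  (bcomp tmul (bcomp (pairr _ z) (bcomp tmul (pairl _ (a ⊠ b)))))
  (bcomp tmul (bcomp (pairl _ (a ⊠ b)) (bcomp tmul (pairr _ z))))) => a' b'.
move: z; apply: (@tens_ext _ T _ _ _
  (bcomp tmul (pairl _ (tmul (a ⊠ b ⊠ (a' ⊠ b')))))
  (bcomp tmul (bcomp (pairl _ (a ⊠ b)) (bcomp tmul (pairl _ (a' ⊠ b')))))) => a'' b''.
suff : tmul (tmul (a ⊠ b ⊠ (a' ⊠ b')) ⊠ (a'' ⊠ b'')) =
       tmul ((a ⊠ b) ⊠ tmul (a' ⊠ b' ⊠ (a'' ⊠ b''))) by [].
by rewrite !tmulE !amulA.
Qed.
Definition talg : balg := BAlg tmulA.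
End TensorAlgebra.

(* Multipliers; [mL m] and [mR m] are left and right multiplication by [m]. *)
Record mult (A : balg) := Mult {
  mL : blin A A;
  mR : blin A A;
  mL_mul : forall x y, mL (x ∙ y) = mL x ∙ y;
  mR_mul : forall x y, mR (x ∙ y) = x ∙ mR y;
  mLR : forall x y, x ∙ mL y = mR x ∙ y }.

Definition meq (A : balg) (m n : mult A) : Prop := mL m =1 mL n /\ mR m =1 mR n.

Section Multipliers.
Variable A : balg.

Lemma miota_L (a x y : A) : lmulb a (x ∙ y) = lmulb a x ∙ y.
Proof. by rewrite /= amulA. Qed.
Lemma miota_R (a x y : A) : rmulb a (x ∙ y) = x ∙ rmulb a y.
Proof. by rewrite /= amulA. Qed.
Lemma miota_LR (a x y : A) : x ∙ lmulb a y = rmulb a x ∙ y.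
Proof. by rewrite /= amulA. Qed.
(* The canonical map from [A] to [M(A)]. *)
Definition miota (a : A) : mult A := Mult (miota_L a) (miota_R a) (miota_LR a).

Definition mone : mult A :=
  @Mult A (bid A) (bid A) (fun _ _ => erefl) (fun _ _ => erefl) (fun _ _ => erefl).

Lemma mscalar_L (c : R[i]) x y : (c *: bid A) (x ∙ y) = (c *: bid A) x ∙ y.
Proof. exact: (esym (linearZ_LR (rmulb y) c x)). Qed.
Lemma mscalar_R (c : R[i]) x y : (c *: bid A) (x ∙ y) = x ∙ (c *: bid A) y.
Proof. exact: (esym (linearZ_LR (lmulb x) c y)). Qed.
Lemma mscalar_LR (c : R[i]) x y : x ∙ (c *: bid A) y = (c *: bid A) x ∙ y.
Proof. by rewrite -mscalar_L mscalar_R. Qed.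
Definition mscalar (c : R[i]) : mult A :=
  Mult (mscalar_L c) (mscalar_R c) (mscalar_LR c).

Lemma mmul_L (m n : mult A) x y :
  bcomp (mL m) (mL n) (x ∙ y) = bcomp (mL m) (mL n) x ∙ y.
Proof. by rewrite /= !mL_mul. Qed.
Lemma mmul_R (m n : mult A) x y :
  bcomp (mR n) (mR m) (x ∙ y) = x ∙ bcomp (mR n) (mR m) y.
Proof. by rewrite /= !mR_mul. Qed.
Lemma mmul_LR (m n : mult A) x y :
  x ∙ bcomp (mL m) (mL n) y = bcomp (mR n) (mR m) x ∙ y.
Proof. by rewrite /= !mLR. Qed.
Definition mmul (m n : mult A) : mult A :=
  Mult (@mmul_L m n) (@mmul_R m n) (@mmul_LR m n).

Definition msmall (S : set (mult A)) : Prop :=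
  small [set mL m | m in S] /\ small [set mR m | m in S].
End Multipliers.

Section TensorMultiplier.
Variables (A B : balg) (m : mult A) (n : mult B).
Local Notation AB := (talg A B).
Local Notation "x * y" := (amul AB (tpair T (V := AB) (W := AB) x y)).
Definition mtensL : blin AB AB := tmap T (mL m) (mL n).
Definition mtensR : blin AB AB := tmap T (mR m) (mR n).

Lemma talg_ext (P Q : blin AB (blin AB AB)) :
  (forall a b a' b', P (a ⊠ b) (a' ⊠ b') = Q (a ⊠ b) (a' ⊠ b')) ->
  forall x y, P x y = Q x y.
Proof.
move=> h x y; congr (blin_fun _ y); move: x; apply: tens_ext => a b.
by apply: blin_eq; apply: tens_ext => a' b'; exact: h.
Qed.

Lemma talgE a b a' b' : (a ⊠ b) * (a' ⊠ b') = (a ∙ a') ⊠ (b ∙ b').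
Proof. exact: tmulE. Qed.
Lemma mtensLE a b : mtensL (a ⊠ b) = mL m a ⊠ mL n b. Proof. exact: tmapE. Qed.
Lemma mtensRE a b : mtensR (a ⊠ b) = mR m a ⊠ mR n b. Proof. exact: tmapE. Qed.

Let muP (f g h : blin AB AB) : bbilin (fun x y : AB => f (g x * h y)) :=
  bbilin_comp (bcomp f (amul AB)) g h (tpairP T AB AB).
Let I := bid AB.

Lemma mtensL_mul (x y : AB) : mtensL (x * y) = mtensL x * y.
Proof.
apply: (talg_ext (P := curry (muP mtensL I I)) (Q := curry (muP I mtensL I))).
move=> a b a' b'.
suff : mtensL ((a ⊠ b) * (a' ⊠ b')) = mtensL (a ⊠ b) * (a' ⊠ b') by [].
by rewrite !(talgE, mtensLE) !mL_mul.
Qed.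

Lemma mtensR_mul (x y : AB) : mtensR (x * y) = x * mtensR y.
Proof.
apply: (talg_ext (P := curry (muP mtensR I I)) (Q := curry (muP I I mtensR))).
move=> a b a' b'.
suff : mtensR ((a ⊠ b) * (a' ⊠ b')) = (a ⊠ b) * mtensR (a' ⊠ b') by [].
by rewrite !(talgE, mtensRE) !mR_mul.
Qed.

Lemma mtensLR (x y : AB) : x * mtensL y = mtensR x * y.
Proof.
apply: (talg_ext (P := curry (muP I I mtensL)) (Q := curry (muP I mtensR I))).
move=> a b a' b'.
suff : (a ⊠ b) * mtensL (a' ⊠ b') = mtensR (a ⊠ b) * (a' ⊠ b') by [].
by rewrite !(mtensLE, mtensRE) !talgE !mLR.
Qed.

Definition mtens : mult AB := Mult mtensL_mul mtensR_mul mtensLR.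
End TensorMultiplier.

(* Homomorphisms (bounded, linear and multiplicative) from [A] to [M(K)]. *)
Record mhom (A K : balg) := MHom {
  mh_fun :> A -> mult K;
  mh_linL : linear (fun a => mL (mh_fun a));
  mh_linR : linear (fun a => mR (mh_fun a));
  mh_bnd : forall S, small S -> msmall (mh_fun @` S);
  mh_mul : forall a b, meq (mh_fun (a ∙ b)) (mmul (mh_fun a) (mh_fun b)) }.

Section Homs.
Variables (A K : balg) (f : mhom A K).

Lemma mh_bndL : bounded_fun (fun a => mL (f a)).
Proof. by move=> S /(mh_bnd f)[+ _]; rewrite image_comp. Qed.
Lemma mh_bndR : bounded_fun (fun a => mR (f a)).
Proof. by move=> S /(mh_bnd f)[_ +]; rewrite image_comp. Qed.

(* The left and right action of [A] on [K] through [f]. *)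
Definition mh_left : blin (A ⊗ K) K :=
  tlift T (uncurryP (Blin (mh_linL f) mh_bndL)).
Definition mh_right : blin (K ⊗ A) K :=
  tlift T (bbilin_flip (uncurryP (Blin (mh_linR f) mh_bndR))).
Lemma mh_leftE a k : mh_left (a ⊠ k) = mL (f a) k.
Proof. by rewrite tliftE. Qed.
Lemma mh_rightE k a : mh_right (k ⊠ a) = mR (f a) k.
Proof. by rewrite tliftE. Qed.

Definition ess_hom : Prop := ess_left mh_left /\ ess_right mh_right.

(* [n] is the value at [m] of the extension of [f] to [M(A) -> M(K)]. *)
Definition extends_at (m : mult A) (n : mult K) : Prop :=
  (forall a k, mL n (mL (f a) k) = mL (f (mL m a)) k) /\
  (forall a k, mR n (mR (f a) k) = mR (f (mR m a)) k).
End Homs.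

Section IdentityHom.
Variable A : balg.
Let mulP := bbilin_comp (amul A) (bid A) (bid A) (tpairP T A A).
Let mulPf := bbilin_flip mulP.
Let lmulbE : (fun a => lmulb a) = curry mulP.
Proof. by apply/funext => a; exact: blin_eq. Qed.
Let rmulbE : (fun a => rmulb a) = curry mulPf.
Proof. by apply/funext => a; exact: blin_eq. Qed.

Lemma miota_linL : linear (fun a : A => mL (miota a)).
Proof. by rewrite [X in linear X]lmulbE; exact: blin_lin. Qed.
Lemma miota_linR : linear (fun a : A => mR (miota a)).
Proof. by rewrite [X in linear X]rmulbE; exact: blin_lin. Qed.
Lemma miota_bnd S : small S -> msmall (@miota A @` S).
Proof.
move=> sS; split; rewrite image_comp.
  by rewrite [X in small (X @` _)]lmulbE; exact: blin_bnd.
by rewrite [X in small (X @` _)]rmulbE; exact: blin_bnd.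
Qed.
Lemma miota_mul (a b : A) : meq (miota (a ∙ b)) (mmul (miota a) (miota b)).
Proof. by split=> x /=; rewrite amulA. Qed.
Definition mh_id : mhom A A := MHom miota_linL miota_linR miota_bnd miota_mul.
End IdentityHom.

Section TensorHom.
Variables (A B K L : balg) (f : mhom A K) (g : mhom B L).
Local Notation KL := (talg K L).
Local Notation AB := (talg A B).

Definition mht_left : blin (AB ⊗ KL) KL := bcomp (tmap T (mh_left f) (mh_left g)) tmid.
Definition mht_right : blin (KL ⊗ AB) KL := bcomp (tmap T (mh_right f) (mh_right g)) tmid.

Lemma mht_leftE a b (k : KL) : mht_left ((a ⊠ b : AB) ⊠ k) = mL (mtens (f a) (g b)) k.
Proof.
move: k; apply: (@tens_ext _ T _ _ _ (bcomp mht_left (pairl KL (a ⊠ b : AB)))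
  (mL (mtens (f a) (g b)))) => k l.
suff : mht_left ((a ⊠ b) ⊠ (k ⊠ l)) = mtensL (f a) (g b) (k ⊠ l) by [].
by rewrite mtensLE bcompE tmidE tmapE !mh_leftE.
Qed.
Lemma mht_rightE a b (k : KL) : mht_right (k ⊠ (a ⊠ b : AB)) = mR (mtens (f a) (g b)) k.
Proof.
move: k; apply: (@tens_ext _ T _ _ _ (bcomp mht_right (pairr KL (a ⊠ b : AB)))
  (mR (mtens (f a) (g b)))) => k l.
suff : mht_right ((k ⊠ l) ⊠ (a ⊠ b)) = mtensR (f a) (g b) (k ⊠ l) by [].
by rewrite mtensRE bcompE tmidE tmapE !mh_rightE.
Qed.

Definition mhtL (z : AB) : blin KL KL := bcomp mht_left (pairl KL z).
Definition mhtR (z : AB) : blin KL KL := bcomp mht_right (pairr KL z).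
Lemma mhtLE a b k : mhtL (a ⊠ b : AB) k = mL (mtens (f a) (g b)) k.
Proof. exact: mht_leftE. Qed.
Lemma mhtRE a b k : mhtR (a ⊠ b : AB) k = mR (mtens (f a) (g b)) k.
Proof. exact: mht_rightE. Qed.

Lemma mhtL_mul z (x y : KL) : mhtL z (x ∙ y) = mhtL z x ∙ y.
Proof.
move: z; apply: (@tens_ext _ T _ _ _ (bcomp mht_left (pairr AB (x ∙ y)))
  (bcomp (rmulb y) (bcomp mht_left (pairr AB x)))) => a b.
suff : mhtL (a ⊠ b) (x ∙ y) = mhtL (a ⊠ b) x ∙ y by [].
by rewrite !mhtLE mL_mul.
Qed.
Lemma mhtR_mul z (x y : KL) : mhtR z (x ∙ y) = x ∙ mhtR z y.
Proof.
move: z; apply: (@tens_ext _ T _ _ _ (bcomp mht_right (pairl AB (x ∙ y)))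
  (bcomp (lmulb x) (bcomp mht_right (pairl AB y)))) => a b.
suff : mhtR (a ⊠ b) (x ∙ y) = x ∙ mhtR (a ⊠ b) y by [].
by rewrite !mhtRE mR_mul.
Qed.
Lemma mhtLR z (x y : KL) : x ∙ mhtL z y = mhtR z x ∙ y.
Proof.
move: z; apply: (@tens_ext _ T _ _ _ (bcomp (lmulb x) (bcomp mht_left (pairr AB y)))
  (bcomp (rmulb y) (bcomp mht_right (pairl AB x)))) => a b.
suff : x ∙ mhtL (a ⊠ b) y = mhtR (a ⊠ b) x ∙ y by [].
by rewrite mhtLE mhtRE mLR.
Qed.
Definition mht_fun (z : AB) : mult KL := Mult (@mhtL_mul z) (@mhtR_mul z) (@mhtLR z).

Let leftP := bbilin_comp mht_left (bid AB) (bid KL) (tpairP T AB KL).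
Let rightP := bbilin_flip (bbilin_comp mht_right (bid KL) (bid AB) (tpairP T KL AB)).
Let mhtLE' : mhtL = curry leftP.
Proof. by apply/funext => z; exact: blin_eq. Qed.
Let mhtRE' : mhtR = curry rightP.
Proof. by apply/funext => z; exact: blin_eq. Qed.

Lemma mht_linL : linear (fun z => mL (mht_fun z)).
Proof. by rewrite [X in linear X]mhtLE'; exact: blin_lin. Qed.
Lemma mht_linR : linear (fun z => mR (mht_fun z)).
Proof. by rewrite [X in linear X]mhtRE'; exact: blin_lin. Qed.
Lemma mht_bnd S : small S -> msmall (mht_fun @` S).
Proof.
move=> sS; split; rewrite image_comp.
  by rewrite [X in small (X @` _)]mhtLE'; exact: blin_bnd.
by rewrite [X in small (X @` _)]mhtRE'; exact: blin_bnd.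
Qed.

Lemma mhtL_comp z w : mhtL (z ∙ w) =1 mhtL z \o mhtL w.
Proof.
move=> k /=; move: z; apply: (@tens_ext _ T _ _ _
  (bcomp mht_left (bcomp (pairr AB k) (rmulb w)))
  (bcomp mht_left (pairr AB (mhtL w k)))) => a b.
move: w; apply: (@tens_ext _ T _ _ _
  (bcomp mht_left (bcomp (pairr AB k) (lmulb (a ⊠ b : AB))))
  (bcomp (mhtL (a ⊠ b)) (bcomp mht_left (pairr AB k)))) => a' b'.
move: k; apply: (@tens_ext _ T _ _ _ (mhtL ((a ⊠ b : AB) ∙ (a' ⊠ b' : AB)))
  (bcomp (mhtL (a ⊠ b)) (mhtL (a' ⊠ b')))) => k l.
suff : mhtL ((a ⊠ b : AB) ∙ (a' ⊠ b' : AB)) (k ⊠ l) =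
       mhtL (a ⊠ b) (mhtL (a' ⊠ b') (k ⊠ l)) by [].
have E m n u v : mL (mtens m n) (u ⊠ v) = mL m u ⊠ mL n v by exact: mtensLE.
rewrite talgE !mhtLE !E.
by rewrite (mh_mul f a a').1 (mh_mul g b b').1.
Qed.
Lemma mhtR_comp z w : mhtR (z ∙ w) =1 mhtR w \o mhtR z.
Proof.
move=> k /=; move: z; apply: (@tens_ext _ T _ _ _
  (bcomp mht_right (bcomp (pairl AB k) (rmulb w)))
  (bcomp (mhtR w) (bcomp mht_right (pairl AB k)))) => a b.
move: w; apply: (@tens_ext _ T _ _ _
  (bcomp mht_right (bcomp (pairl AB k) (lmulb (a ⊠ b : AB))))
  (bcomp mht_right (pairl AB (mhtR (a ⊠ b) k)))) => a' b'.
move: k; apply: (@tens_ext _ T _ _ _ (mhtR ((a ⊠ b : AB) ∙ (a' ⊠ b' : AB)))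
  (bcomp (mhtR (a' ⊠ b')) (mhtR (a ⊠ b)))) => k l.
suff : mhtR ((a ⊠ b : AB) ∙ (a' ⊠ b' : AB)) (k ⊠ l) =
       mhtR (a' ⊠ b') (mhtR (a ⊠ b) (k ⊠ l)) by [].
have E m n u v : mR (mtens m n) (u ⊠ v) = mR m u ⊠ mR n v by exact: mtensRE.
rewrite talgE !mhtRE !E.
by rewrite (mh_mul f a a').2 (mh_mul g b b').2.
Qed.
Lemma mht_mul z w : meq (mht_fun (z ∙ w)) (mmul (mht_fun z) (mht_fun w)).
Proof. by split; [exact: mhtL_comp|exact: mhtR_comp]. Qed.
Definition mh_tens : mhom AB KL := MHom mht_linL mht_linR mht_bnd mht_mul.
End TensorHom.

End Algebras.

Section QuantumGroups.
Variables (R : realType) (T : tensor_product R).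
Local Notation "V ⊗ W" := (tobj T V W) (at level 40, left associativity).
Local Notation "v ⊠ w" := (tpair T v w) (at level 40, left associativity).
Local Notation "x ∙ y" := (amul _ (x ⊠ y)) (at level 40, left associativity).
Local Notation C := (R[i]^o : bornType R).

Definition cmul : blin (C ⊗ C) C := slice_l C (bid C).
Lemma cmulE (x y : C) : cmul (x ⊠ y) = (x : R[i]) * y.
Proof. by rewrite tliftE. Qed.
Lemma cmulA (x y z : C) : cmul (cmul (x ⊠ y) ⊠ z) = cmul (x ⊠ cmul (y ⊠ z)).
Proof. by rewrite !cmulE mulrA. Qed.
Definition calg : balg T := BAlg cmulA.

Section Comultiplications.
Variables (H : balg T) (Delta : mhom H (talg H H)).
Local Notation HH := (talg H H).
Implicit Types (g : blin (H ⊗ H) (H ⊗ H)) (w : blin H C) (x y : H).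

(* [(Delta (x) id) Delta = (id (x) Delta) Delta], with both sides defined by the
   extensions to multipliers and compared through the identification of
   [(H (x) H) (x) H] with [H (x) (H (x) H)]. *)
Definition coassociative : Prop := forall h : H,
  exists (X : mult (talg HH H)) (Y : mult (talg H HH)),
    [/\ extends_at (mh_tens Delta (mh_id H)) (Delta h) X,
        extends_at (mh_tens (mh_id H) Delta) (Delta h) Y,
        forall z, tassoc (mL X z) = mL Y (tassoc z)
      & forall z, tassoc (mR X z) = mR Y (tassoc z)].

Definition is_gamma_l g : Prop := forall x y,
  meq (miota (g (x ⊠ y) : HH)) (mmul (Delta x) (mtens (miota y) (mone H))).
Definition is_gamma_r g : Prop := forall x y,
  meq (miota (g (x ⊠ y) : HH)) (mmul (Delta x) (mtens (mone H) (miota y))).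
Definition is_rho_l g : Prop := forall x y,
  meq (miota (g (x ⊠ y) : HH)) (mmul (mtens (miota x) (mone H)) (Delta y)).
Definition is_rho_r g : Prop := forall x y,
  meq (miota (g (x ⊠ y) : HH)) (mmul (mtens (mone H) (miota x)) (Delta y)).

Definition faithful w : Prop :=
  (forall x, (forall y, w (x ∙ y) = 0) -> x = 0) /\
  (forall y, (forall x, w (x ∙ y) = 0) -> y = 0).

(* [m] is the multiplier [(id (x) w) Delta(x)], resp. [(w (x) id) Delta(x)];
   [gl], [gr], [rl], [rr] are the Galois maps. *)
Definition is_slice_r (gl rl : blin (H ⊗ H) (H ⊗ H)) w x (m : mult H) : Prop :=
  (forall y, mL m y = slice_r H w (gl (x ⊠ y))) /\
  (forall y, mR m y = slice_r H w (rl (y ⊠ x))).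
Definition is_slice_l (gr rr : blin (H ⊗ H) (H ⊗ H)) w x (m : mult H) : Prop :=
  (forall y, mL m y = slice_l H w (gr (x ⊠ y))) /\
  (forall y, mR m y = slice_l H w (rr (y ⊠ x))).
End Comultiplications.


(* Bornological quantum groups. The inverses of the Galois maps are part of
   the isomorphisms [gamma_l], etc. *)
Record bqg := BQG {
  qalg :> balg T;
  q_essential : ess_algebra qalg;
  q_approx : approximation_property qalg;
  Delta : mhom qalg (talg qalg qalg);
  Delta_essential : ess_hom Delta;
  Delta_coassoc : coassociative Delta;
  gamma_l : biso (qalg ⊗ qalg) (qalg ⊗ qalg);
  gamma_r : biso (qalg ⊗ qalg) (qalg ⊗ qalg);
  rho_l : biso (qalg ⊗ qalg) (qalg ⊗ qalg);
  rho_r : biso (qalg ⊗ qalg) (qalg ⊗ qalg);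
  gamma_lP : is_gamma_l Delta gamma_l;
  gamma_rP : is_gamma_r Delta gamma_r;
  rho_lP : is_rho_l Delta rho_l;
  rho_rP : is_rho_r Delta rho_r;
  phi : blin qalg C;
  phi_faithful : faithful phi;
  phi_left_invariant : forall x,
    is_slice_r gamma_l rho_l phi x (mscalar qalg (phi x)) }.

Section BQG.
Variable H : bqg.

Definition right_invariant (psi : blin H C) : Prop := forall x : H,
  is_slice_l (gamma_r H) (rho_r H) psi x (mscalar H (psi x)).

(* The functional [eps] is, as a map into [C], contained in [M(C)], an
   essential homomorphism, and satisfies the counit equations in [M(H)]. *)
Definition counit (eps : blin H C) : Prop :=
  (exists2 f : mhom H calg, ess_hom f & forall x, meq (f x) (miota (eps x : calg))) /\
  (forall x : H, is_slice_l (gamma_r H) (rho_r H) eps x (miota x)) /\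
  (forall x : H, is_slice_r (gamma_l H) (rho_l H) eps x (miota x)).

Record essmod (V : bornType R) := EssMod {
  act :> blin (H ⊗ V) V;
  act_mul : forall x y v, act ((x ∙ y) ⊠ v) = act (x ⊠ act (y ⊠ v));
  act_essential : ess_left act }.

Record esscomod (V : bornType R) := EssComod {
  coact :> biso (V ⊗ H) (V ⊗ H);
  coact_mul : forall y z, coact (tmap T (bid V) (rmulb y) z) =
    tmap T (bid V) (rmulb y) (coact z);
  coact_coassoc : forall z,
    tmap T (bid V) (gamma_r H)
      (leg12 coact (tmap T (bid V) (biso_inv (gamma_r H)) z)) =
    leg12 coact (leg13 coact z) }.

Definition linear_over V W (lamV : essmod V) (lamW : essmod W) (f : blin V W) : Prop :=
  forall x v, f (lamV (x ⊠ v)) = lamW (x ⊠ f v).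

Definition colinear V W (etaV : esscomod V) (etaW : esscomod W) (f : blin V W) : Prop :=
  forall z, etaW (tmap T f (bid H) z) = tmap T f (bid H) (etaV z).

Definition act2 V W (lamV : essmod V) (lamW : essmod W) :
    blin ((H ⊗ H) ⊗ (V ⊗ W)) (V ⊗ W) :=
  bcomp (tmap T lamV lamW) tmid.

(* [lam] is the tensor product module [V (x) W]: under the isomorphisms
   [V (x) W = (H (x) H) (x)_(H (x) H) (V (x) W)], an element [x] of H acts by
   left multiplication with [Delta(x)] on the factor [H (x) H]. *)
Definition is_tensor_module V W (lamV : essmod V) (lamW : essmod W)
    (lam : essmod (V ⊗ W)) : Prop :=
  forall (x : H) (z : H ⊗ H) (u : V ⊗ W),
    lam (x ⊠ act2 lamV lamW (z ⊠ u)) =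
    act2 lamV lamW ((mL (Delta H x) z : H ⊗ H) ⊠ u).

(* The tensor product coaction [eta_V^13 eta_W^23]. *)
Definition tensor_coact V W (etaV : esscomod V) (etaW : esscomod W) :
    blin ((V ⊗ W) ⊗ H) ((V ⊗ W) ⊗ H) :=
  bcomp (coleg13 W etaV) (coleg23 V etaW).
End BQG.

(* [Hd] is the dual quantum group of [H]: it embeds by [dual_ev] into the dual
   space of [H], with image and bornology transported from [H] along any of
   [Fl], [Fr], [Gl], [Gr]. *)
Record dual_of (H Hd : bqg) := DualOf {
  dual_psi : blin H C;
  dual_psi_faithful : faithful dual_psi;
  dual_psi_invariant : right_invariant dual_psi;
  dual_eps : blin H C;
  dual_eps_counit : counit dual_eps;
  dual_ev : blin Hd (blin H C);
  dual_ev_inj : injective dual_ev;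
  Fl : biso H Hd;
  Fr : biso H Hd;
  Gl : biso H Hd;
  Gr : biso H Hd;
  FlE : forall f h, dual_ev (Fl f) h = phi H (h ∙ f);
  FrE : forall f h, dual_ev (Fr f) h = phi H (f ∙ h);
  GlE : forall f h, dual_ev (Gl f) h = dual_psi (h ∙ f);
  GrE : forall f h, dual_ev (Gr f) h = dual_psi (f ∙ h);
  dual_mul : forall f g : H, Fl f ∙ Fl g =
    Fl (slice_r H (phi H) (biso_inv (gamma_l H) (f ⊠ g)));
  dual_gamma_r : forall f g : H, gamma_r Hd (Fl f ⊠ Fl g) =
    tmap T Fl Fl (tswap (biso_inv (gamma_l H) (f ⊠ g)));
  dual_rho_l : forall f g : H, rho_l Hd (Gr g ⊠ Gr f) =
    tmap T Gr Gr (tswap (biso_inv (rho_r H) (g ⊠ f)));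
  dual_phi : forall f, phi Hd (Gr f) = dual_eps f }.

Definition bqg_iso (H K : bqg) (P : biso H K) : Prop :=
  [/\ forall x y : H, P (x ∙ y) = P x ∙ P y,
      forall (x : H) (z : H ⊗ H),
        mL (Delta K (P x)) (tmap T P P z) = tmap T P P (mL (Delta H x) z)
    & forall (x : H) (z : H ⊗ H),
        mR (Delta K (P x)) (tmap T P P z) = tmap T P P (mR (Delta H x) z)].

Section Duality.
Variables (H Hd : bqg) (d : dual_of H Hd).

(* D(eta) (F_l(f) (x) v) = (id (x) phi) eta (v (x) f). *)
Definition D_comod V (eta : esscomod H V) : blin (Hd ⊗ V) V :=
  bcomp (slice_r V (phi H))
    (bcomp eta (bcomp tswap (tmap T (biso_inv (Fl d)) (bid V)))).

(* [eta] is [D(lam)]. An element [y] of [H (x) V] represents the element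
   [lam^-1 (lam y)] of [H (x)_H V], so that [lam] being onto, this equation is
   D(lam) (v (x) F_l(f)) = (id (x) F_l) tau (id (x) lam)
     (gamma_l^-1 tau (x) id) (id (x) lam^-1) (f (x) v). *)
Definition is_D_mod V (lam : essmod H V) (eta : esscomod Hd V) : Prop :=
  forall (f : H) (y : H ⊗ V),
    eta (lam y ⊠ Fl d f) =
    tmap T (bid V) (Fl d) (tswap (tmap T (bid H) lam (tassoc
      (tmap T (bcomp (biso_inv (gamma_l H)) tswap) (bid V) (tassocV (f ⊠ y)))))).
End Duality.

Definition act_along (H K : bqg) (P : biso H K) V (lam : blin (K ⊗ V) V) :
    blin (H ⊗ V) V :=
  bcomp lam (tmap T P (bid V)).

End QuantumGroups.

(* Main.v *)
Require Import Defs.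
From HB Require Import structures.
From mathcomp Require Import all_boot all_order all_algebra.
From mathcomp Require Import complex.
From mathcomp Require Import all_classical all_reals topology normedtype sequences.
From mathcomp Require Import ring lra zify.
Set Implicit Arguments.
Unset Strict Implicit.
Unset Printing Implicit Defensive.
Import Order.TTheory GRing.Theory Num.Theory numFieldNormedType.Exports.

(* Let A be the dual of H. The coaction of A on the regular module H is
   Gamma = (id (x) F_l) tau gamma_l^-1 (id (x) F_l^-1), and for a module lambda the
   coaction D(lambda) is the unique map with
     eta (lambda (x) id) = (lambda (x) id) Gamma_13      on H (x) V (x) A,
   so it inherits the pentagon relation and linearity from Gamma. Conversely a coaction
   eta satisfies eta ((g.v) (x) f) = sum a_i.v (x) b_i, where g.v = (id (x) phi) eta (v (x) g)
   and gamma_l^-1 (f (x) g) = sum a_i (x) b_i; with the Galois map of A expressed through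
   Gamma this is the same relation, hence the two constructions are mutually inverse.
   All identities for Gamma are checked by pairing with A: for q in A,
     (q (x) id) Gamma (l (x) y) = (l.q) y,   (l.q)(k) = q(kl).
   This is legitimate because, by the approximation property, elements of H (x) V and A (x) V
   are determined by their slices as soon as the dual of V separates points; for this
   one writes them as rapidly convergent series of elementary tensors. *)

(** * Disks and geometric series *)

(** The tensor product is given by its universal property, which compares maps but describes no
    single tensor. The series representation is therefore obtained by building a second complete
    space inside the tensor product, through which the pairing factors; proving its completeness is
    what forces the explicit rates and constants below. The ratio 1/4 leaves room to spare. When
    layers are grouped in pairs, a weight 4^(-2k) splits into one factor 4^(-k) that moves the
    second legs into a compact disk, where the approximation property applies, and another that
    keeps the series convergent. Without units, Delta takes values in multipliers and a module
    element is not of the form 1.v. Hence identities are tested after multiplication by elements or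
    against functionals, and statements on a module are reduced to the regular one along the orbit
    maps h -> h.v. The bidual enters through the map [Th : H -> A] with phi_A(w Th(h)) = w(h). *)

Section ScaledDisks.
Local Open Scope classical_set_scope.
Local Open Scope ring_scope.
Local Open Scope complex_scope.
Variables (R : realType) (V : lmodType R[i]).
Implicit Types (B : set V) (x y : V) (r s : R).

(** A gauge bound that keeps its witness, so that estimates add up without infima; r = 0 is allowed
    and forces x = 0. *)
Definition scl B r : set V := [set x | exists2 b, B b & x = r%:C *: b].

Lemma scl0 B r : disk B -> scl B r 0.
Proof. by move=> /disk0 B0; exists 0; rewrite ?scaler0. Qed.

Lemma scl1 B x : B x -> scl B 1 x.
Proof. by move=> Bx; exists x; rewrite ?scale1r. Qed.

Lemma scl_mem1 B x : scl B 1 x -> B x.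
Proof. by case=> b Bb ->; rewrite scale1r. Qed.

Lemma sclS B B' r : B `<=` B' -> scl B r `<=` scl B' r.
Proof. by move=> BB' _ [b /BB' Bb ->]; exists b. Qed.

Lemma scl_le B x r s : disk B -> 0 <= r -> r <= s -> scl B r x -> scl B s x.
Proof.
move=> dB; rewrite le_eqVlt => /orP[/eqP <- s0 [b _ ->]|r0 rs].
  by rewrite scale0r; exact: scl0.
exact: disk_le.
Qed.

Lemma sclZ B x r c (a : R[i]) : disk B -> 0 <= c -> `|a| <= c%:C ->
  scl B r x -> scl B (c * r) (a *: x).
Proof.
move=> dB; rewrite le_eqVlt => /orP[/eqP <-|c0] ac [b Bb ->].
  have -> : a = 0 by apply/eqP; rewrite -normr_le0.
  by rewrite scale0r; exact: scl0.
have cn : c%:C != 0 :> R[i] by rewrite eq_complex /= negb_and gt_eqF.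
exists ((a / c%:C) *: b).
  apply: disk_scale => //; rewrite normrM normfV real_complex_ge0 ?(ltW c0) //.
  by rewrite ler_pdivrMr ?mul1r // -[0]/(0%:C) ltcR.
rewrite !scalerA rmorphM /=; congr (_ *: _).
by rewrite mulrC -mulrA [X in _ = X]mulrC -!mulrA mulVf ?mulr1 // mulrC.
Qed.

Lemma sclZr B x r c : disk B -> 0 <= c -> scl B r x -> scl B (c * r) (c%:C *: x).
Proof. by move=> dB c0; apply: sclZ => //; rewrite real_complex_ge0. Qed.

Lemma sclN B x r : disk B -> scl B r x -> scl B r (- x).
Proof.
move=> dB /(@sclZ _ _ _ 1 (-1) dB ler01); rewrite mul1r scaleN1r; apply.
by rewrite normrN1.
Qed.

Lemma sclD B x y r s : disk B -> 0 <= r -> 0 <= s -> scl B r x -> scl B s y ->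
  scl B (r + s) (x + y).
Proof.
move=> dB; rewrite le_eqVlt => /orP[/eqP <- _ [b _ ->]|r0].
  by rewrite scale0r !add0r.
rewrite le_eqVlt => /orP[/eqP <- xr [b _ ->]|s0 [b Bb ->] [c Bc ->]].
  by rewrite scale0r !addr0.
have [||z Bz zE] := @disk_combine _ _ B r s 1 1 b c dB r0 s0 _ _ Bb Bc.
- by rewrite normr1.
- by rewrite normr1.
by exists z => //; rewrite -zE !scale1r.
Qed.

Lemma sclB B x y r s : disk B -> 0 <= r -> 0 <= s -> scl B r x -> scl B s y ->
  scl B (r + s) (x - y).
Proof. by move=> dB r0 s0 xr ys; apply: sclD => //; exact: sclN. Qed.

Lemma scl_sum B n (r : nat -> R) (x : nat -> V) : disk B ->
  (forall i, (i < n)%N -> 0 <= r i) -> (forall i, (i < n)%N -> scl B (r i) (x i)) ->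
  scl B (\sum_(i < n) r i) (\sum_(i < n) x i).
Proof.
move=> dB; elim: n => [|n IH] r0 xr; first by rewrite !big_ord0; exact: scl0.
rewrite !big_ord_recr /=; apply: sclD => //.
- by apply: sumr_ge0 => i _; apply: r0; rewrite ltnS ltnW.
- exact: r0.
- by apply: IH => i ni; [apply: r0|apply: xr]; rewrite ltnS ltnW.
- exact: xr.
Qed.

Lemma scl_gauge B x r : 0 < r -> scl B r x -> gauge B x <= r.
Proof. exact: gauge_le. Qed.

Lemma scl_lspan B x r : disk B -> 0 <= r -> scl B r x -> lspan B x.
Proof.
move=> dB r0 xr; apply/(lspanP _ dB); exists (r + 1); first by rewrite ltr_wpDl.
by apply: scl_le xr => //; rewrite lerDl.
Qed.

(* absolutely convex hull *)
Definition aco B : set V := [set x | exists s : seq (R[i] * V),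
  [/\ forall p, p \in s -> B p.2, \sum_(p <- s) `|p.1| <= 1
    & x = \sum_(p <- s) p.1 *: p.2]].

Lemma aco_incl B : B `<=` aco B.
Proof.
move=> x Bx; exists [:: (1, x)]; rewrite !big_seq1 normr1 scale1r; split => //.
by move=> p; rewrite inE => /eqP ->.
Qed.

Lemma acoS B B' : B `<=` B' -> aco B `<=` aco B'.
Proof. by move=> BB' x [s [Bs s1 ->]]; exists s; split => // p /Bs/BB'. Qed.

Lemma disk_aco B : disk (aco B).
Proof.
split; first by exists [::]; rewrite !big_nil ler01; split.
move=> a b x y ab [s [Bs s1 ->]] [t [Bt t1 ->]].
exists ([seq (a * p.1, p.2) | p <- s] ++ [seq (b * p.1, p.2) | p <- t]).
rewrite !big_cat !big_map /=; split.
- by move=> p; rewrite mem_cat => /orP[] /mapP[q qs ->]; [exact: (Bs q)|exact: (Bt q)].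
- have -> c (u : seq (R[i] * V)) : \sum_(p <- u) `|c * p.1| = `|c| * \sum_(p <- u) `|p.1|.
    by rewrite mulr_sumr; apply: eq_bigr => i _; rewrite normrM.
  have -> c (u : seq (R[i] * V)) : \sum_(p <- u) `|c * p.1| = `|c| * \sum_(p <- u) `|p.1|.
    by rewrite mulr_sumr; apply: eq_bigr => i _; rewrite normrM.
  apply: le_trans ab; apply: lerD; exact: ler_piMr.
- rewrite !scaler_sumr; congr (_ + _); apply: eq_bigr => p _; by rewrite scalerA.
Qed.

Lemma aco_sub B D : disk D -> B `<=` D -> aco B `<=` D.
Proof.
move=> dD BD x [s [Bs s1 ->]].
suff h : scl D (\sum_(p <- s) cmod p.1) (\sum_(p <- s) p.1 *: p.2).
  apply: scl_mem1; apply: scl_le h => //.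
    by apply: sumr_ge0 => p _; exact: cmod_ge0.
  rewrite -lecR rmorph_sum /=; apply: le_trans s1; rewrite le_eqVlt.
  by apply/orP; left; apply/eqP; apply: eq_bigr => p _; rewrite cmodE.
elim: s {s1} Bs => [|p s IH] Bs; first by rewrite !big_nil; exact: scl0.
rewrite !big_cons; apply: sclD => //.
- exact: cmod_ge0.
- by apply: sumr_ge0 => q _; exact: cmod_ge0.
- rewrite -[cmod _]mulr1; apply: sclZ => //; rewrite ?cmod_ge0 -?cmodE //.
  by apply/scl1/BD/Bs; rewrite mem_head.
- by apply: IH => q qs; apply: Bs; rewrite in_cons qs orbT.
Qed.

End ScaledDisks.

Section Geometric.
Local Open Scope classical_set_scope.
Local Open Scope ring_scope.
Local Open Scope complex_scope.
Variables (R : realType).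
Implicit Types (V : lmodType R[i]).
Local Notation q := (4^-1 : R).

Lemma q_ge0 k : 0 <= q ^+ k. Proof. by rewrite exprn_ge0 // invr_ge0. Qed.
Lemma invpow_ge0 n k : 0 <= (n%:R : R)^-1 ^+ k.
Proof. by rewrite exprn_ge0 // invr_ge0. Qed.
Lemma pow_antidiagonal j m : (j <= m)%N ->
  2^-1 ^+ j * q ^+ m = 8^-1 ^+ j * q ^+ (m - j).
Proof.
move=> jm; rewrite -{1}(subnKC jm) exprD mulrA -exprMn.
by congr (_ ^+ _ * _); rewrite -invfM -natrM.
Qed.
(** A layer of weight 4^(-2k) can be amplified by 4^k and still decays geometrically; [slices_zero]
    spends this margin. *)
Lemma pow_double k (e : R) : q ^+ (2 * k) * (e * 4 ^+ k) = e * q ^+ k.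
Proof.
rewrite mulrCA mul2n -addnn exprD -mulrA -[X in _ * (_ * X)]exprMn.
by rewrite mulVf ?pnatr_eq0 // expr1n mulr1.
Qed.
Lemma q_gt0 k : 0 < q ^+ k. Proof. by rewrite exprn_gt0 // invr_gt0. Qed.

Lemma geometric_le (p : R) k n : 0 <= p -> p <= 2^-1 ->
  \sum_(i < n) p ^+ (k + i) <= 2 * p ^+ k.
Proof.
move=> p0 p2; have pk : 0 <= p ^+ k by exact: exprn_ge0.
have -> : \sum_(i < n) p ^+ (k + i) = p ^+ k * \sum_(i < n) p ^+ i.
  by rewrite mulr_sumr; apply: eq_bigr => i _; rewrite exprD.
rewrite mulrC ler_wpM2r //.
(* The induction needs this sharper bound; its step amounts to 2 p^(n+1) <= p^n. *)
suff : \sum_(i < n) p ^+ i <= 2 * (1 - p ^+ n).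
  move=> /le_trans; apply; rewrite ler_piMr // lerBlDr lerDl; exact: exprn_ge0.
elim: n => [|n IH]; first by rewrite big_ord0 expr0 subrr mulr0.
rewrite big_ord_recr /=; have pn : 0 <= p ^+ n by exact: exprn_ge0.
rewrite exprS; nra.
Qed.

Lemma half_pow_small (c e : R) : 0 <= c -> 0 < e -> exists K, forall k, (K <= k)%N ->
  c * 2^-1 ^+ k <= e.
Proof.
move=> c0 e0; exists (Num.bound (c / e)) => k Kk.
rewrite exprVn mulrC ler_pdivrMl ?exprn_gt0 // -ler_pdivrMr //.
apply: le_trans (ltW (archi_boundP _)) _; first by rewrite divr_ge0 // ltW.
rewrite -natrX ler_nat; apply: leq_trans Kk _; exact/ltnW/ltn_expl.
Qed.

Lemma q_le_half k : q ^+ k <= 2^-1 ^+ k.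
Proof. by rewrite lerXn2r ?nnegrE //; lra. Qed.

Lemma q_pow_small (c e : R) : 0 <= c -> 0 < e -> exists K, forall k, (K <= k)%N ->
  c * q ^+ k <= e.
Proof.
move=> c0 e0; have [K hK] := half_pow_small c0 e0; exists K => k /hK; apply: le_trans.
by rewrite ler_wpM2l // q_le_half.
Qed.

(** Both error sets fit into one Banach disk, which separates points. This identifies a limit found
    by completeness in one disk with a limit known in an unrelated one. *)
Lemma q_rate_unique (V : bornType R) (B B' : set V) (c c' : R) (u : nat -> V) x y :
  small B -> small B' -> 0 <= c -> 0 <= c' ->
  (forall k, scl B (c * q ^+ k) (x - u k)) -> (forall k, scl B' (c' * q ^+ k) (y - u k)) ->
  x = y.
Proof.
move=> sB sB' c0 c'0 hx hy; have [D [sD [dD _ _] BD]] := small_banach (smallU sB sB').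
apply/eqP; rewrite -subr_eq0; apply/eqP; apply: (small_sep sD) => e e0.
have [K /(_ K (leqnn K)) Ke] := q_pow_small (addr_ge0 c0 c'0) e0.
apply: (scl_le dD _ Ke); first by rewrite mulr_ge0 ?addr_ge0 ?q_ge0.
have -> : x - y = (x - u K) - (y - u K) by rewrite opprB subrKA.
rewrite mulrDl; apply: sclB; rewrite ?mulr_ge0 ?q_ge0 //.
  by apply: sclS (hx K) => z Bz; apply: BD; left.
by apply: sclS (hy K) => z Bz; apply: BD; right.
Qed.

Definition q_cvg V (B : set V) (u : nat -> V) x := forall k, scl B (q ^+ k) (x - u k).

Lemma q_partial V (B : set V) (u : nat -> V) : disk B ->
  (forall k, scl B (q ^+ k) (u k.+1 - u k)) ->
  forall k n, scl B (2 * q ^+ k) (u (k + n)%N - u k).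
Proof.
move=> dB h k n; apply: (@scl_le _ _ _ _ (\sum_(i < n) q ^+ (k + i))) => //.
- by apply: sumr_ge0 => i _; exact: q_ge0.
- by apply: geometric_le; lra.
have -> : u (k + n)%N - u k = \sum_(i < n) (u (k + i).+1 - u (k + i)%N).
  elim: n => [|n IH]; first by rewrite addn0 subrr big_ord0.
  by rewrite big_ord_recr /= -IH addnS addrC subrKA.
by apply: (scl_sum (r := fun i => q ^+ (k + i))
   (x := fun i => u (k + i).+1 - u (k + i)%N)) => // i _; exact: q_ge0.
Qed.

Lemma q_complete V (B : set V) (u : nat -> V) : banach_disk B -> lspan B (u 0%N) ->
  (forall k, scl B (q ^+ k) (u k.+1 - u k)) ->
  exists l, forall k, scl B (4 * q ^+ k) (l - u k).
Proof.
move=> [dB sep cpl] u0 h; have hp := q_partial dB h.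
have lu n : lspan B (u n).
  have -> : u n = u n - u 0%N - (0 - u 0%N) by rewrite sub0r opprK subrK.
  apply: lspanB => //; last by apply: lspanB => //; exact: scl_lspan (scl0 0 dB).
  by apply: scl_lspan (hp 0%N n) => //; rewrite mulr_ge0 ?q_ge0.
have cau e : 0 < e -> exists N, forall m n, (N <= m)%N -> (N <= n)%N -> scl B (e / 2) (u m - u n).
  move=> e0; have e20 : 0 < e / 2 by rewrite divr_gt0.
  have [N hN] := @q_pow_small 4 (e / 2) (ltac:(by [])) e20.
  exists N => m n Nm Nn.
  have -> : u m - u n = (u m - u N) - (u n - u N) by rewrite opprB subrKA.
  apply: (@scl_le _ _ _ _ (2 * q ^+ N + 2 * q ^+ N)) => //.
  - by rewrite addr_ge0 // mulr_ge0 ?q_ge0.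
  - by apply: le_trans (hN N (leqnn N)); lra.
  by apply: sclB; rewrite ?mulr_ge0 ?q_ge0 //; [rewrite -(subnKC Nm)|rewrite -(subnKC Nn)].
have [|l ll /cvgr0Pnorm_lt hl] := cpl u lu.
  move=> e e0; have [N hN] := cau e e0; exists N => m n Nm Nn.
  apply: (@le_lt_trans _ _ (e / 2)); last by rewrite ltr_pdivrMr // ltr_pMr // ltr1n.
  by apply: scl_gauge; [rewrite divr_gt0|exact: hN].
exists l => k.
(* The constant 4 is 2 + 2: the geometric tail from k to m, and the distance from [u m] to the limit
   for m large. *)
have [N _ hN] := hl (2 * q ^+ k) (ltac:(by rewrite mulr_gt0 ?q_gt0)).
pose m := (k + N)%N.
have /= := hN m (leq_addl _ _); rewrite ger0_norm ?gauge_ge0 // => gm.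
have -> : l - u k = (u m - u k) - (u m - l) by rewrite opprB [X in _ = X]addrC subrKA.
have -> : 4 * q ^+ k = 2 * q ^+ k + 2 * q ^+ k by lra.
apply: sclB; rewrite ?mulr_ge0 ?q_ge0 //; first exact: hp.
by apply: gauge_lt => //; exact: lspanB.
Qed.

(* The elements of the completion of the normed space spanned by [aco D]. *)
Definition chull (V : bornType R) (D : set V) : set V :=
  [set z | exists u : nat -> V, [/\ u 0%N = 0,
     forall k, scl (aco D) (q ^+ k) (u k.+1 - u k)
   & exists2 B, small B & q_cvg B u z]].

(** * Completed absolutely convex hulls *)

Section CHull.
Variable V : bornType R.
Implicit Types (D B : set V).

Lemma chullS D D' : D `<=` D' -> chull D `<=` chull D'.
Proof.
by move=> DD' z [u [u0 hu h]]; exists u; split => // k; apply: sclS (hu k); exact: acoS.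
Qed.

Lemma chull_incl D : D `<=` chull D.
Proof.
move=> x Dx; exists (fun k => if k is 0%N then 0 else x); split => //.
  case=> [|k]; last by rewrite subrr; apply: scl0; exact: disk_aco.
  by rewrite subr0 expr0; apply/scl1/aco_incl.
have [B [sB [dB _ _] Bx]] := small_banach (small1 x).
exists B => // -[|k]; last by rewrite subrr; exact: scl0.
by rewrite subr0; apply/scl1/Bx.
Qed.

Lemma chull_lin D D' (a : R[i]) z : (forall x, D x -> D' (a *: x)) -> chull D z ->
  chull D' (a *: z).
Proof.
move=> DD' [u [u0 hu [B sB hB]]]; exists (fun k => a *: u k); split.
- by rewrite u0 scaler0.
- move=> k; have [y [s [Ds s1 ->]] yE] := hu k; rewrite -scalerBr yE scalerA mulrC -scalerA.
  eexists; last by [].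
  exists [seq (p.1, a *: p.2) | p <- s]; rewrite !big_map /=; split => //.
    by move=> p /mapP[p' p's ->]; exact/DD'/Ds.
  by rewrite scaler_sumr; apply: eq_bigr => p _; rewrite !scalerA mulrC.
exists [set a *: x | x in B]; first exact: smallZ.
move=> k; have [b Bb bE] := hB k; exists (a *: b); first by exists b.
by rewrite -scalerBr bE !scalerA mulrC.
Qed.

Lemma disk_chull D : disk (chull D).
Proof.
split.
  exists (fun=> 0); split => //.
    by move=> k; rewrite subrr; apply: scl0; exact: disk_aco.
  exists [set 0]; first exact: small1.
  by move=> k; rewrite subrr; exists 0; rewrite ?scaler0.
move=> a b x y ab [u [u0 hu [B sB hB]]] [v [v0 hv [B' sB' hB']]].
exists (fun k => a *: u k + b *: v k); split.
- by rewrite u0 v0 !scaler0 addr0.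
- move=> k; have [c Dc cE] := hu k; have [c' Dc' c'E] := hv k.
  exists (a *: c + b *: c'); first by have [_] := disk_aco D; exact.
  rewrite opprD addrACA -!scalerBr cE c'E scalerDr !scalerA.
  by rewrite ![_%:C * _]mulrC.
exists [set x + y | x in [set a *: x | x in B] & y in [set b *: x | x in B']].
  by apply: smallD; exact: smallZ.
move=> k; have [c Bc cE] := hB k; have [c' Bc' c'E] := hB' k.
exists (a *: c + b *: c'); first by exists (a *: c); [exists c|exists (b *: c') => //; exists c'].
rewrite opprD addrACA -!scalerBr cE c'E scalerDr !scalerA.
by rewrite ![_%:C * _]mulrC.
Qed.

Section Bound.
Variables (D B : set V) (sB : small B) (bB : banach_disk B) (DB : D `<=` B).
Let dB : disk B. Proof. by case: bB. Qed.

Lemma chull_limit (u : nat -> V) : u 0%N = 0 ->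
  (forall k, scl (aco D) (q ^+ k) (u k.+1 - u k)) ->
  exists2 z, chull D z & forall k, scl B (4 * q ^+ k) (z - u k).
Proof.
move=> u0 hu.
have hu' k : scl B (q ^+ k) (u k.+1 - u k) by apply: sclS (hu k); exact: aco_sub.
have [|z hz] := q_complete bB _ hu'; first by rewrite u0; apply: scl_lspan (scl0 0 dB).
exists z => //; exists u; split => //.
(* The factor 4 lost to completeness goes into the small set, as [q_cvg] has constant 1. *)
exists [set 4%:C *: x | x in B]; first exact: smallZ.
move=> k; have [b Bb bE] := hz k; exists (4%:C *: b); first by exists b.
by rewrite scalerA -rmorphM /= mulrC.
Qed.

(** The small set in the definition of [chull] depends on the element; uniqueness of limits allows
    replacing it by [B]. *)
Lemma chull_rate z : chull D z -> exists u : nat -> V, [/\ u 0%N = 0,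
  forall k, scl (aco D) (q ^+ k) (u k.+1 - u k) & forall k, scl B (4 * q ^+ k) (z - u k)].
Proof.
move=> [u [u0 hu [B' sB' hB']]]; exists u; split => //.
have [z' _ hz'] := chull_limit u0 hu; suff -> : z = z' by [].
apply: (@q_rate_unique _ B' B 1 4 u) => // k.
by rewrite mul1r; exact: hB'.
Qed.

Lemma chull_sub : chull D `<=` scl B 4.
Proof.
by move=> z /chull_rate[u [u0 _ /(_ 0%N)]]; rewrite u0 subr0 expr0 mulr1.
Qed.

(* The double series [sum_j 8^-j sum_k 4^-k y_(j,k)] is summed along antidiagonals,
   where the coefficient of [4^-m] is [sum_(j <= m) 2^-j y_(j, m - j)]. *)
Lemma chull_series (x : nat -> V) : (forall j, chull D (x j)) ->
  exists2 z, scl (chull D) 2 z &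
  forall m, scl B (16 * q ^+ m) (z - \sum_(j < m) (8^-1 ^+ j)%:C *: x j).
Proof.
move=> xD; have /boolp.choice[u hu] := fun j => chull_rate (xD j).
have u0 j : u j 0%N = 0 by have [] := hu j.
(* Increments of the antidiagonal sums have size up to 2 q^m, since the sum of the 2^-j is at most
   2. The factor 1/2 normalizes them and is undone by the scale 2 of the result. *)
pose w m := (2^-1)%:C *: \sum_(j < m) (8^-1 ^+ j)%:C *: u j (m - j)%N.
have [||z zD hz] := @chull_limit w; first by rewrite /w big_ord0 scaler0.
  move=> m; have dD := disk_aco D; rewrite /w -scalerBr.
  (* The extra index j = m of the first sum is paired with [u m 0], which vanishes. *)
  have -> : \sum_(j < m.+1) (8^-1 ^+ j)%:C *: u j (m.+1 - j)%N -
            \sum_(j < m) (8^-1 ^+ j)%:C *: u j (m - j)%N =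
            \sum_(j < m.+1) (8^-1 ^+ j)%:C *: (u j (m - j).+1 - u j (m - j)%N).
    rewrite [in RHS]big_ord_recr /= subnn u0 subr0 big_ord_recr /= subSnn.
    rewrite addrAC -sumrB; congr (_ + _); apply: eq_bigr => j _.
    by rewrite scalerBr subSn // ltnW.
  have h : scl (aco D) (\sum_(j < m.+1) (2^-1 ^+ j * q ^+ m))
      (\sum_(j < m.+1) (8^-1 ^+ j)%:C *: (u j (m - j).+1 - u j (m - j)%N)).
    apply: (scl_sum (r := fun j => 2^-1 ^+ j * q ^+ m)
      (x := fun j => (8^-1 ^+ j)%:C *: (u j (m - j).+1 - u j (m - j)%N))) => // j jm.
      by rewrite mulr_ge0 ?q_ge0 ?invpow_ge0.
    have -> : 2^-1 ^+ j * q ^+ m = 8^-1 ^+ j * q ^+ (m - j).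
      exact: pow_antidiagonal.
    by apply: sclZr => //; [exact: invpow_ge0|have [_ h _] := hu j; exact: h].
  apply: (@scl_le _ _ _ _ (2^-1 * \sum_(j < m.+1) (2^-1 ^+ j * q ^+ m))) => //.
  - by rewrite mulr_ge0 ?invr_ge0 // sumr_ge0 // => j _; rewrite mulr_ge0 ?q_ge0 ?invpow_ge0.
  - rewrite -mulr_suml mulrA ler_piMl ?q_ge0 // mulrC ler_pdivrMr // mul1r.
    by have := @geometric_le (2^-1) 0 m.+1; rewrite expr0 mulr1; apply; rewrite ?invr_ge0.
  - by apply: sclZr; rewrite ?invr_ge0.
exists (2%:C *: z); first by exists z.
move=> m; have -> : 2%:C *: z - \sum_(j < m) (8^-1 ^+ j)%:C *: x j =
    2%:C *: (z - w m) - \sum_(j < m) (8^-1 ^+ j)%:C *: (x j - u j (m - j)%N).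
  have e2 : (2 : R)%:C * (2^-1)%:C = 1 by rewrite -rmorphM divff ?rmorph1 // pnatr_eq0.
  rewrite scalerBr /w scalerA e2 scale1r.
  under [X in _ - _ - X]eq_bigr do rewrite scalerBr.
  by rewrite sumrB opprB addrA subrK.
have h : scl B (\sum_(j < m) (2^-1 ^+ j * (4 * q ^+ m)))
    (\sum_(j < m) (8^-1 ^+ j)%:C *: (x j - u j (m - j)%N)).
  apply: (scl_sum (r := fun j => 2^-1 ^+ j * (4 * q ^+ m))
    (x := fun j => (8^-1 ^+ j)%:C *: (x j - u j (m - j)%N))) => // j jm.
    by rewrite !mulr_ge0 ?q_ge0 ?invpow_ge0.
  have -> : 2^-1 ^+ j * (4 * q ^+ m) = 8^-1 ^+ j * (4 * q ^+ (m - j)).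
    by rewrite ![_ * (4 * _)]mulrCA pow_antidiagonal // ltnW.
  by apply: sclZr => //; [exact: invpow_ge0|have [_ _ h] := hu j; exact: h].
(* 16 = 8 + 8: twice the rate 4 q^m of [z] against [w m], and 4 q^m times the sum of the 2^-j. *)
apply: (@scl_le _ _ _ _ (2 * (4 * q ^+ m) + \sum_(j < m) (2^-1 ^+ j * (4 * q ^+ m)))) => //.
- rewrite addr_ge0 ?mulr_ge0 ?q_ge0 // sumr_ge0 // => j _.
  by rewrite !mulr_ge0 ?q_ge0 ?invpow_ge0.
- rewrite -mulr_suml -mulrDl mulrA ler_wpM2r ?q_ge0 //.
  have := @geometric_le (2^-1) 0 m; rewrite expr0 mulr1 => /(_ _ _) h2.
  suff : \sum_(i < m) 2^-1 ^+ i <= 2 :> R by lra.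
  by apply: h2; rewrite ?invr_ge0.
- apply: sclB => //; first by rewrite !mulr_ge0 ?q_ge0.
    by rewrite sumr_ge0 // => j _; rewrite !mulr_ge0 ?q_ge0 ?invpow_ge0.
  exact: sclZr.
Qed.

Lemma scl_trans A B0 r r' x : A `<=` scl B0 r' -> scl A r x -> scl B0 (r * r') x.
Proof. by move=> h [a /h[b Bb ->] ->]; exists b; rewrite // scalerA -rmorphM. Qed.

Lemma chull_separated x : lspan (chull D) x -> gauge (chull D) x = 0 -> x = 0.
Proof.
move=> lx gx; have dC := disk_chull D.
apply: (small_sep sB) => e e0.
have e4 : 0 < e / 4 by rewrite divr_gt0.
have h : scl (chull D) (e / 4) x by apply: gauge_lt => //; rewrite gx.
by have := scl_trans chull_sub h; rewrite divfK // pnatr_eq0.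
Qed.

(** The tail is 8^-m times the series of the shifted sequence. This bounds it in the hull itself and
    not only in [B]. *)
Lemma chull_series_tail (x : nat -> V) m z : (forall j, chull D (x j)) ->
  (forall k, scl B (16 * q ^+ k) (z - \sum_(j < k) (8^-1 ^+ j)%:C *: x j)) ->
  scl (chull D) (2 * 8^-1 ^+ m) (z - \sum_(j < m) (8^-1 ^+ j)%:C *: x j).
Proof.
move=> xD hz; have [t tD ht] := chull_series (fun j => xD (m + j)%N).
suff -> : z - \sum_(j < m) (8^-1 ^+ j)%:C *: x j = (8^-1 ^+ m)%:C *: t.
  by rewrite mulrC; apply: sclZr => //; [exact: disk_chull|exact: invpow_ge0].
apply: (@q_rate_unique _ B B 16 16 (fun k =>
  \sum_(j < k) (8^-1 ^+ (m + j))%:C *: x (m + j)%N)) => // k.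
  have -> : z - \sum_(j < m) (8^-1 ^+ j)%:C *: x j -
      \sum_(j < k) (8^-1 ^+ (m + j))%:C *: x (m + j)%N =
      z - \sum_(j < m + k) (8^-1 ^+ j)%:C *: x j.
    by rewrite big_split_ord /= opprD addrA.
  apply: (scl_le dB _ _ (hz _)); rewrite ?mulr_ge0 ?q_ge0 // ler_wpM2l //.
  by rewrite exprD ler_piMl ?q_ge0 // exprn_ile1 // ?invr_ge0 // invf_le1 // ler1n.
have -> : \sum_(j < k) (8^-1 ^+ (m + j))%:C *: x (m + j)%N =
    (8^-1 ^+ m)%:C *: \sum_(j < k) (8^-1 ^+ j)%:C *: x (m + j)%N.
  rewrite scaler_sumr; apply: eq_bigr => j _.
  by rewrite scalerA -rmorphM exprD.
rewrite -scalerBr; apply: (@scl_le _ _ _ _ (8^-1 ^+ m * (16 * q ^+ k))) => //.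
- by rewrite !mulr_ge0 ?q_ge0 ?invpow_ge0.
- by rewrite ler_piMl ?mulr_ge0 ?q_ge0 // exprn_ile1 // ?invr_ge0 // invf_le1 // ler1n.
- by apply: sclZr => //; exact: invpow_ge0.
Qed.

(** A Cauchy sequence is thinned until its increments have size 8^-j, a ratio below the 1/4 of
    [chull]; they are then summed by [chull_series], and the tail bound gives convergence in the
    gauge of the hull. *)
Lemma banach_chull : banach_disk (chull D).
Proof.
have dC := disk_chull D; split=> // [|u lu cu]; first exact: chull_separated.
have p0 m : 0 < (8^-1 : R) ^+ m by rewrite exprn_gt0 // invr_gt0.
have hN j : exists N, forall m n, (N <= m)%N -> (N <= n)%N ->
    scl (chull D) (8^-1 ^+ j) (u m - u n).
  have [N hN] := cu _ (p0 j); exists N => m n Nm Nn.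
  by apply: gauge_lt; [|exact: lspanB|exact: hN].
have /boolp.choice[N0 hN0] := hN.
(* Running maxima make the indices monotone, so that [N j] and [N j.+1] both lie beyond [N0 j]. *)
pose N := fix N j := if j is j'.+1 then maxn (N j') (N0 j) else N0 0%N.
have NN0 j : (N0 j <= N j)%N by case: j => [|j] //=; rewrite leq_maxr.
have Nmono j : (N j <= N j.+1)%N by rewrite /= leq_maxl.
have hstep j : exists2 y, chull D y & u (N j.+1) - u (N j) = (8^-1 ^+ j)%:C *: y.
  by apply: hN0; [exact: leq_trans (NN0 j) (Nmono j)|exact: NN0].
have /boolp.choice[y hy] : forall j, exists y, chull D y /\
    u (N j.+1) - u (N j) = (8^-1 ^+ j)%:C *: y.
  by move=> j; have [y yD yE] := hstep j; exists y.
have yD j : chull D (y j) by have [] := hy j.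
have uE j : u (N j) - u (N 0%N) = \sum_(i < j) (8^-1 ^+ i)%:C *: y i.
  elim: j => [|j IH]; first by rewrite subrr big_ord0.
  by rewrite big_ord_recr /= -IH -(hy j).2 addrC subrKA.
have [z zD hz] := chull_series yD.
pose l := z + u (N 0%N).
have tail j : scl (chull D) (2 * 8^-1 ^+ j) (u (N j) - l).
  have := chull_series_tail j yD hz; rewrite -uE => /(sclN dC).
  by rewrite opprB /l opprD [- z - _]addrC addrA.
exists l.
  have -> : l = u (N 0%N) - (u (N 0%N) - l) by rewrite opprB addrC subrK.
  apply: lspanB => //; apply: scl_lspan (tail 0%N) => //.
  by rewrite mulr_ge0 ?invpow_ge0.
apply: gauge_cvg0 => e e0.
have [J hJ] := @half_pow_small 3 e (ltac:(by [])) e0.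
exists (N J) => n Nn.
have -> : u n - l = (u n - u (N J)) + (u (N J) - l) by rewrite subrKA.
apply: (@scl_le _ _ _ _ (8^-1 ^+ J + 2 * 8^-1 ^+ J)) => //.
- by rewrite addr_ge0 ?mulr_ge0 ?invpow_ge0.
- apply: le_trans (hJ J (leqnn J)).
  have -> : 8^-1 ^+ J + 2 * 8^-1 ^+ J = 3 * 8^-1 ^+ J :> R by lra.
  by rewrite ler_wpM2l // lerXn2r ?nnegrE ?invr_ge0 // lef_pV2 ?posrE // ler_nat.
- apply: sclD => //; rewrite ?mulr_ge0 ?invpow_ge0 //.
  by apply: hN0; [exact: leq_trans (NN0 J) Nn|exact: NN0].
Qed.

Lemma small_chull : small (chull D).
Proof. by apply: smallS (smallZ 4%:C sB) => z /chull_sub[b Bb ->]; exists b. Qed.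

End Bound.
End CHull.
End Geometric.

Section Blin.
Local Open Scope ring_scope.
Local Open Scope complex_scope.
Variables (R : realType) (V W : bornType R) (f : blin V W).

Lemma blin0 : f 0 = 0. Proof. exact: raddf0. Qed.
Lemma blinD x y : f (x + y) = f x + f y. Proof. exact: raddfD. Qed.
Lemma blinB x y : f (x - y) = f x - f y. Proof. exact: raddfB. Qed.
Lemma blinZ (a : R[i]) x : f (a *: x) = a *: f x. Proof. exact: (linearZ_LR f). Qed.
Lemma blin_sum I (s : seq I) P (F : I -> V) :
  f (\sum_(i <- s | P i) F i) = \sum_(i <- s | P i) f (F i).
Proof. exact: raddf_sum. Qed.
End Blin.

(** * Series representation of tensors *)

Section Representable.
Local Open Scope classical_set_scope.
Local Open Scope ring_scope.
Local Open Scope complex_scope.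
Variables (R : realType) (T : tensor_product R) (V W : bornType R).
Local Notation VW := (tobj T V W).
Local Notation "v ⊠ w" := (tpair T v w) (at level 40, left associativity).

Lemma tpairZl (a : R[i]) (v : V) (w : W) : (a *: v) ⊠ w = a *: (v ⊠ w).
Proof. exact: (linearZ_LR (pairr V w)). Qed.
Lemma tpairZr (a : R[i]) (v : V) (w : W) : v ⊠ (a *: w) = a *: (v ⊠ w).
Proof. exact: (linearZ_LR (pairl W v)). Qed.
Lemma tpairBl (v v' : V) (w : W) : (v - v') ⊠ w = v ⊠ w - v' ⊠ w.
Proof. exact: (raddfB (pairr V w)). Qed.
Lemma tpairBr (v : V) (w w' : W) : v ⊠ (w - w') = v ⊠ w - v ⊠ w'.
Proof. exact: (raddfB (pairl W v)). Qed.

Definition tset (A : set V) (B : set W) : set VW := [set a ⊠ b | a in A & b in B].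

Lemma tsetS A A' B B' : A `<=` A' -> B `<=` B' -> tset A B `<=` tset A' B'.
Proof. by move=> AA' BB' _ [a /AA' Aa [b /BB' Bb <-]]; exists a => //; exists b. Qed.

Lemma small_tset A B : small A -> small B -> small (tset A B).
Proof. exact: (bbilin_bnd (tpairP T V W)). Qed.

Definition representable (z : VW) : Prop :=
  exists A B, [/\ small A, small B & chull (tset A B) z].

Definition repr_pred : {pred VW} := fun z => `[< representable z >].

(** The hull is a disk, so the weights 1/2 and 1/2 are free; 2a and 2b are moved into the first
    legs. The new small sets depend on neither x nor y, as needed for small families. *)
Lemma chull_tset2 A B A' B' (a b : R[i]) : small A -> small B -> small A' -> small B' ->
  exists A2 B2, [/\ small A2, small B2 & forall x y,
     chull (tset A B) x -> chull (tset A' B') y -> chull (tset A2 B2) (a *: x + b *: y)].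
Proof.
move=> sA sB sA' sB'.
pose A1 := A `|` A'; pose B2 := B `|` B'.
pose A2 := [set (2 * a) *: x | x in A1] `|` [set (2 * b) *: x | x in A1].
exists A2, B2; split=> [||x y hx hy].
- by apply: smallU; apply: smallZ; exact: smallU.
- exact: smallU.
have h (c : R[i]) z : (forall x, A1 x -> A2 ((2 * c) *: x)) ->
    chull (tset A1 B2) z -> chull (tset A2 B2) ((2 * c) *: z).
  move=> hc; apply: chull_lin => _ [u Au [v Bv <-]].
  by exists ((2 * c) *: u); [exact: hc|exists v; rewrite // tpairZl].
have -> : a *: x + b *: y = 2^-1 *: ((2 * a) *: x) + 2^-1 *: ((2 * b) *: y).
  by rewrite !scalerA !mulrA mulVf ?pnatr_eq0 // !mul1r.
have [_] := disk_chull (tset A2 B2); apply.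
- by rewrite normfV normr_nat -[2^-1]mul1r -splitr.
- apply: h; first by move=> u Au; left; exists u.
  by apply: chullS hx; apply: tsetS => u ?; left.
- apply: h; first by move=> u Au; right; exists u.
  by apply: chullS hy; apply: tsetS => u ?; right.
Qed.
Lemma representable_submod : submod_closed repr_pred.
Proof.
split.
  apply/asboolP; exists [set 0], [set 0]; split; try exact: small1.
  exact: (disk0 (disk_chull _)).
move=> a x y /asboolP[A [B [sA sB hx]]] /asboolP[A' [B' [sA' sB' hy]]]; apply/asboolP.
have [A2 [B2 [sA2 sB2 h]]] := chull_tset2 a 1 sA sB sA' sB'.
by exists A2, B2; split => //; rewrite -[y]scale1r; exact: h.
Qed.

HB.instance Definition _ :=
  GRing.isSubmodClosed.Build R[i] VW repr_pred representable_submod.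

Record reprt := Reprt { rval : VW; rvalP : rval \in repr_pred }.
HB.instance Definition _ := [isSub for rval].
HB.instance Definition _ := [Choice of reprt by <:].
HB.instance Definition _ := [SubChoice_isSubLmodule of reprt by <:].

(** Not the bornology induced from the tensor product: with these sets the pairing is bounded by
    construction, and completeness is [banach_chull]. *)
Definition rsmall : set (set reprt) := [set S | exists A B,
  [/\ small A, small B & forall s, S s -> chull (tset A B) (rval s)]].

Lemma rvalD (x y : reprt) : rval (x + y) = rval x + rval y. Proof. exact: (raddfD val). Qed.
Lemma rval0 : rval 0 = 0. Proof. exact: (raddf0 val). Qed.
Lemma rvalB (x y : reprt) : rval (x - y) = rval x - rval y.
Proof. exact: (raddfB val). Qed.
Lemma rvalZ (a : R[i]) (x : reprt) : rval (a *: x) = a *: rval x.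
Proof. exact: (linearZ_LR val). Qed.

Lemma rsmall1 x : rsmall [set x].
Proof.
by have /asboolP[A [B [sA sB h]]] := rvalP x; exists A, B; split => // _ ->.
Qed.
Lemma rsmallS S S' : S `<=` S' -> rsmall S' -> rsmall S.
Proof. by move=> SS' [A [B [sA sB h]]]; exists A, B; split => // s /SS'/h. Qed.
Lemma rsmallU S S' : rsmall S -> rsmall S' -> rsmall (S `|` S').
Proof.
move=> [A [B [sA sB h]]] [A' [B' [sA' sB' h']]].
exists (A `|` A'), (B `|` B'); split; try exact: smallU.
by move=> s [/h|/h']; apply: chullS; apply: tsetS => u ?; by [left|right].
Qed.
Lemma rsmall_lin (a b : R[i]) S S' : rsmall S -> rsmall S' ->
  rsmall [set a *: x + b *: y | x in S & y in S'].
Proof.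
move=> [A [B [sA sB h]]] [A' [B' [sA' sB' h']]].
have [A2 [B2 [sA2 sB2 h2]]] := chull_tset2 a b sA sB sA' sB'.
exists A2, B2; split => // _ [x Sx [y Sy <-]].
by rewrite rvalD !rvalZ; apply: h2; [exact: h|exact: h'].
Qed.
Lemma rsmallD S S' : rsmall S -> rsmall S' -> rsmall [set x + y | x in S & y in S'].
Proof.
move=> h h'; apply: rsmallS (rsmall_lin 1 1 h h') => _ [x Sx [y Sy <-]].
by exists x => //; exists y; rewrite // !scale1r.
Qed.
Lemma rsmallZ (a : R[i]) S : rsmall S -> rsmall [set a *: x | x in S].
Proof.
move=> h; apply: rsmallS (rsmall_lin a 0 h h) => _ [x Sx <-].
by exists x => //; exists x; rewrite // scale0r addr0.
Qed.

Lemma rsmall_banach S : rsmall S -> exists S', [/\ rsmall S', banach_disk S' & S `<=` S'].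
Proof.
move=> [A [B [sA sB h]]]; pose Q := chull (tset A B).
pose S' := [set x | Q (rval x)]; exists S'; split => //; first by exists A, B; split.
have [D [sD bD AD]] := small_banach (small_tset sA sB).
have [dQ sepQ cplQ] : banach_disk Q := banach_chull sD bD AD.
have dS' : disk S'.
  split=> [|a b x y ab Sx Sy]; first by rewrite /S' /mkset rval0; exact: disk0.
  by rewrite /S' /mkset rvalD !rvalZ; case: dQ => _; exact.
have sc (x : reprt) (r : R) : scl S' r x <-> scl Q r (rval x).
  split=> [[s Ss ->]|[z Qz zE]]; first by exists (rval s); rewrite ?rvalZ.
  have Pz : z \in repr_pred by apply/asboolP; exists A, B.
  by exists (Reprt Pz) => //; apply: val_inj; rewrite [RHS]rvalZ; exact: zE.
have gE x : gauge S' x = gauge Q (rval x).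
  rewrite /gauge; congr (inf _); apply/seteqP; split => r /= [r0 hr]; split => //; exact/sc.
have lE x : lspan S' x <-> lspan Q (rval x).
  split=> [/(lspanP _ dS')|/(lspanP _ dQ)] [r r0 hr].
    by apply/(lspanP _ dQ); exists r => //; apply/sc.
  by apply/(lspanP _ dS'); exists r => //; apply/sc.
split => // [x /lE lx gx|u lu cu].
  by apply: val_inj; rewrite [RHS]rval0; apply: sepQ => //; rewrite -gE.
have [n|e e0|l ll hl] := cplQ (fun n => rval (u n)).
- exact/lE.
- by have [N hN] := cu e e0; exists N => m n Nm Nn; rewrite -rvalB -gE; exact: hN.
have Pl : l \in repr_pred.
  have /(lspanP _ dQ)[r r0 [z Qz ->]] := ll; apply: rpredZ; apply/asboolP; by exists A, B.
exists (Reprt Pl); first exact/lE.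
rewrite (_ : (fun n => _) = (fun n => gauge Q (rval (u n) - l))) //.
by apply/funext => n; rewrite gE rvalB.
Qed.

HB.instance Definition _ := isBornological.Build R reprt
  rsmall1 rsmallS rsmallU rsmallD rsmallZ rsmall_banach.

Lemma rpair_proof v w : v ⊠ w \in repr_pred.
Proof.
apply/asboolP; exists [set v], [set w]; split; try exact: small1.
by apply: chull_incl; exists v => //; exists w.
Qed.
Definition rpair (v : V) (w : W) : reprt := Reprt (rpair_proof v w).

Lemma rpair_bilin : bbilin rpair.
Proof.
split=> [w a v v'|v a w w'|A B sA sB].
- by apply: val_inj; rewrite [LHS](bbilin_linl (tpairP T V W)) [RHS]rvalD rvalZ.
- by apply: val_inj; rewrite [LHS](bbilin_linr (tpairP T V W)) [RHS]rvalD rvalZ.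
exists A, B; split => // _ [v Av [w Bw <-]]; apply: chull_incl.
by exists v => //; exists w.
Qed.

Lemma rval_lin : linear rval.
Proof. by move=> a x y; rewrite rvalD rvalZ. Qed.
Lemma rval_bnd : Defs.bounded_fun rval.
Proof.
move=> S [A [B [sA sB h]]]; have [D [sD bD AD]] := small_banach (small_tset sA sB).
by apply: smallS (small_chull sD bD AD) => _ [s Ss <-]; exact: h.
Qed.

(* The pairing corestricts to the representable tensors, which form a complete space;
   by universality, the lift of this corestriction inverts the inclusion. *)
Lemma tens_representable z : representable z.
Proof.
pose f := bcomp (Blin rval_lin rval_bnd) (tlift T rpair_bilin).
suff <- : f z = z by apply/asboolP/rvalP.
by apply: (tens_ext (g := bid _)) => v w; rewrite /f bcompE /= tliftE.
Qed.

Definition linear_subspace (U : lmodType R[i]) (N : set U) : Prop :=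
  N 0 /\ forall (a : R[i]) x y, N x -> N y -> N (a *: x + y).

Lemma linear_subspace_sum (U : lmodType R[i]) (N : set U) (I : eqType) (s : seq I)
    (f : I -> U) :
  linear_subspace N -> (forall i, i \in s -> N (f i)) -> N (\sum_(i <- s) f i).
Proof.
move=> [N0 NP]; elim: s => [|i s IH] Nf; first by rewrite big_nil.
rewrite big_cons -[f i]scale1r; apply: NP; first by apply: Nf; rewrite mem_head.
by apply: IH => j js; apply: Nf; rewrite in_cons js orbT.
Qed.

Lemma linear_subspaceZ (U : lmodType R[i]) (N : set U) (a : R[i]) x :
  linear_subspace N -> N x -> N (a *: x).
Proof. by move=> [N0 NP] Nx; rewrite -[_ *: _]addr0; exact: NP. Qed.

Lemma q_born_cvg (U : bornType R) (B : set U) (u : nat -> U) x : small B -> disk B ->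
  q_cvg B u x -> born_cvg u x.
Proof.
move=> sB dB h; exists B => // e e0; have [K hK] := q_pow_small ler01 e0.
exists K => k Kk; apply: (@scl_le _ _ _ _ (4^-1 ^+ k)) => //; first exact: q_ge0.
  by have := hK k Kk; rewrite mul1r.
by rewrite -opprB; apply: sclN.
Qed.

Lemma born_cvg_map (U X : bornType R) (f : blin U X) (u : nat -> U) x :
  born_cvg u x -> born_cvg (fun n => f (u n)) (f x).
Proof.
move=> [B sB h]; exists (f @` B); first exact: blin_bnd.
move=> e e0; have [N hN] := h e e0; exists N => n Nn; have [b Bb bE] := hN n Nn.
by exists (f b); [exists b|by rewrite -blinB bE blinZ].
Qed.

(** Density of elementary tensors, without forming the quotient by [N]: the partial sums of a
    representing series are mapped into [N], which is closed. *)
Lemma tens_closed (U : bornType R) (F : blin VW U) (N : set U) :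
  linear_subspace N -> born_closed N -> (forall v w, N (F (v ⊠ w))) -> forall z, N (F z).
Proof.
move=> sN cN NF z; have [A [B [sA sB [u [u0 hu [D sD hD]]]]]] := tens_representable z.
have [D' [sD' [dD' _ _] DD']] := small_banach sD.
have cu : born_cvg u z by apply: (q_born_cvg sD' dD') => k; exact: sclS (hD k).
apply: (cN (fun n => F (u n)) _ _ (born_cvg_map F cu)).
elim=> [|n IH]; first by rewrite u0 blin0; case: sN.
have [_ [s [Ds _ ->]] uE] := hu n.
rewrite -(subrK (u n) (u n.+1)) uE blinD blinZ.
case: (sN) => _; apply => //; rewrite blin_sum.
apply: linear_subspace_sum => // p /Ds[v _ [w _ <-]]; rewrite blinZ; exact: linear_subspaceZ.
Qed.
End Representable.

(** * Compactness of real cubes *)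

Section Cube.
Local Open Scope classical_set_scope.
Local Open Scope ring_scope.
Variables (R : realType) (I : choiceType).
Local Notation X := (prod_topology (fun _ : I => R)).

Lemma nbhs_cylinder (f : X) (L : seq I) (d : R) : 0 < d ->
  nbhs f [set g : X | forall i, i \in L -> `|f i - g i| < d].
Proof.
move=> d0; elim: L => [|j L IH]; first by apply: filterS filterT.
have hj : nbhs f [set g : X | `|f j - g j| < d].
  have /= := @proj_continuous I (fun _ => R) j f [set y | `|f j - y| < d].
  by apply; exact: nbhsx_ballx.
apply: filterS (filterI hj IH) => g [/= gj gL] i.
by rewrite in_cons => /orP[/eqP ->|/gL].
Qed.

(** Compactness is phrased through an arbitrary relation that is locally constant in finitely many
    coordinates, so that covers of a disk in V can be pulled back without a topology on V. *)
Lemma cube_finite_cover (U : eqType) (good : (I -> R) -> U -> Prop) :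
  (forall f, (forall i, `|f i| <= 1) -> exists (u : U) (L : seq I) (d : R),
     0 < d /\ forall g, (forall i, i \in L -> `|f i - g i| < d) -> good g u) ->
  exists s : seq U, forall f, (forall i, `|f i| <= 1) -> exists2 u, u \in s & good f u.
Proof.
move=> h; pose K := [set f : X | forall i, `[-1, 1]%classic (f i)].
have cK : compact K.
  exact: (@tychonoff I (fun=> R) (fun=> `[-1, 1]%classic) (fun=> @segment_compact _ _ _)).
have KP (f : X) : K f <-> forall i, `|f i| <= 1.
  by split=> hf i; have := hf i; rewrite /= in_itv /= ler_norml.
(* Along the filter of finite subfamilies, the near-covering form of compactness yields one finite
   subfamily for all points. *)
pose F : set_system (seq U) := 
  [set P | exists s0 : seq U, forall s : seq U, {subset s0 <= s} -> P s].
have FF : Filter F.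
  split; first by exists [::].
    move=> P Q [s hs] [t ht]; exists (s ++ t) => r sub; split; [apply: hs|apply: ht];
    by move=> x xs; apply: sub; rewrite mem_cat xs ?orbT.
  by move=> P Q PQ [s hs]; exists s => t /hs/PQ.
have [s0 /(_ s0 (fun _ => id)) h0] : \near F, K `<=` (fun f => exists2 u, u \in F & good f u).
  move/compact_near_coveringP : cK; apply => f /(iffLR (KP f)) /h[u [L [d [d0 hd]]]].
  exists ([set g : X | forall i, i \in L -> `|f i - g i| < d], [set s : seq U | u \in s]).
    by split; [exact: nbhs_cylinder|exists [:: u] => s; apply; rewrite mem_head].
  by move=> [g s] [/= gL us]; exists u => //; exact: hd.
by exists s0 => f /(iffRL (KP f)) /h0.
Qed.
End Cube.

Section ComplexModulus.
Local Open Scope ring_scope.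
Local Open Scope complex_scope.
Variable R : realType.
Implicit Types (x y : R) (z : R[i]).

Lemma cmod_def z : cmod z = Num.sqrt (complex.Re z ^+ 2 + complex.Im z ^+ 2).
Proof. by apply: (@complexI R); rewrite -cmodE; exact: normc_def. Qed.

Lemma cmod_le_ReIm x y : cmod (x +i* y) <= `|x| + `|y|.
Proof.
rewrite cmod_def /= -[X in _ <= X]ger0_norm ?addr_ge0 // -sqrtr_sqr ler_wsqrtr //.
by rewrite sqrrD !real_normK ?num_real // lerD2r lerDl mulrn_wge0 ?mulr_ge0.
Qed.

Lemma cmod_ReIm z : `|complex.Re z| <= cmod z /\ `|complex.Im z| <= cmod z.
Proof.
by rewrite cmod_def; split; rewrite -sqrtr_sqr ler_wsqrtr // ?lerDl ?lerDr sqr_ge0.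
Qed.
End ComplexModulus.

(** * Compact disks spanned by weighted finite sets *)

Section CompactDisk.
Local Open Scope classical_set_scope.
Local Open Scope ring_scope.
Local Open Scope complex_scope.
Variables (R : realType) (V : bornType R) (B : set V) (bB : banach_disk B).
Variables (b : nat -> seq V) (Bb : forall k x, x \in b k -> B x).
Local Notation q := (4^-1 : R).
Implicit Types (c : nat -> nat -> R[i]).
Let dB : disk B. Proof. by case: bB. Qed.

(** Coefficients are indexed by all pairs of naturals, whatever the length of [b k], so that they
    become points of one cube. *)
Definition coefs c : Prop := forall k, \sum_(i < size (b k)) cmod (c k i) <= 1.
Definition cterm c k : V := \sum_(i < size (b k)) c k i *: (b k)`_i.
Definition cpsum c k : V := \sum_(j < k) (q ^+ j)%:C *: cterm c j.

(* All sums [sum_k 4^-k y_k] with [y_k] in the absolutely convex hull of [b k]. *)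
Definition null_hull : set V :=
  [set x | exists2 c, coefs c & forall k, scl B (4 * q ^+ k) (x - cpsum c k)].

Lemma cterm_scl c k (r : R) : \sum_(i < size (b k)) cmod (c k i) <= r -> scl B r (cterm c k).
Proof.
move=> h; apply: scl_le h _ => //; first by apply: sumr_ge0 => i _; exact: cmod_ge0.
apply: (scl_sum (r := fun i => cmod (c k i)) (x := fun i => c k i *: (b k)`_i)) => // i ik.
  exact: cmod_ge0.
rewrite -[cmod _]mulr1; apply: sclZ; rewrite ?cmod_ge0 -?cmodE //.
by apply/scl1/(Bb (k := k))/mem_nth.
Qed.

Lemma cpsum_limit c : coefs c -> exists x, forall k, scl B (4 * q ^+ k) (x - cpsum c k).
Proof.
move=> hc; apply: q_complete => // [|k].
  by rewrite /cpsum big_ord0; apply: scl_lspan (scl0 0 dB).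
rewrite /cpsum big_ord_recr /= addrAC subrr add0r.
by have := sclZr dB (q_ge0 R k) (cterm_scl (hc k)); rewrite mulr1.
Qed.

Lemma null_hull_mem k x : x \in b k -> null_hull ((q ^+ k)%:C *: x).
Proof.
move=> xb; pose i0 := index x (b k).
have i0s : (i0 < size (b k))%N by rewrite index_mem.
pose c (k' i : nat) : R[i] := ((k' == k) && (i == i0))%:R.
have cE k' i : cmod (c k' i) = ((k' == k) && (i == i0))%:R.
  by rewrite /c; case: (_ && _); rewrite /cmod ?normr1 ?normr0.
have termE j : cterm c j = if j == k then x else 0.
  rewrite /cterm /c; case: eqP => [->|_] /=; last first.
    by rewrite big1 // => i _; rewrite scale0r.
  rewrite (bigD1 (Ordinal i0s)) //= eqxx scale1r nth_index // big1 ?addr0 // => i.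
  by rewrite -val_eqE /= => /negbTE ->; rewrite scale0r.
exists c.
  move=> k'; under eq_bigr do rewrite cE.
  case: eqP => [->|_] /=; last by rewrite big1.
  by rewrite (bigD1 (Ordinal i0s)) //= eqxx big1 ?addr0 // => i; rewrite -val_eqE => /negbTE /= ->.
move=> m; have -> : cpsum c m = if (k < m)%N then (q ^+ k)%:C *: x else 0.
  rewrite /cpsum; case: ltnP => km.
    rewrite (bigD1 (Ordinal km)) //= termE eqxx big1 ?addr0 // => i.
    by rewrite termE -val_eqE /= => /negbTE ->; rewrite scaler0.
  rewrite big1 // => i _; rewrite termE ifN ?scaler0 //.
  by rewrite neq_ltn (leq_trans (ltn_ord i) km).
case: ltnP => km; first by rewrite subrr; exact: scl0.
rewrite subr0; apply: (@scl_le _ _ _ _ (q ^+ k * 1)) => //.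
- by rewrite mulr1 q_ge0.
- rewrite mulr1; apply: (@le_trans _ _ (q ^+ m)); last by rewrite ler_peMl ?q_ge0 // ler1n.
  by apply: ler_wiXn2l => //; rewrite ?invr_ge0 // invf_le1 // ler1n.
- by apply: sclZr; rewrite ?q_ge0 //; apply: scl1; exact: Bb xb.
Qed.

Lemma disk_null_hull : disk null_hull.
Proof.
split.
  exists (fun _ _ => 0).
    by move=> k; rewrite big1 // => i _; rewrite /cmod normr0.
  move=> k; rewrite /cpsum big1 ?subr0; last first.
    by move=> j _; rewrite /cterm big1 ?scaler0 // => i _; rewrite scale0r.
  exact: scl0.
move=> s t x y st [c hc hx] [d hd hy].
have st1 : cmod s + cmod t <= 1 by rewrite -lecR rmorphD /= -!cmodE.
exists (fun k i => s * c k i + t * d k i).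
  move=> k; apply: (@le_trans _ _ (\sum_(i < size (b k)) (cmod s * cmod (c k i) + cmod t * cmod (d k i)))).
    by apply: ler_sum => i _; apply: le_trans (cmodD _ _) _; rewrite !cmodM.
  rewrite big_split /= -!mulr_sumr; apply: le_trans st1; apply: lerD;
  by apply: ler_piMr; rewrite ?cmod_ge0 ?hc ?hd.
move=> k; have -> : cpsum (fun k i => s * c k i + t * d k i) k = s *: cpsum c k + t *: cpsum d k.
  rewrite /cpsum !scaler_sumr -big_split /=; apply: eq_bigr => j _.
  rewrite !scalerA mulrC [t * _]mulrC -!scalerA -scalerDr; congr (_ *: _).
  rewrite /cterm !scaler_sumr -big_split /=; apply: eq_bigr => i _.
  by rewrite scalerDl !scalerA.
rewrite opprD addrACA -!scalerBr.
apply: (@scl_le _ _ _ _ (cmod s * (4 * q ^+ k) + cmod t * (4 * q ^+ k))) => //.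
- by rewrite -mulrDl !mulr_ge0 ?q_ge0 ?addr_ge0 ?cmod_ge0.
- by rewrite -mulrDl ler_piMl ?mulr_ge0 ?q_ge0.
- by apply: sclD; rewrite ?mulr_ge0 ?q_ge0 ?cmod_ge0 //; apply: sclZ; rewrite ?cmod_ge0 -?cmodE.
Qed.

(** The cube has real coordinates; the boolean selects the real or the imaginary part. *)
Let I := (nat * nat * bool)%type.
Let cof (f : I -> R) k i : R[i] := f (k, i, true) +i* f (k, i, false).

Definition support m : seq I := [seq (p, e) | p <- [seq (k, i) | k <- iota 0 m,
  i <- iota 0 (size (b k))], e <- [:: true; false]].

Lemma mem_support m k i e : (k < m)%N -> (i < size (b k))%N -> (k, i, e) \in support m.
Proof.
move=> km ik; apply/allpairsP; exists ((k, i), e); split => //; last by case: e.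
by apply/allpairsPdep; exists k, i; rewrite !mem_iota.
Qed.

Lemma close_cof m (d : R) (f g : I -> R) : (forall i, i \in support m -> `|f i - g i| < d) ->
  forall k i, (k < m)%N -> (i < size (b k))%N -> cmod (cof f k i - cof g k i) <= 2 * d.
Proof.
move=> h k i km ik; have -> : cof f k i - cof g k i =
   (f (k, i, true) - g (k, i, true)) +i* (f (k, i, false) - g (k, i, false)).
  by rewrite /cof; simpc.
apply: le_trans (cmod_le_ReIm _ _) _; rewrite mulrDl mul1r.
by apply: lerD; apply/ltW/h/mem_support.
Qed.
Lemma cpsum_close m (d : R) c c' : 0 <= d ->
  (forall k i, (k < m)%N -> (i < size (b k))%N -> cmod (c k i - c' k i) <= d) ->
  scl B (d * \sum_(j < m) (size (b j))%:R) (cpsum c m - cpsum c' m).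
Proof.
move=> d0 h; have -> : cpsum c m - cpsum c' m =
    \sum_(j < m) (q ^+ j)%:C *: cterm (fun k i => c k i - c' k i) j.
  rewrite /cpsum -sumrB; apply: eq_bigr => j _; rewrite -scalerBr; congr (_ *: _).
  by rewrite /cterm -sumrB; apply: eq_bigr => i _; rewrite scalerBl.
rewrite mulr_sumr; apply: (scl_sum (r := fun j => d * (size (b j))%:R)
  (x := fun j => (q ^+ j)%:C *: cterm (fun k i => c k i - c' k i) j)) => // j jm.
  by rewrite mulr_ge0.
apply: (@scl_le _ _ _ _ (q ^+ j * (d * (size (b j))%:R))) => //.
- by rewrite !mulr_ge0 ?q_ge0.
- by rewrite ler_piMl ?mulr_ge0 // exprn_ile1 // ?invr_ge0 // invf_le1 // ler1n.
apply: sclZr => //; first exact: q_ge0.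
apply: cterm_scl; apply: (@le_trans _ _ (\sum_(i < size (b j)) d)).
  by apply: ler_sum => i _; exact: h.
by rewrite sumr_const card_ord mulr_natr.
Qed.

(** The hull is the image of a closed part of a cube of coefficient families. A point of the cube
    outside that part has a neighbourhood violating [coefs], where [good] is vacuous; elsewhere the
    sum depends on finitely many coordinates up to a small error. *)
Lemma null_hull_compact : gauge_compact B null_hull.
Proof.
split=> [x [c _ /(_ 0%N)]|O openO cov].
  by rewrite /cpsum big_ord0 subr0 => h; apply: scl_lspan h; rewrite ?mulr_ge0 ?q_ge0.
pose good (g : I -> R) (u : set V) := coefs (cof g) ->
  forall x, (forall k, scl B (4 * q ^+ k) (x - cpsum (cof g) k)) -> O u /\ u x.
have [f f1|s hs] := @cube_finite_cover R I (set V) good.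
  case: (pselect (coefs (cof f))) => [cf|/existsNP[k /negP]]; last first.
    rewrite -ltNge; set S := (\sum_(i < _) _) => S1.
    (* Chosen with size * d < S - 1, so that nearby families also have a layer sum above 1; [set0]
       is then a dummy value. *)
    pose d := (S - 1) / (2 * (size (b k)).+1%:R).
    have d0 : 0 < d by rewrite divr_gt0 ?subr_gt0 // mulr_gt0.
    exists set0, (support k.+1), (d / 2); split; first by rewrite divr_gt0.
    move=> g /close_cof hg /(_ k) cg; exfalso.
    have : S <= 1 + (size (b k))%:R * d.
      apply: (@le_trans _ _ (\sum_(i < size (b k)) (cmod (cof g k i) + d))); last first.
        by rewrite big_split /= sumr_const card_ord mulr_natl lerD2r.
      apply: ler_sum => i _; have := hg k i (ltnSn k) (ltn_ord i).
      rewrite [2 * _]mulrC divfK ?pnatr_eq0 // => hi; rewrite addrC -[cof f k i](subrK (cof g k i)).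
      by apply: le_trans (cmodD _ _) _; rewrite lerD2r.
    rewrite leNgt => /negP; apply; rewrite -ltrBrDl /d.
    rewrite mulrA ltr_pdivrMr ?mulr_gt0 // mulrC ltr_pM2l ?subr_gt0 //.
    by rewrite -natrM ltr_nat; lia.
  have [x hx] := cpsum_limit cf.
  have [u Ou ux] := cov x (ex_intro2 _ _ (cof f) cf hx).
  have lx : lspan B x.
    by have := hx 0%N; rewrite /cpsum big_ord0 subr0; apply: scl_lspan; rewrite ?mulr_ge0 ?q_ge0.
  have [e e0 he] := openO u Ou x lx ux.
  have e40 : 0 < e / 4 by rewrite divr_gt0.
  (* The tails of x and y cost 8 q^m <= e/4 in total, and [d] keeps the partial sums within e/4 of
     each other; e/2 leaves the inequality strict. *)
  have [m /(_ m (leqnn m)) hm] := @q_pow_small R 8 (e / 4) (ltac:(by [])) e40.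
  pose N : R := \sum_(j < m) (size (b j))%:R.
  have N0 : 0 <= N by apply: sumr_ge0.
  pose d := e / 8 / (N + 1).
  have N10 : 0 < N + 1 by rewrite ltr_wpDl.
  have d0 : 0 < d by rewrite !divr_gt0.
  exists u, (support m), d; split => // g /close_cof hg cg y hy; split => //.
  have ly : lspan B y.
    by have := hy 0%N; rewrite /cpsum big_ord0 subr0; apply: scl_lspan; rewrite ?mulr_ge0 ?q_ge0.
  apply: he => //; apply: (@le_lt_trans _ _ (e / 2)); last by rewrite ltr_pdivrMr // ltr_pMr // ltr1n.
  apply: scl_gauge; first by rewrite divr_gt0.
  have -> : y - x = (y - cpsum (cof g) m) - (x - cpsum (cof f) m)
      - (cpsum (cof f) m - cpsum (cof g) m).
    have swap (a c a' c' : V) : a - c = a - a' - (c - c') - (c' - a').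
      by rewrite !opprB addrAC !subrKA.
    exact: swap.
  have d20 : 0 <= 2 * d by rewrite mulr_ge0 // ltW.
  have q0 : 0 <= 4 * q ^+ m by rewrite mulr_ge0 ?q_ge0.
  apply: (@scl_le _ _ _ _ (4 * q ^+ m + 4 * q ^+ m + 2 * d * N)) => //.
  - by rewrite !addr_ge0 // mulr_ge0.
  - have : 2 * d * N <= e / 4.
      have -> : 2 * d * N = (e / 4) * (N / (N + 1)) by rewrite /d; field; rewrite gt_eqF.
      by rewrite ler_piMr ?(ltW e40) // ler_pdivrMr // mul1r lerDl.
    lra.
  apply: sclB => //; first exact: addr_ge0.
  - exact: mulr_ge0.
  - exact: sclB.
  - exact: cpsum_close.
exists [set u | u \in s /\ O u]; split => [u []|| x [c cc hx]] //.
  by apply: sub_finite_set (finite_seq s) => u [].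
(* Coefficients beyond the length of a layer are unconstrained by [coefs]; they are set to 0 to stay
   in the cube. *)
pose f (i : I) : R := let: (k, i, e) := i in if (i < size (b k))%N then
  (if e then complex.Re (c k i) else complex.Im (c k i)) else 0.
have fc k i : (i < size (b k))%N -> cof f k i = c k i.
  by move=> ik; rewrite /cof /f ik; case: (c k i).
have cof_sum k : \sum_(i < size (b k)) cmod (cof f k i) = \sum_(i < size (b k)) cmod (c k i).
  by apply: eq_bigr => i _; rewrite fc.
have f1 i : `|f i| <= 1.
  case: i => [[k i] e] /=; case: ifPn => [ik|_]; last by rewrite normr0.
  have ck : cmod (c k i) <= 1.
    apply: le_trans (cc k); rewrite (bigD1 (Ordinal ik)) //= lerDl.
    by apply: sumr_ge0 => j _; exact: cmod_ge0.
  have [re im] := cmod_ReIm (c k i).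
  by case: e; [exact: le_trans re ck|exact: le_trans im ck].
have [u us gu] := hs f f1.
have [|k|Ou ux] := gu _ x.
- by move=> k; rewrite cof_sum; exact: cc.
- have -> : cpsum (cof f) k = cpsum c k; last exact: hx.
  by rewrite /cpsum; apply: eq_bigr => j _; congr (_ *: _); apply: eq_bigr => i _; rewrite fc.
by exists u.
Qed.

Lemma null_hull_compact_disk : small B -> compact_disk null_hull.
Proof.
move=> sB; split; first exact: disk_null_hull.
by exists B; split => //; exact: null_hull_compact.
Qed.
End CompactDisk.

(** * Slices and the approximation property *)

Section Separation.
Local Open Scope classical_set_scope.
Local Open Scope ring_scope.
Local Open Scope complex_scope.
Variables (R : realType) (T : tensor_product R).
Implicit Types U V W X : bornType R.
Local Notation "V ⊗ W" := (tobj T V W) (at level 40, left associativity).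
Local Notation "v ⊠ w" := (tpair T v w) (at level 40, left associativity).
Local Notation C := (R[i]^o : bornType R).
Local Notation q := (4^-1 : R).

Definition separating V (S : set (blin V C)) : Prop :=
  forall x, (forall w, S w -> w x = 0) -> x = 0.

Definition rank1 V (w : blin V C) (v : V) : blin V V := curry (slice_r_bilin V w) v.

Lemma blin_sumE V W (I : Type) (s : seq I) (f : I -> blin V W) x :
  (\sum_(i <- s) f i) x = \sum_(i <- s) f i x.
Proof. by elim: s => [|i s IH]; rewrite ?big_nil // !big_cons haddE IH. Qed.

(** A biorthogonal system is built by induction. The new functional is precomposed with id - pi and
    so kills the earlier vectors; if [x - pi x = 0], nothing is added. *)
Lemma span_projection V (S : set (blin V C)) (l : seq V) : separating S ->
  exists r : seq (V * blin V C), forall x, x \in l -> \sum_(p <- r) p.2 x *: p.1 = x.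
Proof.
move=> sep; elim: l => [|x l [r hr]]; first by exists [::].
pose pi := \sum_(p <- r) rank1 p.2 p.1.
have piE y : pi y = \sum_(p <- r) p.2 y *: p.1 by rewrite blin_sumE.
case: (pselect (x - pi x = 0)) => [/subr0_eq xE|x0].
  exists r => y; rewrite in_cons => /orP[/eqP ->|]; last exact: hr.
  by rewrite -piE.
have [w wx] : exists w : blin V C, w (x - pi x) <> 0.
  by apply: contrapT => /forallNP h; apply: x0; apply: sep => w _; exact: contrapT (h w).
pose c : R[i] := w (x - pi x).
pose w' := bcomp (c^-1 *: w) (bid V - pi).
have w'E y : w' y = c^-1 *: w (y - pi y) by rewrite /w' bcompE hscaleE hsubE.
exists ((x - pi x, w') :: r) => y.
rewrite in_cons big_cons -piE [X in X + _](_ : _ = (c^-1 *: w (y - pi y)) *: (x - pi x)); last first.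
  by rewrite -w'E.
move=> /orP[/eqP ->|yl].
  rewrite (_ : c^-1 *: _ = 1) ?scale1r ?subrK // /c.
  by apply: mulVf; apply/eqP.
by rewrite piE hr // subrr blin0 scaler0 scale0r add0r.
Qed.

Lemma lspan_projection V n (s : 'I_n -> V) (S : set (blin V C)) : separating S ->
  exists r : seq (V * blin V C), forall x, lspan (range s) x ->
  x = \sum_(p <- r) p.2 x *: p.1.
Proof.
move=> /(span_projection (codom s))[r hr]; exists r => x [m [c [t [ts ->]]]].
pose pi := \sum_(p <- r) rank1 p.2 p.1.
have piE y : pi y = \sum_(p <- r) p.2 y *: p.1 by rewrite blin_sumE.
rewrite -piE blin_sum; apply: eq_bigr => i _; rewrite blinZ piE hr //.
by have [j _ <-] := ts i; exact: codom_f.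
Qed.

(** The identity of the range of f is a finite sum of rank one maps, so id ⊗ f is a finite sum of
    maps that factor through slices. *)
Lemma finite_rank_slices V W (f : blin W W) (S : set (blin W C)) (z : V ⊗ W) :
  separating S -> finite_rank f -> (forall w : blin W C, slice_r V w z = 0) ->
  tmap T (bid V) f z = 0.
Proof.
move=> sep [n [s hf]] z0; have [r hr] := lspan_projection s sep.
pose g : blin (V ⊗ W) (V ⊗ W) :=
  \sum_(p <- r) bcomp (pairr V p.1) (slice_r V (bcomp p.2 f)).
have -> : tmap T (bid V) f z = g z.
  move: z {z0}; apply: tens_ext => v w; rewrite tmapE blin_sumE.
  rewrite {1}(hr _ (hf w)) [LHS](blin_sum (pairl W v)); apply: eq_bigr => p _.
  by rewrite /= tliftE /= tpairZr tpairZl.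
by rewrite blin_sumE big1 // => p _; rewrite bcompE z0 blin0.
Qed.

Definition tens_sum V W (s : seq (R[i] * (V * W))) : V ⊗ W :=
  \sum_(p <- s) p.1 *: (p.2.1 ⊠ p.2.2).

Lemma tens_series V W (z : V ⊗ W) : exists A B (s : nat -> seq (R[i] * (V * W))),
  [/\ small A, small B, forall k p, p \in s k -> A p.2.1 /\ B p.2.2,
      forall k, \sum_(p <- s k) `|p.1| <= 1
    & exists D, [/\ small D, disk D & forall k,
        scl D (q ^+ k) (z - \sum_(j < k) (q ^+ j)%:C *: tens_sum (s j))]].
Proof.
have [A [B [sA sB [u [u0 hu [D sD hD]]]]]] := tens_representable z.
(* The pair (0, 0) is a default outside [tset A B]. *)
have /boolp.choice[g hg] (x : V ⊗ W) : exists p : V * W, tset A B x ->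
    [/\ A p.1, B p.2 & x = p.1 ⊠ p.2].
  case: (pselect (tset A B x)) => [[a Aa [b Bb <-]]|]; first by exists (a, b).
  by exists (0, 0).
have /boolp.choice[t ht] k : exists s : seq (R[i] * (V ⊗ W)),
    [/\ forall p, p \in s -> tset A B p.2, \sum_(p <- s) `|p.1| <= 1
      & u k.+1 - u k = (q ^+ k)%:C *: \sum_(p <- s) p.1 *: p.2].
  by have [_ [s [h1 h2 ->]] uE] := hu k; exists s.
exists A, B, (fun k => [seq (p.1, g p.2) | p <- t k]); split => //.
- move=> k _ /mapP[p pt ->] /=; have [h _ _] := ht k.
  by have [] := hg _ (h p pt).
- by move=> k; rewrite big_map; have [] := ht k.
have [D' [sD' [dD' _ _] DD']] := small_banach sD.
exists D'; split => // k; suff -> : \sum_(j < k) (q ^+ j)%:C *: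
    tens_sum [seq (p.1, g p.2) | p <- t j] = u k by exact: sclS (hD k).
elim: k => [|k IH]; first by rewrite big_ord0.
rewrite big_ord_recr /= IH -[RHS](subrK (u k)) addrC; congr (_ + _).
have [h _ ->] := ht k; congr (_ *: _); rewrite /tens_sum big_map.
by apply: eq_big_seq => p pt /=; have [_ _ <-] := hg _ (h p pt).
Qed.

Lemma tens_sum_map V W V' W' (f : blin V V') (g : blin W W') (s : seq (R[i] * (V * W))) :
  tmap T f g (tens_sum s) = \sum_(p <- s) p.1 *: (f p.2.1 ⊠ g p.2.2).
Proof. by rewrite blin_sum; apply: eq_bigr => p _; rewrite blinZ tmapE. Qed.

(* With [f] of finite rank close to the identity on a compact disk carrying the second
   legs of [z], [z = - (id (x) (f - id)) z] is arbitrarily small. *)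
Lemma slices_zero V W (S : set (blin W C)) (z : V ⊗ W) :
  approximation_property W -> separating S ->
  (forall w : blin W C, slice_r V w z = 0) -> z = 0.
Proof.
move=> AP sep z0; have [A [B [s [sA sB sAB s1 [D [sD dD hD]]]]]] := tens_series z.
have [B0 [sB0 bB0 BB0]] := small_banach sB.
(* Layers 2k and 2k + 1 have weight at most 4^(-2k) in z but enter the compact disk with weight
   4^(-k). *)
pose b k := [seq p.2.2 | p <- s (2 * k)%N ++ s (2 * k).+1].
have Bb k x : x \in b k -> B0 x.
  by move=> /mapP[p]; rewrite mem_cat => /orP[] /sAB[_ /BB0 ?] ->.
pose K := null_hull B0 b.
have [f [frf [F [sF hF]]]] := AP K (null_hull_compact_disk bB0 Bb sB0).
have [G [sG bG FG]] := small_banach (sF 1 ltr01).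
have [M [sM bM AGM]] := small_banach (small_tset T sA sG).
have dM : disk M by case: bM. have dG : disk G by case: bG.
have dK : disk K := disk_null_hull bB0 b.
(* 8 = 2 * 4: the image series is normalized by 2 e, and its limit then lies in 4 M. *)
apply: (small_sep sM) => e0 e00; pose e := e0 / 8.
have e_gt0 : 0 < e by rewrite divr_gt0.
have [N hN] := hF e e_gt0; have [phi Fphi hphi] := hN N (leqnn N).
pose d := f N - bid W; have dE x : d x = f N x - x by rewrite hsubE.
have dK' k x : x \in b k -> scl G (e * 4 ^+ k) (d x).
  move=> xb; have Kx := null_hull_mem bB0 Bb xb.
  have lx : lspan K ((q ^+ k)%:C *: x) by apply: scl_lspan (scl1 Kx).
  have := hphi _ lx; rewrite -dE blinZ => h.
  have -> : d x = (4 ^+ k)%:C *: (e%:C *: phi ((q ^+ k)%:C *: x)).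
    by rewrite -h scalerA -rmorphM -exprMn divff ?pnatr_eq0 // expr1n scale1r.
  rewrite mulrC; apply: sclZr => //; first exact: exprn_ge0.
  exists (phi ((q ^+ k)%:C *: x)) => //; apply: FG; exists phi => //.
  by exists ((q ^+ k)%:C *: x); rewrite // scale1r.
pose X := tmap T (bid V) d.
have Xz : X z = - z.
  suff -> : X z = tmap T (bid V) (f N) z - z by rewrite (finite_rank_slices sep) // sub0r.
  have -> : tmap T (bid V) (f N) z - z = (tmap T (bid V) (f N) - bid _) z by rewrite hsubE.
  move: z {z0 hD}; apply: tens_ext => v w.
  by rewrite hsubE !tmapE dE tpairBr.
have Xs k j : s j = s (2 * k)%N \/ s j = s (2 * k).+1 -> scl M (e * 4 ^+ k) (X (tens_sum (s j))).
  move=> sj; have e4 : 0 <= e * 4 ^+ k by rewrite mulr_ge0 ?exprn_ge0 // ltW.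
  rewrite tens_sum_map.
  have h p : p \in s j -> scl M (e * 4 ^+ k) (bid V p.2.1 ⊠ d p.2.2).
    move=> pj; have [Ap _] := sAB _ _ pj.
    have [|g Gg ->] := dK' k p.2.2.
      by apply: map_f; rewrite mem_cat; case: sj => <-; rewrite pj ?orbT.
    exists (p.2.1 ⊠ g); last by rewrite tpairZr.
    by apply: AGM; exists p.2.1 => //; exists g.
  have : scl M (e * 4 ^+ k) (\sum_(p <- s j) p.1 *: (bid V p.2.1 ⊠ d p.2.2)).
    have [r r1] : exists r : R, r%:C = \sum_(p <- s j) `|p.1|.
      by exists (\sum_(p <- s j) cmod p.1); rewrite rmorph_sum; apply: eq_bigr => p _; rewrite cmodE.
    have := s1 j; rewrite -r1 -[1]/(1%:C) lecR => rle.
    apply: (@scl_le _ _ _ _ (r * (e * 4 ^+ k))) => //.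
    + rewrite mulr_ge0 // -lecR r1; exact: sumr_ge0.
    + exact: ler_piMl.
    have -> : r = \sum_(p <- s j) cmod p.1.
      apply: (@complexI R); rewrite r1 rmorph_sum; apply: eq_bigr => p _; exact: cmodE.
    elim: (s j) h => [|p t IH] h; first by rewrite !big_nil; exact: scl0.
    rewrite !big_cons mulrDl; apply: sclD => //.
    + by rewrite mulr_ge0 ?cmod_ge0.
    + by rewrite mulr_ge0 // sumr_ge0 // => p' _; exact: cmod_ge0.
    + by apply: sclZ; rewrite ?cmod_ge0 -?cmodE //; apply: h; rewrite mem_head.
    + by apply: IH => p' p't; apply: h; rewrite in_cons p't orbT.
  by [].
pose ps k := \sum_(j < k) (q ^+ j)%:C *: tens_sum (s j).
(* Two consecutive layers contribute at most (1 + 1/4) e q^k, which after division by 2 e stays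
   below q^k. *)
pose w k := ((2 * e)^-1)%:C *: X (ps (2 * k)%N).
have e2 : 0 <= (2 * e)^-1 by rewrite invr_ge0 mulr_ge0 // ltW.
have [||l hl] := @q_complete _ _ M w bM.
- by rewrite /w /ps big_ord0 blin0 scaler0; apply: scl_lspan (scl0 0 dM).
- move=> k; rewrite /w -scalerBr -blinB.
  have -> : ps (2 * k.+1)%N - ps (2 * k)%N = (q ^+ (2 * k))%:C *: tens_sum (s (2 * k)%N) +
      (q ^+ (2 * k).+1)%:C *: tens_sum (s (2 * k).+1).
    have cancel (P x y : V ⊗ W) : P + x + y - P = x + y.
      by rewrite addrAC [P + x]addrC addrK.
    by rewrite /ps mulnS add2n !big_ord_recr /= cancel.
  rewrite blinD !blinZ.
  have qe : 0 <= e * 4 ^+ k by rewrite mulr_ge0 ?exprn_ge0 // ltW.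
  apply: (@scl_le _ _ _ _ ((2 * e)^-1 * (q ^+ (2 * k) * (e * 4 ^+ k) +
    q ^+ (2 * k).+1 * (e * 4 ^+ k)))) => //.
  + by rewrite mulr_ge0 // addr_ge0 // mulr_ge0 ?q_ge0.
  + rewrite exprS -[q * _ * _]mulrA pow_double.
    have -> : (2 * e)^-1 * (e * q ^+ k + q * (e * q ^+ k)) = (5 / 8) * q ^+ k.
      by field; rewrite gt_eqF.
    by rewrite ler_piMl ?q_ge0 //; lra.
  apply: sclZr => //; apply: sclD => //.
  + exact: mulr_ge0 (q_ge0 _ _) qe.
  + exact: mulr_ge0 (q_ge0 _ _) qe.
  + by apply: sclZr (q_ge0 _ _) _ => //; apply: Xs; left.
  + by apply: sclZr (q_ge0 _ _) _ => //; apply: Xs; right.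
(* The series of z converges in a disk [D] unrelated to [M]; uniqueness of limits identifies the
   limit found in [M]. *)
have lE : l = ((2 * e)^-1)%:C *: X z.
  apply: (@q_rate_unique _ _ M [set ((2 * e)^-1)%:C *: x | x in X @` D] 4 1 w) => //.
    by apply: smallZ; exact: blin_bnd.
  move=> k; rewrite mul1r /w -scalerBr -blinB.
  have : scl D (q ^+ k) (z - ps (2 * k)%N).
    apply: (@scl_le _ _ _ _ (q ^+ (2 * k))) => //; first exact: q_ge0.
    by apply: ler_wiXn2l; rewrite ?invr_ge0 ?invf_le1 ?ler1n // leq_pmull.
  move=> [x Dx ->]; exists (((2 * e)^-1)%:C *: X x); first by exists (X x) => //; exists x.
  by rewrite blinZ !scalerA mulrC.
have : scl M 4 l by have := hl 0%N; rewrite /w /ps big_ord0 blin0 scaler0 subr0 expr0 mulr1.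
have zE : z = (- (2 * e))%:C *: l.
  rewrite lE Xz scalerA -rmorphM mulNr divff; last by rewrite gt_eqF // mulr_gt0.
  by rewrite rmorphN rmorph1 scaleN1r opprK.
rewrite zE => h; have -> : e0 = 2 * e * 4 by rewrite /e; field.
apply: sclZ => //; first by rewrite mulr_ge0 // ltW.
by rewrite rmorphN normrN real_complex_ge0 // mulr_ge0 // ltW.
Qed.

(** Lets [tens_ind] compare plain expressions in a tensor: the closure lemmas rebuild the [blin]
    maps that [tens_ext] requires. *)
Definition blinear V W (f : V -> W) : Prop := exists g : blin V W, f =1 g.

Lemma blinear_id V : blinear (fun x : V => x).
Proof. by exists (bid V). Qed.
Lemma blinear_comp U V W (g : blin V W) (f : U -> V) :
  blinear f -> blinear (fun x => g (f x)).
Proof. by case=> h fh; exists (bcomp g h) => x; rewrite fh. Qed.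
Lemma blinear_pairl U V W (f : U -> V) (w : W) :
  blinear f -> blinear (fun x => f x ⊠ w).
Proof. by case=> h fh; exists (bcomp (pairr V w) h) => x; rewrite fh. Qed.
Lemma blinear_pairr U V W (v : V) (f : U -> W) :
  blinear f -> blinear (fun x => v ⊠ f x).
Proof. by case=> h fh; exists (bcomp (pairl W v) h) => x; rewrite fh. Qed.
Lemma blinear_scale U V (c : R[i]) (f : U -> V) :
  blinear f -> blinear (fun x => c *: f x).
Proof. by case=> h fh; exists (c *: h) => x; rewrite fh. Qed.
Lemma blinear_mulr U (c : R[i]) (f : U -> C) :
  blinear f -> @blinear U C (fun x => (f x : R[i]) * c).
Proof. by case=> h fh; exists (c *: h) => x; rewrite fh mulrC. Qed.
Lemma blinear_mull U (c : R[i]) (f : U -> C) :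
  blinear f -> @blinear U C (fun x => c * (f x : R[i])).
Proof. by case=> h fh; exists (c *: h) => x; rewrite fh. Qed.
Lemma blinear_scaler U V (f : U -> C) (v : V) :
  blinear f -> blinear (fun x => (f x : R[i]) *: v).
Proof.
by case=> h fh; exists (bcomp (curry (slice_r_bilin V (bid C)) v) h) => x; rewrite fh.
Qed.
Lemma blinear_app U V W X (F : blin V (blin W X)) (f : U -> V) (y : W) :
  blinear f -> blinear (fun x => F (f x) y).
Proof.
by case=> h fh; exists (bcomp (curry (bbilin_flip (uncurryP F)) y) h) => x; rewrite fh.
Qed.

Lemma tens_ind V W U (f g : V ⊗ W -> U) : blinear f -> blinear g ->
  (forall v w, f (v ⊠ w) = g (v ⊠ w)) -> forall z, f z = g z.
Proof.
move=> [f' ff'] [g' gg'] h z; rewrite ff' gg'; apply: tens_ext => v w.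
by rewrite -ff' -gg'.
Qed.

Lemma slice_rE V W (w : blin W C) (v : V) (x : W) : slice_r V w (v ⊠ x) = w x *: v.
Proof. exact: tliftE. Qed.
Lemma slice_lE V W (w : blin V C) (v : V) (x : W) : slice_l W w (v ⊠ x) = w v *: x.
Proof. exact: tliftE. Qed.

Lemma slice_rl V W (f : blin V C) (g : blin W C) (z : V ⊗ W) :
  f (slice_r V g z) = g (slice_l W f z).
Proof.
move: z; apply: tens_ind; do ?[exact: blinear_id | apply: blinear_comp].
by move=> v w; rewrite slice_rE slice_lE !blinZ [LHS]mulrC.
Qed.

(** Functionals outside [SW] are reached through the other leg: the slice of z by v in [SV] is an
    element of [W] killed by all of [SW], hence zero. *)
Lemma slice_r_separating V W (SV : set (blin V C)) (SW : set (blin W C)) (z : V ⊗ W) :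
  approximation_property W -> separating SV -> separating SW ->
  (forall w, SW w -> slice_r V w z = 0) -> z = 0.
Proof.
move=> AP sV sW z0; apply: (slices_zero AP sW) => w; apply: sV => v Sv.
rewrite slice_rl (_ : slice_l W v z = 0) ?blin0 //.
by apply: sW => w' /z0 zw'; rewrite -slice_rl zw' blin0.
Qed.

Lemma slice_l_separating V W (SV : set (blin V C)) (SW : set (blin W C)) (z : W ⊗ V) :
  approximation_property W -> separating SV -> separating SW ->
  (forall w, SW w -> slice_l V w z = 0) -> z = 0.
Proof.
move=> AP sV sW z0.
have tt x : tswap (tswap x) = x :> W ⊗ V.
  move: x; apply: tens_ind; do ?[exact: blinear_id | apply: blinear_comp].
  by move=> w v; rewrite !tswapE.
rewrite -(tt z) (_ : tswap z = 0) ?blin0 //.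
apply: (slice_r_separating AP sV sW) => w /z0 <-.
move: z {z0}; apply: tens_ind; do ?[exact: blinear_id | apply: blinear_comp].
by move=> x v; rewrite tswapE slice_rE slice_lE.
Qed.

Lemma separating_tens V W (SV : set (blin V C)) (SW : set (blin W C)) :
  approximation_property W -> separating SV -> separating SW ->
  separating [set bcomp v (@slice_r R T V W w) | v in SV & w in SW].
Proof.
move=> AP sV sW z z0; apply: (slice_r_separating AP sV sW) => w Sw.
by apply: sV => v Sv; apply: (z0 (bcomp v (slice_r V w))); exists v => //; exists w.
Qed.
End Separation.

Ltac blinear_step := first
  [ exact: blinear_id | apply: blinear_pairl | apply: blinear_pairr
  | apply: blinear_comp | apply: blinear_app | apply: blinear_scaler
  | apply: blinear_scale | apply: blinear_mulr | apply: blinear_mull ].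
Ltac blinear := do ?blinear_step.
Ltac tensor_ind z := move: z; apply: tens_ind; [by blinear|by blinear|].

(** * Galois maps and duality *)

Section Algebra.
Local Open Scope classical_set_scope.
Local Open Scope ring_scope.
Variables (R : realType) (T : tensor_product R).
Local Notation "V ⊗ W" := (tobj T V W) (at level 40, left associativity).
Local Notation "v ⊠ w" := (tpair T v w) (at level 40, left associativity).
Local Notation "x ∙ y" := (amul _ (x ⊠ y)) (at level 40, left associativity).
Local Notation C := (R[i]^o : bornType R).

Lemma tmap_comp (U V W U' V' W' : bornType R) (g : blin V W) (f : blin U V)
    (g' : blin V' W') (f' : blin U' V') z :
  tmap T g g' (tmap T f f' z) = tmap T (bcomp g f) (bcomp g' f') z.
Proof. by tensor_ind z => u v; rewrite !tmapE. Qed.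

Lemma tmap_id (U V : bornType R) (z : U ⊗ V) : tmap T (bid U) (bid V) z = z.
Proof. by tensor_ind z => u v; rewrite !tmapE. Qed.

Lemma tmap_idr (U V W : bornType R) (f : blin U V) (u : U) (w : W) :
  tmap T f (bid W) (u ⊠ w) = f u ⊠ w.
Proof. exact: tmapE. Qed.

Lemma tmap_idl (U V W : bornType R) (f : blin U V) (w : W) (u : U) :
  tmap T (bid W) f (w ⊠ u) = w ⊠ f u.
Proof. exact: tmapE. Qed.

Lemma tmap_eq (U V U' V' : bornType R) (f g : blin U V) (f' g' : blin U' V') z :
  f =1 g -> f' =1 g' -> tmap T f f' z = tmap T g g' z.
Proof. by move=> /blin_eq -> /blin_eq ->. Qed.

Lemma slice_r_tmap (U V U' V' : bornType R) (f : blin U V) (f' : blin U' V')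
    (w : blin V' C) z :
  slice_r V w (tmap T f f' z) = f (slice_r U (bcomp w f') z).
Proof. by tensor_ind z => u v; rewrite tmapE !slice_rE blinZ. Qed.

Lemma slice_l_tmap (U V U' V' : bornType R) (f : blin U V) (f' : blin U' V')
    (w : blin V C) z :
  slice_l V' w (tmap T f f' z) = f' (slice_l U' (bcomp w f) z).
Proof. by tensor_ind z => u v; rewrite tmapE !slice_lE blinZ. Qed.

Lemma bidE (V : bornType R) (x : V) : bid V x = x. Proof. by []. Qed.

Lemma bcomp_bid (U V : bornType R) (f : blin U V) : bcomp f (bid U) = f.
Proof. exact: blin_eq. Qed.

Lemma tswapK (U V : bornType R) (z : U ⊗ V) : tswap (tswap z) = z.
Proof. by tensor_ind z => u v; rewrite !tswapE. Qed.

Lemma tassocK (U V W : bornType R) (z : (U ⊗ V) ⊗ W) : tassocV (tassoc z) = z.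
Proof.
move: z; apply: (tens_ext3 (f := bcomp tassocV tassoc) (g := bid _)) => u v w.
by rewrite bcompE tassocE tassocVE.
Qed.

Lemma tens_ind3 (U V W X : bornType R) (f g : U ⊗ (V ⊗ W) -> X) :
  blinear f -> blinear g -> (forall u v w, f (u ⊠ (v ⊠ w)) = g (u ⊠ (v ⊠ w))) ->
  forall z, f z = g z.
Proof.
move=> [f' ff'] [g' gg'] h; apply: tens_ind; [by exists f'|by exists g'|].
move=> u z; rewrite ff' gg'; tensor_ind z => v w; by rewrite -ff' -gg' h.
Qed.

Local Notation "z ⊙ w" := (tmul _ _ (z ⊠ w)) (at level 40, left associativity).

Lemma tmul_pairl (A B : balg T) (a : A) (b : B) (z : A ⊗ B) :
  (a ⊠ b) ⊙ z = tmap T (lmulb a) (lmulb b) z.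
Proof. by tensor_ind z => u v; rewrite tmulE tmapE. Qed.

Lemma tmul_pairr (A B : balg T) (a : A) (b : B) (z : A ⊗ B) :
  z ⊙ (a ⊠ b) = tmap T (rmulb a) (rmulb b) z.
Proof. by tensor_ind z => u v; rewrite tmulE tmapE. Qed.

Lemma tmul_rmul2 (A B : balg T) (b : B) (z w : A ⊗ B) :
  tmap T (bid A) (rmulb b) z ⊙ w = z ⊙ tmap T (bid A) (lmulb b) w.
Proof.
tensor_ind z => u v; tensor_ind w => u' v'.
by rewrite !tmapE !tmulE /= amulA.
Qed.

Lemma tmul_rmul1 (A B : balg T) (a : A) (z w : A ⊗ B) :
  tmap T (rmulb a) (bid B) z ⊙ w = z ⊙ tmap T (lmulb a) (bid B) w.
Proof.
tensor_ind z => u v; tensor_ind w => u' v'.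
by rewrite !tmapE !tmulE /= amulA.
Qed.

Lemma tmul_lmul1 (A B : balg T) (a : A) (z w : A ⊗ B) :
  tmap T (lmulb a) (bid B) z ⊙ w = tmap T (lmulb a) (bid B) (z ⊙ w).
Proof.
tensor_ind z => u v; tensor_ind w => u' v'.
by rewrite !(tmapE, tmulE) /= amulA.
Qed.

(** * Galois maps and invariance *)

Section Galois.
Variable K : bqg T.
Implicit Types (x y a b c g k t : K) (z w : K ⊗ K).

Definition Delta_mul x : blin (K ⊗ K) (K ⊗ K) := mL (Delta K x).

Lemma Delta_mulM x y z : Delta_mul (x ∙ y) z = Delta_mul x (Delta_mul y z).
Proof. exact: (mh_mul (Delta K) x y).1. Qed.

Lemma Delta_mul_mul x z w : Delta_mul x (z ⊙ w) = Delta_mul x z ⊙ w.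
Proof. exact: (mL_mul (Delta K x)). Qed.

Lemma gamma_l_mul x y w : gamma_l K (x ⊠ y) ⊙ w = Delta_mul x (tmap T (lmulb y) (bid K) w).
Proof. exact: (gamma_lP x y).1. Qed.
Lemma gamma_r_mul x y w : gamma_r K (x ⊠ y) ⊙ w = Delta_mul x (tmap T (bid K) (lmulb y) w).
Proof. exact: (gamma_rP x y).1. Qed.
Lemma rho_l_mul x y w : rho_l K (x ⊠ y) ⊙ w = tmap T (lmulb x) (bid K) (Delta_mul y w).
Proof. exact: (rho_lP x y).1. Qed.
Lemma rho_r_mul x y w : rho_r K (x ⊠ y) ⊙ w = tmap T (bid K) (lmulb x) (Delta_mul y w).
Proof. exact: (rho_rP x y).1. Qed.

Definition phi_r a : blin K C := bcomp (phi K) (rmulb a).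
Definition phi_l a : blin K C := bcomp (phi K) (lmulb a).

Lemma phi_r_separating : separating (range phi_r).
Proof. by move=> x h; apply: (phi_faithful K).1 => y; apply: (h (phi_r y)); exists y. Qed.
Lemma phi_l_separating : separating (range phi_l).
Proof. by move=> x h; apply: (phi_faithful K).2 => y; apply: (h (phi_l y)); exists y. Qed.

(** The functionals phi(. a) ⊗ phi(. b) separate points by the approximation property. Thus
    identities between multipliers descend to K ⊗ K. *)
Lemma tmul_faithful_l z : (forall w, z ⊙ w = 0) -> z = 0.
Proof.
move=> h.
have := @separating_tens R T _ _ _ _ (@q_approx R T K) phi_r_separating phi_r_separating z; apply.
move=> _ [_ [a _ <-] [_ [b _ <-] <-]]; rewrite bcompE.
have := h (a ⊠ b); rewrite tmul_pairr => /(congr1 (slice_r K (phi K))).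
by rewrite slice_r_tmap => /(congr1 (phi K)); rewrite !blin0.
Qed.

Lemma tmul_inj z z' : (forall w, z ⊙ w = z' ⊙ w) -> z = z'.
Proof.
move=> h; apply/eqP; rewrite -subr_eq0; apply/eqP; apply: tmul_faithful_l => w.
by rewrite tpairBl blinB h subrr.
Qed.

Lemma Delta_mul_gamma_l x a b : Delta_mul x (gamma_l K (a ⊠ b)) = gamma_l K ((x ∙ a) ⊠ b).
Proof. by apply: tmul_inj => w; rewrite -Delta_mul_mul !gamma_l_mul Delta_mulM. Qed.
Lemma Delta_mul_gamma_r x a b : Delta_mul x (gamma_r K (a ⊠ b)) = gamma_r K ((x ∙ a) ⊠ b).
Proof. by apply: tmul_inj => w; rewrite -Delta_mul_mul !gamma_r_mul Delta_mulM. Qed.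

Lemma Delta_mul_pair_r x a b : Delta_mul x (a ⊠ b) = tmap T (rmulb a) (bid K) (gamma_r K (x ⊠ b)).
Proof.
apply: tmul_inj => w; rewrite -Delta_mul_mul tmul_rmul1 gamma_r_mul tmap_comp tmul_pairl.
exact: congr1 (tmap_eq _ _ _).
Qed.

Lemma gamma_l_rmul x y k : gamma_l K (x ⊠ (y ∙ k)) =
  tmap T (rmulb k) (bid K) (gamma_l K (x ⊠ y)).
Proof.
apply: tmul_inj => w; rewrite tmul_rmul1 !gamma_l_mul tmap_comp; congr (Delta_mul x _).
by apply: tmap_eq => u //=; rewrite amulA.
Qed.

Lemma gamma_l_inv_rmul k z : biso_inv (gamma_l K) (tmap T (rmulb k) (bid K) z) =
  tmap T (bid K) (rmulb k) (biso_inv (gamma_l K) z).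
Proof.
have h u : gamma_l K (tmap T (bid K) (rmulb k) u) = tmap T (rmulb k) (bid K) (gamma_l K u).
  by tensor_ind u => x y; rewrite tmapE -gamma_l_rmul.
by rewrite -{1}(biso_invK (gamma_l K) z) -h biso_funK.
Qed.

(** Both sides are (g ⊗ 1) Delta(k) (1 ⊗ c). *)
Lemma gamma_r_lmul g k c : tmap T (lmulb g) (bid K) (gamma_r K (k ⊠ c)) =
  tmap T (bid K) (rmulb c) (rho_l K (g ⊠ k)).
Proof.
by apply: tmul_inj => w; rewrite tmul_rmul2 rho_l_mul tmul_lmul1 gamma_r_mul.
Qed.

Lemma phi_gamma_l x y : slice_r K (phi K) (gamma_l K (x ⊠ y)) = phi K x *: y.
Proof. by have [h _] := phi_left_invariant x; rewrite -h. Qed.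

(** Left invariance applied to Delta(xa)(b ⊗ 1); it serves to remove gamma_l^-1 from the product of
    the dual. *)
Lemma phi_Delta_mul_gamma_l x z :
  slice_r K (phi K) (Delta_mul x (gamma_l K z)) = slice_l K (phi_l x) z.
Proof.
by tensor_ind z => a b; rewrite Delta_mul_gamma_l phi_gamma_l slice_lE.
Qed.

Lemma amul_onto (x : K) : exists z, x = amul K z.
Proof.
have [_ [_ h]] := @q_essential R T K; have [B _ xB] := h _ (small1 x).
have : [set x] x by []. rewrite xB => -[z _ <-]; by exists z.
Qed.

End Galois.

Section Legs.
Variables (U V W A : bornType R).
Implicit Types (e : blin (V ⊗ A) (V ⊗ A)).

Lemma leg12E e v a b : leg12 e (v ⊠ (a ⊠ b)) = tmap T (bid V) (pairr A b) (e (v ⊠ a)).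
Proof.
rewrite /leg12 2!bcompE tassocVE tmapE; set u := e _; move: u => u.
by tensor_ind u => x y; rewrite tassocE tmapE.
Qed.

Lemma leg13E e v a b : leg13 e (v ⊠ (a ⊠ b)) = tmap T (bid V) (pairl A a) (e (v ⊠ b)).
Proof.
rewrite /leg13 2!bcompE tmapE tswapE leg12E; set u := e _; move: u => u.
by tensor_ind u => x y; rewrite !tmapE tswapE.
Qed.

Lemma coleg23E e u v a :
  coleg23 U e ((u ⊠ v) ⊠ a) = tmap T (pairl V u) (bid A) (e (v ⊠ a)).
Proof.
rewrite /coleg23 2!bcompE tassocE tmapE; set w := e _; move: w => w.
by tensor_ind w => x y; rewrite tassocVE tmapE.
Qed.

Lemma coleg13E e v u a :
  coleg13 U e ((v ⊠ u) ⊠ a) = tmap T (pairr V u) (bid A) (e (v ⊠ a)).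
Proof.
rewrite /coleg13 2!bcompE tmapE tswapE coleg23E; set w := e _; move: w => w.
by tensor_ind w => x y; rewrite !tmapE tswapE.
Qed.

End Legs.

Section Intertwiner.
Variables (V W A : bornType R) (e : blin (V ⊗ A) (V ⊗ A)) (e' : blin (W ⊗ A) (W ⊗ A)) (f : blin V W).
Hypothesis fe : forall z, e' (tmap T f (bid A) z) = tmap T f (bid A) (e z).

Lemma leg12_intertwine z : leg12 e' (tmap T f (bid _) z) = tmap T f (bid _) (leg12 e z).
Proof.
move: z; apply: tens_ind3; [by blinear|by blinear|] => v a b.
rewrite tmap_idr !leg12E -(tmap_idr f v a) fe; rewrite !tmap_comp; exact: tmap_eq.
Qed.

Lemma leg13_intertwine z : leg13 e' (tmap T f (bid _) z) = tmap T f (bid _) (leg13 e z).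
Proof.
move: z; apply: tens_ind3; [by blinear|by blinear|] => v a b.
rewrite tmap_idr !leg13E -(tmap_idr f v b) fe; rewrite !tmap_comp; exact: tmap_eq.
Qed.
End Intertwiner.

Section Contraction.
Variables (X U V Y : bornType R) (F : blin U (blin V C)).

(** The inner legs are paired by [F]; evaluating from the left or from the right moves a pairing
    from one tensor to the other. *)
Definition contraction : blin ((X ⊗ U) ⊗ (V ⊗ Y)) (X ⊗ Y) :=
  bcomp (tmap T (bid X) (bcomp (slice_l Y (bid C))
    (bcomp (tmap T (tlift T (uncurryP F)) (bid Y)) tassocV))) tassoc.

Lemma contraction_l x u z : contraction ((x ⊠ u) ⊠ z) = x ⊠ slice_l Y (F u) z.
Proof.
tensor_ind z => v y; rewrite /contraction bcompE tassocE tmapE !bcompE tassocVE tmapE.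
by rewrite !slice_lE /= tliftE.
Qed.

Lemma contraction_r z v y :
  contraction (z ⊠ (v ⊠ y)) = slice_r X (curry (bbilin_flip (uncurryP F)) v) z ⊠ y.
Proof.
tensor_ind z => x u; rewrite contraction_l slice_lE slice_rE.
by rewrite tpairZl tpairZr.
Qed.
End Contraction.

(** * The pairing with the dual and the regular coaction *)

Section Duality.
Variables (H A : bqg T) (d : dual_of H A).
Implicit Types (h k l f g c : H) (p q w y s t : A).

Definition ev h : blin A C := curry (bbilin_flip (uncurryP (dual_ev d))) h.

Lemma evE h w : ev h w = dual_ev d w h. Proof. by []. Qed.

Lemma dual_eq p q : (forall k, dual_ev d p k = dual_ev d q k) -> p = q.
Proof. by move=> h; apply: (dual_ev_inj (d := d)); exact: blin_eq. Qed.

Lemma Fl_surj y : exists f, y = Fl d f.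
Proof. by exists (biso_inv (Fl d) y); rewrite biso_invK. Qed.
Lemma Gr_surj y : exists f, y = Gr d f.
Proof. by exists (biso_inv (Gr d) y); rewrite biso_invK. Qed.

Lemma ev_separating : separating (range ev).
Proof.
move=> w h; apply: dual_eq => k; rewrite (blin0 (dual_ev d)).
by rewrite -evE (h (ev k)).
Qed.

Lemma dual_separating : separating (range (dual_ev d)).
Proof.
move=> x h; apply: (phi_r_separating (K := H)) => _ [a _ <-].
by rewrite -[RHS](h (dual_ev d (Fl d a))) ?FlE.
Qed.

Definition hact h : blin A A := bcomp (Fl d) (bcomp (lmulb h) (biso_inv (Fl d))).

Lemma hact_Fl h c : hact h (Fl d c) = Fl d (h ∙ c).
Proof. by rewrite /hact /= biso_funK. Qed.

Lemma hactE h q k : dual_ev d (hact h q) k = dual_ev d q (k ∙ h).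
Proof. by have [c ->] := Fl_surj q; rewrite hact_Fl !FlE amulA. Qed.

Lemma hactM h k q : hact (h ∙ k) q = hact h (hact k q).
Proof. by apply: dual_eq => l; rewrite !hactE amulA. Qed.

(** The product of the dual is convolution, (p ⊗ phi)(Delta(k)(1 ⊗ c)). *)
Lemma dual_mul_Fl p c k :
  dual_ev d (p ∙ Fl d c) k = phi H (slice_l H (dual_ev d p) (gamma_r H (k ⊠ c))).
Proof.
have [f ->] := Fl_surj p; rewrite dual_mul FlE; set z := biso_inv _ _.
rewrite -[LHS]/(phi_l k (slice_r H (phi H) z)) slice_rl -phi_Delta_mul_gamma_l biso_invK.
rewrite Delta_mul_pair_r slice_r_tmap -[LHS]/(phi_r f (slice_r H (bcomp (phi H) (bid H)) _)).
rewrite slice_rl bcompE; congr (phi H (slice_l H _ _)).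
by apply: blin_eq => x; rewrite FlE.
Qed.

Lemma dual_mul_Gr g y k :
  dual_ev d (Gr d g ∙ y) k = dual_ev d y (slice_l H (dual_psi d) (rho_l H (g ⊠ k))).
Proof.
have [c ->] := Fl_surj y; rewrite dual_mul_Fl FlE.
have -> : dual_ev d (Gr d g) = bcomp (dual_psi d) (lmulb g).
  by apply: blin_eq => x; rewrite GrE.
have := slice_l_tmap (lmulb g) (bid H) (dual_psi d) (gamma_r H (k ⊠ c)).
by rewrite gamma_r_lmul slice_l_tmap bcomp_bid /= => <-.
Qed.

Lemma psi_gamma_r k h : slice_l H (dual_psi d) (gamma_r H (k ⊠ h)) = dual_psi d k *: h.
Proof. by have [hk _] := dual_psi_invariant d k; rewrite -hk. Qed.

(** For z = u ⊗ t the product is (1 ⊗ u) Delta(tk) (1 ⊗ h), and right invariance collapses the first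
    leg. *)
Lemma psi_rho_r_gamma_r z k h :
  dual_psi d (slice_l H (dual_psi d) (rho_r H z ⊙ gamma_r H (k ⊠ h))) =
  dual_psi d (slice_l H (bcomp (dual_psi d) (rmulb h)) z ∙ k).
Proof.
tensor_ind z => u t; rewrite rho_r_mul Delta_mul_gamma_r slice_l_tmap.
rewrite bcomp_bid psi_gamma_r slice_lE blinZ blinZ.
by rewrite -[X in _ = dual_psi d X]/(rmulb k _) !blinZ [LHS]mulrC.
Qed.

(** The comultiplication of A is dual to the product of H: Delta(q) evaluated at h in the second leg
    is k -> q(kh), which is h.q. The defining formula contains rho_r^-1, which is removed by pairing
    with gamma_r under psi ⊗ psi. *)
Lemma ev_rho_l h p q : slice_r A (ev h) (rho_l A (p ⊠ q)) = p ∙ hact h q.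
Proof.
have [g ->] := Gr_surj p; have [f ->] := Gr_surj q; apply: dual_eq => k.
rewrite dual_rho_l; set z := biso_inv _ _.
rewrite slice_r_tmap GrE (_ : slice_r H _ (tswap z) = slice_l H (bcomp (ev h) (Gr d)) z); last first.
  by tensor_ind z => u v; rewrite tswapE slice_rE slice_lE.
have -> : bcomp (ev h) (Gr d) = bcomp (dual_psi d) (rmulb h).
  by apply: blin_eq => x; rewrite bcompE evE GrE.
rewrite -psi_rho_r_gamma_r biso_invK tmul_pairl dual_mul_Gr hactE GrE.
have -> : tmap T (lmulb g) (lmulb f) (gamma_r H (k ⊠ h)) =
    tmap T (bid H) (lmulb f) (tmap T (lmulb g) (bid H) (gamma_r H (k ⊠ h))).
  by rewrite tmap_comp; exact: tmap_eq.
by rewrite gamma_r_lmul !slice_l_tmap !bcomp_bid.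
Qed.

Section RegularCoaction.

(* The coaction of [A] on the regular module [H] given by D. *)
Definition regular_coact_fun : blin (H ⊗ A) (H ⊗ A) :=
  bcomp (tmap T (bid H) (Fl d)) (bcomp tswap (bcomp (biso_inv (gamma_l H))
    (tmap T (bid H) (biso_inv (Fl d))))).
Definition regular_coact_inv : blin (H ⊗ A) (H ⊗ A) :=
  bcomp (tmap T (bid H) (Fl d)) (bcomp (gamma_l H) (bcomp tswap
    (tmap T (bid H) (biso_inv (Fl d))))).

Lemma tmap_FlK z : tmap T (bid H) (biso_inv (Fl d)) (tmap T (bid H) (Fl d) z) = z.
Proof. by rewrite tmap_comp -[RHS]tmap_id; apply: tmap_eq => // x; exact: biso_funK. Qed.
Lemma tmap_FlVK z : tmap T (bid H) (Fl d) (tmap T (bid H) (biso_inv (Fl d)) z) = z.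
Proof. by rewrite tmap_comp -[RHS]tmap_id; apply: tmap_eq => // x; exact: biso_invK. Qed.

Lemma regular_coact_funK : cancel regular_coact_fun regular_coact_inv.
Proof. by move=> z; rewrite /regular_coact_fun /regular_coact_inv /= tmap_FlK tswapK biso_invK tmap_FlVK. Qed.
Lemma regular_coact_invK : cancel regular_coact_inv regular_coact_fun.
Proof. by move=> z; rewrite /regular_coact_fun /regular_coact_inv /= tmap_FlK biso_funK tswapK tmap_FlVK. Qed.
Definition regular_coact : biso (H ⊗ A) (H ⊗ A) := Biso regular_coact_funK regular_coact_invK.

Lemma regular_coact_Fl l f : regular_coact (l ⊠ Fl d f) = tmap T (bid H) (Fl d) (tswap (biso_inv (gamma_l H) (l ⊠ f))).
Proof. by rewrite /= tmapE biso_funK. Qed.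

End RegularCoaction.

(** With q = Fl c, right linearity lets c slide through gamma_l^-1, where it turns phi into q; what
    remains is the product of the dual. *)
Lemma slice_regular_coact q l y : slice_l A (dual_ev d q) (regular_coact (l ⊠ y)) = hact l q ∙ y.
Proof.
have [c ->] := Fl_surj q; have [f ->] := Fl_surj y.
rewrite regular_coact_Fl hact_Fl dual_mul slice_l_tmap bcomp_bid; congr (Fl d _).
have -> : (l ∙ c) ⊠ f = tmap T (rmulb c) (bid H) (l ⊠ f) by rewrite tmapE.
rewrite gamma_l_inv_rmul slice_r_tmap.
have -> : bcomp (phi H) (rmulb c) = dual_ev d (Fl d c).
  by apply: blin_eq => x; rewrite FlE.
set z := biso_inv _ _; move: z => z.
by tensor_ind z => u v; rewrite tswapE slice_rE slice_lE.
Qed.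

Lemma slice_dual_inj (V : bornType R) (S : set (blin V C)) (z z' : H ⊗ V) :
  separating S ->
  (forall q, slice_l V (dual_ev d q) z = slice_l V (dual_ev d q) z') -> z = z'.
Proof.
move=> sS h; apply/eqP; rewrite -subr_eq0; apply/eqP.
apply: (slice_l_separating (@q_approx R T H) sS dual_separating) => _ [q _ <-].
by rewrite blinB h subrr.
Qed.

Lemma regular_coact_rmul y z : regular_coact (tmap T (bid H) (rmulb y) z) = tmap T (bid H) (rmulb y) (regular_coact z).
Proof.
tensor_ind z => l t; rewrite tmapE; apply: (slice_dual_inj ev_separating) => q.
by rewrite slice_l_tmap bcomp_bid !slice_regular_coact /= amulA.
Qed.

(** Right multiplications are endomorphisms of the left regular module. Commuting with them is what
    lets Gamma descend along H ⊗ V -> V. *)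
Lemma regular_coact_lmul k z : regular_coact (tmap T (rmulb k) (bid A) z) = tmap T (rmulb k) (bid A) (regular_coact z).
Proof.
tensor_ind z => l t; rewrite tmapE; apply: (slice_dual_inj ev_separating) => q.
rewrite slice_l_tmap (_ : bcomp _ (rmulb k) = dual_ev d (hact k q)).
  by rewrite !slice_regular_coact -hactM.
by apply: blin_eq => x; rewrite hactE.
Qed.

Lemma regular_coact_inv_lmul k z :
  biso_inv regular_coact (tmap T (rmulb k) (bid A) z) = tmap T (rmulb k) (bid A) (biso_inv regular_coact z).
Proof. by rewrite -{1}(biso_invK regular_coact z) -regular_coact_lmul biso_funK. Qed.

Lemma rho_l_hact s l q :
  rho_l A (s ⊠ hact l q) = tmap T (bid A) (hact l) (rho_l A (s ⊠ q)).
Proof.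
apply/eqP; rewrite -subr_eq0; apply/eqP.
apply: (slice_r_separating (@q_approx R T A) ev_separating ev_separating) => _ [h _ <-].
rewrite blinB slice_r_tmap (_ : bcomp (ev h) (hact l) = ev (h ∙ l)).
  by rewrite !ev_rho_l hactM subrr.
by apply: blin_eq => w; rewrite bcompE !evE hactE.
Qed.

(** The orbit map h -> h.q of [hact]. *)
Definition hactr q : blin H A := bcomp (Fl d) (rmulb (biso_inv (Fl d) q)).

Lemma lmul_faithful (z z' : A ⊗ A) :
  (forall s, tmap T (lmulb s) (bid A) z = tmap T (lmulb s) (bid A) z') -> z = z'.
Proof.
move=> h; apply/eqP; rewrite -subr_eq0; apply/eqP.
apply: (slice_r_separating (@q_approx R T A) (phi_l_separating (K := A)) ev_separating).
move=> w _; apply: (phi_l_separating (K := A)) => _ [s _ <-].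
have := congr1 (fun u => phi A (slice_r A w u)) (h s).
by rewrite blinB blinB !slice_r_tmap !bcomp_bid => /eqP; rewrite -subr_eq0 => /eqP.
Qed.

(** After left multiplication by s', both sides contract [rho_l A (s' ⊠ q)] with Gamma(l ⊗ t): read
    from one side by [ev_rho_l], from the other by [slice_regular_coact]. *)
Lemma regular_coact_comult q l s t : tmap T (bcomp (rmulb s) (hactr q)) (bid A) (regular_coact (l ⊠ t)) =
  Delta_mul (hact l q) (s ⊠ t).
Proof.
apply: lmul_faithful => s'; rewrite tmap_comp.
have -> u : tmap T (bcomp (lmulb s') (bcomp (rmulb s) (hactr q))) (bcomp (bid A) (bid A)) u =
    tmap T (rmulb s) (bid A) (contraction A A (dual_ev d) (rho_l A (s' ⊠ q) ⊠ u)).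
  by tensor_ind u => l' t'; rewrite contraction_r !tmapE [curry _ _]/(ev l') ev_rho_l /= -amulA.
have -> z : contraction A A (dual_ev d) (z ⊠ regular_coact (l ⊠ t)) =
    tmap T (bid A) (bcomp (rmulb t) (hact l)) z.
  by tensor_ind z => m n; rewrite contraction_l slice_regular_coact tmapE.
rewrite -rho_l_mul rho_l_hact tmul_pairr !tmap_comp; exact: tmap_eq.
Qed.

(* Slicing the first leg by [q], both sides become multiplication by Delta of [hact l q],
   so the coassociativity of [A] is replaced by [hact] being an action of [H]. *)
Lemma regular_coact_pentagon (z : H ⊗ (A ⊗ A)) :
  tmap T (bid H) (gamma_r A) (leg12 regular_coact z) =
  leg12 regular_coact (leg13 regular_coact (tmap T (bid H) (gamma_r A) z)).
Proof.
move: z; apply: tens_ind3; [by blinear|by blinear|] => l y w.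
have sepAA := @separating_tens R T A A _ _ (@q_approx R T A) ev_separating ev_separating.
apply: (slice_dual_inj sepAA) => q.
rewrite slice_l_tmap bcomp_bid leg12E slice_l_tmap bcomp_bid slice_regular_coact -Delta_mul_gamma_r tmapE.
set u := gamma_r A _; move: u => u.
move: u; apply: tens_ind; [exact: blinear_comp (blinear_id _)|by blinear|] => s t.
rewrite leg13E -regular_coact_comult; set v := regular_coact _; move: v => v.
tensor_ind v => l' t'.
by rewrite !tmapE leg12E slice_l_tmap bcomp_bid slice_regular_coact.
Qed.

(** Delta(h) is only a multiplier; translating p by k and q by l supplies the factor k ⊗ l that
    brings it into H ⊗ H. *)
Lemma dual_mul_Delta_mul p q k l h : dual_ev d (hact k p ∙ hact l q) h =
  dual_ev d p (slice_r H (dual_ev d q) (Delta_mul h (k ⊠ l))).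
Proof.
have [a ->] := Fl_surj p; have [b ->] := Fl_surj q.
rewrite !hact_Fl dual_mul_Fl.
have FlphiE c : dual_ev d (Fl d c) = phi_r c by apply: blin_eq => x; rewrite FlE.
rewrite !FlphiE -slice_rl.
have := Delta_mul_pair_r h (k ∙ a) (l ∙ b); rewrite -tmulE Delta_mul_mul tmul_pairr.
move=> /(congr1 (fun u => phi H (slice_r H (phi H) u))).
by rewrite !slice_r_tmap bcomp_bid => /esym.
Qed.

(** * Fourier inversion and the Galois map of the dual *)

Section FourierInverse.
Variables (Th : biso H A).
(** In the application [Th] is [P] followed by the inverse of the map [Fl] of A; the two hypotheses
    are then evaluation and product in the bidual. *)
Hypothesis phi_Th : forall w h, phi A (w ∙ Th h) = dual_ev d w h.
Hypothesis ThM : forall h k,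
  Th (h ∙ k) = slice_r A (phi A) (biso_inv (gamma_l A) (Th h ⊠ Th k)).

Lemma phi_rho_gamma p q (u : H ⊗ A) :
  slice_r A (phi A) (rho_l A (p ⊠ q) ⊙ gamma_l A (tmap T Th (bid A) u)) =
  p ∙ slice_l A (dual_ev d q) u.
Proof.
tensor_ind u => l t; rewrite tmapE rho_l_mul Delta_mul_gamma_l slice_r_tmap bcomp_bid.
rewrite phi_gamma_l slice_lE phi_Th; reflexivity.
Qed.

(* Fourier inversion: [Th] followed by the inverse of [Fl] plays the role of the antipode. *)
Lemma Th_regular_coact h y : tmap T Th (bid A) (regular_coact (h ⊠ y)) = biso_inv (gamma_l A) (y ⊠ Th h).
Proof.
rewrite -[LHS](biso_funK (gamma_l A)); congr (biso_inv _ _).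
apply/eqP; rewrite -subr_eq0; apply/eqP.
have := @separating_tens R T A A _ _ (@q_approx R T A)
  (@phi_l_separating A) (@phi_l_separating A); apply.
move=> _ [_ [s _ <-] [_ [w _ <-] <-]]; rewrite bcompE.
suff h0 : slice_r A (phi A) ((s ⊠ w) ⊙ gamma_l A (tmap T Th (bid A) (regular_coact (h ⊠ y)))) =
    slice_r A (phi A) ((s ⊠ w) ⊙ (y ⊠ Th h)).
  move/(congr1 (phi A)): h0; rewrite !tmul_pairl !slice_r_tmap => /eqP.
  by rewrite -subr_eq0 !blinB => /eqP.
(* Writing s ⊗ w in the range of rho_l produces Delta(q) Delta(Th l) = Delta(q Th l), to which
   invariance applies. *)
rewrite -{1}(biso_invK (rho_l A) (s ⊠ w)).
have -> z : slice_r A (phi A) (rho_l A z ⊙ gamma_l A (tmap T Th (bid A) (regular_coact (h ⊠ y)))) =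
    slice_r A (ev h) (rho_l A z) ∙ y.
  by tensor_ind z => p q; rewrite phi_rho_gamma slice_regular_coact ev_rho_l amulA.
rewrite biso_invK tmulE !slice_rE phi_Th evE.
by rewrite -[LHS]/(rmulb y _) blinZ.
Qed.

(** The case of the regular module in the proof that applying D twice returns the module. *)
Lemma phi_regular_coact k h : slice_r H (phi A) (regular_coact (k ⊠ Th h)) = h ∙ k.
Proof.
rewrite -[LHS](biso_funK Th) -[RHS](biso_funK Th); congr (biso_inv _ _).
rewrite ThM -Th_regular_coact slice_r_tmap bcomp_bid; reflexivity.
Qed.

(** Sliced by p ⊗ q, the two coactions give (k.p)(l.q) Th(h), and phi evaluates the product of the
    dual at h. This is tensor compatibility for regular modules. *)
Lemma phi_regular_coact_comult k l h :
  slice_r (H ⊗ H) (phi A) (coleg13 H regular_coact (coleg23 H regular_coact ((k ⊠ l) ⊠ Th h))) = Delta_mul h (k ⊠ l).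
Proof.
apply/eqP; rewrite -subr_eq0; apply/eqP.
have := @separating_tens R T H H _ _ (@q_approx R T H) dual_separating dual_separating; apply.
move=> _ [_ [p _ <-] [_ [q _ <-] <-]]; set fpq := bcomp _ _.
rewrite blinB [fpq (Delta_mul _ _)]bcompE -dual_mul_Delta_mul; apply/eqP; rewrite subr_eq0; apply/eqP.
rewrite slice_rl coleg23E -phi_Th amulA -(slice_regular_coact q l (Th h)).
congr (phi A _); set v := regular_coact _; move: v => v.
tensor_ind v => l' y'; rewrite tmap_idr coleg13E slice_l_tmap bidE.
have -> : bcomp fpq (pairr H l') = dual_ev d q l' *: dual_ev d p.
  by apply: blin_eq => x; rewrite !bcompE /= slice_rE blinZ.
have -> (c : R[i]) (w : blin H C) z : slice_l A (c *: w) z = c *: slice_l A w z.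
  by tensor_ind z => x y; rewrite !slice_lE hscaleE scalerA.
by rewrite slice_regular_coact slice_lE -[RHS]/(lmulb (hact k p) _) blinZ.
Qed.

End FourierInverse.
End Duality.
End Algebra.

(** * Modules and comodules *)

Section ModulesComodules.
Local Open Scope classical_set_scope.
Local Open Scope ring_scope.
Variables (R : realType) (T : tensor_product R).
Local Notation "V ⊗ W" := (tobj T V W) (at level 40, left associativity).
Local Notation "v ⊠ w" := (tpair T v w) (at level 40, left associativity).
Local Notation "x ∙ y" := (amul _ (x ⊠ y)) (at level 40, left associativity).
Local Notation "z ⊙ w" := (tmul _ _ (z ⊠ w)) (at level 40, left associativity).
Local Notation C := (R[i]^o : bornType R).

Lemma induces_iso_onto (X Y : bornType R) (q : blin X Y) N y :
  induces_iso q N -> exists x, q x = y.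
Proof.
move=> [_ h]; have [B _ yB] := h _ (small1 y).
have : [set y] y by []. by rewrite yB => -[x _ <-]; exists x.
Qed.

(** The section [s] is an arbitrary choice; the composite does not depend on it and is bounded
    because small sets lift along [q]. *)
Lemma descend (X Y Z : bornType R) (q : blin X Y) N (F : blin X Z) :
  induces_iso q N -> (forall x, q x = 0 -> F x = 0) ->
  exists G : blin Y Z, forall x, G (q x) = F x.
Proof.
move=> iq F0; have /boolp.choice[s sK] y := induces_iso_onto y iq.
have Feq x x' : q x = q x' -> F x = F x'.
  move=> qx; apply/eqP; rewrite -subr_eq0 -blinB; apply/eqP/F0.
  by rewrite blinB qx subrr.
have lin : linear (fun y => F (s y)).
  move=> a y y'; rewrite -blinZ -blinD; apply: Feq.
  by rewrite blinD blinZ !sK.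
have bnd : Defs.bounded_fun (fun y => F (s y)).
  move=> S sS; have [B sB SB] := iq.2 _ sS.
  apply: smallS (blin_bnd F sB) => _ [y Sy <-].
  move: Sy; rewrite SB => -[b Bb by_]; exists b => //.
  by apply: Feq; rewrite sK.
by exists (Blin lin bnd) => x; apply: Feq; rewrite sK.
Qed.

(** Currying in W reduces this to a map on X with values in a Hom space. *)
Lemma descend_tens (X Y Z W : bornType R) (q : blin X Y) N (F : blin (X ⊗ W) Z) :
  induces_iso q N -> (forall x w, q x = 0 -> F (x ⊠ w) = 0) ->
  exists G : blin (Y ⊗ W) Z, forall z, G (tmap T q (bid W) z) = F z.
Proof.
move=> iq F0; pose F' := curry (bbilin_comp F (bid X) (bid W) (tpairP T X W)).
have [x qx|G hG] := descend (F := F') iq.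
  by apply: blin_eq => w; exact: F0.
exists (tlift T (uncurryP G)); apply: tens_ind; [by blinear|by blinear|] => x w.
by rewrite tmap_idr tliftE hG.
Qed.

Lemma kernel_closure (X Z : bornType R) (f : blin X Z) (S : set X) x :
  (forall y, S y -> f y = 0) -> born_closure (lspan S) x -> f x = 0.
Proof.
move=> S0 /(_ [set y | f y = 0]); apply.
  move=> _ [n [c [s [Ss ->]]]]; rewrite /= blin_sum big1 // => i _.
  by rewrite blinZ S0 ?scaler0.
move=> u l u0 /(born_cvg_map f) cu; apply: (born_cvg_unique cu).
exists [set 0]; first exact: small1.
move=> e e0; exists 0%N => n _; exists 0 => //.
by rewrite u0 subr0 scaler0.
Qed.

Lemma born_closed_closure (X : bornType R) (S : set X) : born_closed (born_closure S).
Proof.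
by move=> u l Su cu F SF cF; apply: (cF u) => // n; exact: Su.
Qed.

Lemma born_cvg_cst (X : bornType R) (x : X) : born_cvg (fun=> x) x.
Proof.
exists [set 0]; first exact: small1.
by move=> e e0; exists 0%N => n _; exists 0; rewrite // subrr scaler0.
Qed.

Lemma linear_subspace_lspan (X : lmodType R[i]) (S : set X) : linear_subspace (lspan S).
Proof.
split.
  by exists 0%N, (fun=> 0), (fun=> 0); split => [[]|] //; rewrite big_ord0.
move=> a x y [n [c [s [Ss ->]]]] [m [c' [s' [Ss' ->]]]].
exists (n + m)%N, (fun i => match fintype.split i with inl j => a * c j | inr k => c' k end),
  (fun i => match fintype.split i with inl j => s j | inr k => s' k end); split.
  by move=> i; case: fintype.split.
rewrite big_split_ord /= scaler_sumr; congr (_ + _); apply: eq_bigr => i _.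
  by rewrite (unsplitK (inl i)) scalerA.
by rewrite (unsplitK (inr i)).
Qed.

(** The closure is an intersection of closed sets, so the two arguments are extended one at a time,
    through closed preimages of the closure. *)
Lemma linear_subspace_closure (X : bornType R) (S : set X) : linear_subspace S ->
  linear_subspace (born_closure S).
Proof.
move=> [S0 SP]; have cS := @born_closed_closure X S.
split; first by move=> F SF _; exact: SF.
move=> a x y Cx Cy; apply: (Cy [set y | born_closure S (a *: x + y)]); last first.
  move=> u l Su cu; apply: (cS (fun n => a *: x + u n)) => //.
  exact: born_cvg_lin (born_cvg_cst x) cu.
move=> {Cy}y Sy; apply: (Cx [set x | born_closure S (a *: x + y)]); last first.
  move=> u l Su cu; apply: (cS (fun n => a *: u n + y)) => //.
  exact: born_cvg_lin cu (born_cvg_cst y).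
by move=> {Cx}x Sx F SF _; apply: SF; exact: SP.
Qed.

Lemma coleg13_pairr (V W A : bornType R) (e : blin (V ⊗ A) (V ⊗ A)) (w : W) z :
  coleg13 W e (tmap T (pairr V w) (bid A) z) = tmap T (pairr V w) (bid A) (e z).
Proof. by tensor_ind z => v a; rewrite tmap_idr coleg13E. Qed.

Lemma coleg23_pairl (V W A : bornType R) (e : blin (V ⊗ A) (V ⊗ A)) (w : W) z :
  coleg23 W e (tmap T (pairl V w) (bid A) z) = tmap T (pairl V w) (bid A) (e z).
Proof. by tensor_ind z => v a; rewrite tmap_idr coleg23E. Qed.

Lemma coleg13K (V W A : bornType R) (e e' : blin (V ⊗ A) (V ⊗ A)) z :
  cancel e e' -> coleg13 W e' (coleg13 W e z) = z.
Proof.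
move=> eK; move: z; apply: (tens_ext3 (f := bcomp (coleg13 W e') (coleg13 W e)) (g := bid _)).
by move=> v w a; rewrite bcompE coleg13E coleg13_pairr eK tmap_idr.
Qed.

Lemma coleg23K (V W A : bornType R) (e e' : blin (V ⊗ A) (V ⊗ A)) z :
  cancel e e' -> coleg23 W e' (coleg23 W e z) = z.
Proof.
move=> eK; move: z; apply: (tens_ext3 (f := bcomp (coleg23 W e') (coleg23 W e)) (g := bid _)).
by move=> w v a; rewrite bcompE coleg23E coleg23_pairl eK tmap_idr.
Qed.

Lemma tmap_interchange (U V U' V' : bornType R) (f : blin U V) (g : blin U' V') z :
  tmap T (bid V) g (tmap T f (bid U') z) = tmap T f (bid V') (tmap T (bid U) g z).
Proof. by rewrite !tmap_comp; exact: tmap_eq. Qed.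

Lemma leg12_comp (V A : bornType R) (e e' : blin (V ⊗ A) (V ⊗ A)) z :
  leg12 (bcomp e e') z = leg12 e (leg12 e' z).
Proof. by rewrite /leg12 /= tassocK tmap_comp; congr (tassoc _); exact: tmap_eq. Qed.

Lemma leg13_comp (V A : bornType R) (e e' : blin (V ⊗ A) (V ⊗ A)) z :
  leg13 (bcomp e e') z = leg13 e (leg13 e' z).
Proof.
have ss (u : V ⊗ (A ⊗ A)) : tmap T (bid V) tswap (tmap T (bid V) tswap u) = u.
  by rewrite tmap_comp -[RHS]tmap_id; apply: tmap_eq => // x; exact: tswapK.
by rewrite /leg13 !(bcompE (tmap _ _ _), bcompE (leg12 _)) ss leg12_comp.
Qed.

Section Coassociativity.
Variables (K : bqg T) (V : bornType R) (e : blin (V ⊗ K) (V ⊗ K)).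
Let G := tmap T (bid V) (gamma_r K).
Let G' := tmap T (bid V) (biso_inv (gamma_r K)).

Lemma coassoc_of_gamma : (forall z, G (leg12 e z) = leg12 e (leg13 e (G z))) ->
  forall z, G (leg12 e (G' z)) = leg12 e (leg13 e z).
Proof.
move=> h z; rewrite h /G /G' tmap_comp (_ : tmap T _ _ z = z) // -[RHS]tmap_id.
by apply: tmap_eq => // x; rewrite bcompE biso_invK.
Qed.

Lemma gamma_of_coassoc : (forall z, G (leg12 e (G' z)) = leg12 e (leg13 e z)) ->
  forall z, G (leg12 e z) = leg12 e (leg13 e (G z)).
Proof.
move=> h z; rewrite -h /G /G' tmap_comp (_ : tmap T _ (bcomp _ _) z = z) // -[RHS]tmap_id.
by apply: tmap_eq => // x; rewrite bcompE biso_funK.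
Qed.
End Coassociativity.

Lemma coact_coassoc_gamma (K : bqg T) (V : bornType R) (eta : esscomod K V) z :
  tmap T (bid V) (gamma_r K) (leg12 eta z) =
  leg12 eta (leg13 eta (tmap T (bid V) (gamma_r K) z)).
Proof. exact: gamma_of_coassoc (coact_coassoc eta) z. Qed.

Definition act_on (H : bqg T) (V : bornType R) (lam : blin (H ⊗ V) V) (v : V) : blin H V :=
  bcomp lam (pairr H v).

Lemma act_onE (H : bqg T) (V : bornType R) (lam : blin (H ⊗ V) V) v h :
  act_on lam v h = lam (h ⊠ v).
Proof. by []. Qed.

(** * A coaction and the action it induces *)

Section Comodule.
Variables (K : bqg T) (V : bornType R) (eta : esscomod K V).
Implicit Types (v : V) (x y a b c f g s t : K).

(** The orbit map of v under D(eta), written on K through the Fourier transform. *)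
Definition hit v : blin K V := bcomp (slice_r V (phi K)) (bcomp eta (pairl K v)).

Lemma hitE v g : hit v g = slice_r V (phi K) (eta (v ⊠ g)). Proof. by []. Qed.

Let N : blin (V ⊗ (K ⊗ K)) (V ⊗ (K ⊗ K)) := bcomp (leg12 eta) (leg13 eta).
Let NE z : N z = leg12 eta (leg13 eta z). Proof. by []. Qed.

Lemma legs_rmul s z : N (tmap T (bid V) (tmap T (rmulb s) (bid K)) z) =
  tmap T (bid V) (tmap T (rmulb s) (bid K)) (N z).
Proof.
move: z; apply: tens_ind3; [by blinear|by blinear|] => v a b.
rewrite tmap_idl tmap_idr !NE !leg13E; set u := eta _; move: u => u.
tensor_ind u => v' b'; rewrite !tmap_idl !leg12E.
have -> : v' ⊠ rmulb s a = tmap T (bid V) (rmulb s) (v' ⊠ a) by rewrite tmapE.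
rewrite coact_mul !tmap_comp; apply: tmap_eq => // x.
by rewrite !bcompE [RHS]tmap_idr.
Qed.

Lemma legs_gamma_r v x t : N (v ⊠ gamma_r K (x ⊠ t)) =
  tmap T (bid V) (gamma_r K) (tmap T (bid V) (pairr K t) (eta (v ⊠ x))).
Proof.
rewrite NE -coact_coassoc tmap_idl biso_funK leg12E; reflexivity.
Qed.

(** Coassociativity in the form (id ⊗ Delta) eta = eta_12 eta_13, applied to z to stay within K ⊗
    K. *)
Lemma legs_Delta_mul v x z : N (v ⊠ Delta_mul x z) =
  tmap T (bid V) (mh_left (Delta K)) (tassoc (eta (v ⊠ x) ⊠ z)).
Proof.
tensor_ind z => s t; rewrite Delta_mul_pair_r -tmap_idl legs_rmul legs_gamma_r.
set u := eta _; move: u => u; tensor_ind u => v' x'.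
rewrite tassocE !tmap_idl -Delta_mul_pair_r; congr (_ ⊠ _).
by rewrite mh_leftE.
Qed.

Let slice3 : blin (V ⊗ (K ⊗ K)) (V ⊗ K) := tmap T (bid V) (slice_r K (phi K)).

Lemma slice_legs v f g : slice3 (N (v ⊠ (f ⊠ g))) = eta (hit v g ⊠ f).
Proof.
rewrite NE leg13E hitE; set u := eta (v ⊠ g); move: u => u.
tensor_ind u => v' g'; rewrite tmap_idl leg12E slice_rE tpairZl blinZ.
set u := eta _; move: u => u; tensor_ind u => x y.
by rewrite /slice3 !tmap_idl slice_rE tpairZr.
Qed.

Lemma slice_legs_gamma_l v c b : slice3 (N (v ⊠ gamma_l K (c ⊠ b))) = hit v c ⊠ b.
Proof.
(* Delta(xa)(b ⊗ 1) is Delta(x) applied to gamma_l(a ⊗ b), the form that [legs_Delta_mul]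
   accepts. *)
have [w ->] := amul_onto c; tensor_ind w => x a.
rewrite -Delta_mul_gamma_l legs_Delta_mul hitE.
have -> : v ⊠ (x ∙ a) = tmap T (bid V) (rmulb a) (v ⊠ x) by rewrite tmapE.
rewrite coact_mul; set u := eta _; move: u => u.
tensor_ind u => v' x'; rewrite /slice3 tassocE !tmap_idl mh_leftE.
by rewrite [mL _ _]Delta_mul_gamma_l phi_gamma_l slice_rE tpairZl tpairZr.
Qed.

(* Recovers the coaction from the action it induces; everything about D on comodules
   follows from this formula. *)
Lemma coact_hit v f g :
  eta (hit v g ⊠ f) = tmap T (hit v) (bid K) (biso_inv (gamma_l K) (f ⊠ g)).
Proof.
rewrite -slice_legs -{1}(biso_invK (gamma_l K) (f ⊠ g)).
set z := biso_inv _ _; move: z => z.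
by tensor_ind z => c b; rewrite slice_legs_gamma_l tmap_idr.
Qed.
End Comodule.

Section Correspondence.
Variables (H A : bqg T) (d : dual_of H A) (Th : biso H A).
Hypothesis phi_Th : forall (w : A) (h : H), phi A (w ∙ Th h) = dual_ev d w h.
Hypothesis ThM : forall h k : H,
  Th (h ∙ k) = slice_r A (phi A) (biso_inv (gamma_l A) (Th h ⊠ Th k)).
Local Notation regular_coact := (regular_coact d).
Implicit Types (V W : bornType R) (h k l : H) (y a : A).

Definition intertwined V (lam : blin (H ⊗ V) V) (eta : blin (V ⊗ A) (V ⊗ A)) : Prop :=
  forall h v y, eta (lam (h ⊠ v) ⊠ y) = tmap T (act_on lam v) (bid A) (regular_coact (h ⊠ y)).

(** * From modules to comodules *)

Section ModuleToComodule.
Variables (V : bornType R) (lam : essmod H V).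

Lemma act_onto v : exists x, lam x = v.
Proof. exact: induces_iso_onto (act_essential lam). Qed.

(** The kernel of the action is the closure of the balancing relations; these are respected because
    [G] commutes with right multiplications. *)
Lemma act_descend (G : blin (H ⊗ A) (H ⊗ A)) :
  (forall k z, G (tmap T (rmulb k) (bid A) z) = tmap T (rmulb k) (bid A) (G z)) ->
  exists E : blin (V ⊗ A) (V ⊗ A),
    forall z, E (tmap T lam (bid A) z) = tmap T lam (bid A) (coleg13 V G z).
Proof.
move=> GR; pose F := bcomp (tmap T lam (bid A)) (coleg13 V G).
have [|E hE] := descend_tens (F := F) (act_essential lam); last by exists E.
move=> x a /(act_essential lam).1 Nx.
apply: (kernel_closure (f := bcomp F (pairr _ a)) _ Nx) => _ [k [h [v ->]]].
apply/eqP; rewrite blinB subr_eq0; apply/eqP.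
have FE w l : F ((l ⊠ w) ⊠ a) = tmap T (act_on lam w) (bid A) (G (l ⊠ a)).
  by rewrite /F bcompE coleg13E tmap_comp; apply: tmap_eq.
rewrite [LHS]FE [RHS]FE -[(k ∙ h) ⊠ a](tmap_idr T (rmulb h)) GR !tmap_comp.
by apply: tmap_eq => // l; rewrite bcompE !act_onE act_mul.
Qed.

(** The orbit maps intertwine Gamma with the descended map, and the action is onto; so each axiom is
    checked on orbits, where it holds for Gamma. *)
Lemma coact_exists : exists eta : esscomod A V, intertwined lam eta.
Proof.
have [E hE] := act_descend (regular_coact_lmul d); have [E' hE'] := act_descend (regular_coact_inv_lmul d).
have EK : cancel E E'.
  move=> z; tensor_ind z => v y; have [x <-] := act_onto v.
  by rewrite -tmap_idr hE hE' (coleg13K _ (biso_funK regular_coact)).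
have E'K : cancel E' E.
  move=> z; tensor_ind z => v y; have [x <-] := act_onto v.
  by rewrite -tmap_idr hE' hE (coleg13K _ (biso_invK regular_coact)).
have inter v z : E (tmap T (act_on lam v) (bid A) z) = tmap T (act_on lam v) (bid A) (regular_coact z).
  have fE u : tmap T (act_on lam v) (bid A) u =
      tmap T lam (bid A) (tmap T (pairr H v) (bid A) u).
    by rewrite tmap_comp; apply: tmap_eq.
  by rewrite !fE hE coleg13_pairr.
pose eta := Biso EK E'K.
have eta_mul y z : eta (tmap T (bid V) (rmulb y) z) = tmap T (bid V) (rmulb y) (eta z).
  tensor_ind z => v a; have [x <-] := act_onto v; tensor_ind x => h w.
  rewrite tmap_idl -[_ ⊠ rmulb y a](tmap_idr T (act_on lam w)) -[_ ⊠ a](tmap_idr T (act_on lam w)).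
  rewrite [LHS]inter [eta _]inter -(tmap_idl T (rmulb y)) regular_coact_rmul !tmap_comp.
  exact: tmap_eq.
have eta_coassoc z : tmap T (bid V) (gamma_r A)
    (leg12 eta (tmap T (bid V) (biso_inv (gamma_r A)) z)) = leg12 eta (leg13 eta z).
  move: z; apply: coassoc_of_gamma; apply: tens_ind; [by blinear|by blinear|] => v u.
  have [x <-] := act_onto v; tensor_ind x => l w.
  rewrite -[_ ⊠ u](tmap_idr T (act_on lam w)) tmap_interchange.
  rewrite (leg12_intertwine (inter w)) tmap_interchange.
  by rewrite (leg13_intertwine (inter w)) (leg12_intertwine (inter w)) regular_coact_pentagon.
exists (EssComod eta_mul eta_coassoc) => l v y.
by rewrite -inter tmap_idr.
Qed.
End ModuleToComodule.

(** * From comodules to modules *)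

Section ComoduleToModule.
Variables (V : bornType R) (eta : esscomod A V).

Definition dact : blin (H ⊗ V) V :=
  bcomp (slice_r V (phi A)) (bcomp eta (bcomp tswap (tmap T Th (bid V)))).

Lemma dactE h v : dact (h ⊠ v) = hit eta v (Th h).
Proof. by rewrite /dact !bcompE tmap_idr tswapE. Qed.

Lemma dact_intertwined : intertwined dact eta.
Proof.
move=> h v y; rewrite dactE coact_hit -(Th_regular_coact phi_Th) tmap_comp.
by apply: tmap_eq => // k; rewrite act_onE dactE.
Qed.

Lemma dact_mul h k v : dact ((h ∙ k) ⊠ v) = dact (h ⊠ dact (k ⊠ v)).
Proof.
rewrite !dactE [RHS]hitE coact_hit ThM slice_r_tmap bcomp_bid; reflexivity.
Qed.

Lemma phi_unit : exists a, phi A a = 1.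
Proof.
have [[x x0] _] := @q_essential R T A.
have [a a0] : exists a, phi A a <> 0.
  apply: contrapT => /forallNP h; apply: x0; apply: (phi_faithful A).1 => y.
  exact: contrapT (h _).
exists ((phi A a : R[i])^-1 *: a); rewrite blinZ; apply: mulVf; exact/eqP.
Qed.

Let swapV : blin (V ⊗ A) (H ⊗ V) :=
  bcomp (tmap T (biso_inv Th) (bid V)) (bcomp tswap (biso_inv eta)).

Let swapV_coact v y : swapV (eta (v ⊠ y)) = biso_inv Th y ⊠ v.
Proof. by rewrite /swapV !bcompE biso_funK tswapE tmap_idr. Qed.

Lemma dact_swapV z : dact (swapV z) = slice_r V (phi A) z.
Proof.
rewrite -(biso_invK eta z); set u := biso_inv eta z; move: u => u.
by tensor_ind u => v y; rewrite swapV_coact dactE biso_invK hitE.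
Qed.

(* In terms of [eta (v (x) y)], the action is [id (x) phi], and the balancing relations
   become [u phi(y) (x) b - u (x) y phi(b)]; taking [phi(b) = 1] splits the action. *)
Lemma dact_essential : ess_left dact.
Proof.
have [a a1] := phi_unit.
pose S := [set z | exists (m : H) (k : H) (v : V), z = (m ∙ k) ⊠ v - m ⊠ dact (k ⊠ v)].
have sN : linear_subspace (born_closure (lspan S)).
  exact/linear_subspace_closure/linear_subspace_lspan.
have cN : born_closed (born_closure (lspan S)) by exact: born_closed_closure.
have SN x : S x -> born_closure (lspan S) x.
  move=> Sx F + _; apply; exists 1%N, (fun=> 1), (fun=> x); split => //.
  by rewrite big_ord_recl big_ord0 addr0 scale1r.
split=> [x|D sD]; last first.
  (* A bounded linear section of the action, which lifts small sets. *)
  pose lift := bcomp swapV (pairr V a).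
  exists (lift @` D); first exact: blin_bnd.
  rewrite image_comp -[LHS]image_id; apply: eq_imagel => v _.
  by rewrite [RHS]dact_swapV slice_rE a1 scale1r.
split=> [x0|]; last first.
  apply: kernel_closure => _ [m [k [v ->]]]; apply/eqP.
  by rewrite blinB dact_mul subrr.
(* [F] subtracts the split part; it reproduces every x in the kernel of the action from its preimage
   z. *)
pose F : blin (V ⊗ A) (H ⊗ V) := bcomp swapV (bid _ - bcomp (pairr V a) (slice_r V (phi A))).
have FE z : F z = swapV z - swapV (slice_r V (phi A) z ⊠ a) by rewrite /F bcompE hsubE blinB.
have [z zx] : exists z, swapV z = x.
  exists (eta (tswap (tmap T Th (bid V) x))); rewrite /swapV !bcompE biso_funK tswapK tmap_comp.
  by rewrite -[RHS]tmap_id; apply: tmap_eq => // y; rewrite bcompE biso_funK.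
have <- : F z = x.
  have -> : F z = swapV z - swapV (dact x ⊠ a) by rewrite FE -dact_swapV zx.
  by rewrite x0 -[0 ⊠ a]/(pairr V a 0) !blin0 subr0.
rewrite -(biso_invK eta z); set u := biso_inv eta z; move: u => u.
apply: (tens_closed (F := bcomp F eta) sN cN) => v c; rewrite bcompE FE swapV_coact.
(* [E] sends elementary tensors to balancing relations, while gamma_l(c ⊗ a) is only a limit of sums
   of such tensors; hence [tens_closed] is applied again. *)
pose E : blin (A ⊗ A) (H ⊗ V) :=
  bcomp (pairr H v) (bcomp (amul H) (tmap T (biso_inv Th) (biso_inv Th))) -
  tmap T (biso_inv Th) (hit eta v).
have ->  : biso_inv Th c ⊠ v - swapV (slice_r V (phi A) (eta (v ⊠ c)) ⊠ a) =
    E (gamma_l A (c ⊠ a)).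
  rewrite /E hsubE !bcompE; congr (_ - _).
    suff -> w : amul H (tmap T (biso_inv Th) (biso_inv Th) w) =
        biso_inv Th (slice_r A (phi A) (biso_inv (gamma_l A) w)).
      by rewrite biso_funK slice_rE a1 scale1r.
    by tensor_ind w => f g; rewrite tmapE -[LHS](biso_funK Th) ThM !biso_invK.
  have -> w : tmap T (biso_inv Th) (hit eta v) w =
      swapV (tmap T (hit eta v) (bid A) (biso_inv (gamma_l A) w)).
    by tensor_ind w => f g; rewrite -coact_hit swapV_coact tmapE.
  by rewrite biso_funK tmap_idr.
apply: (tens_closed sN cN) => f g; apply: SN; rewrite /E hsubE !bcompE !tmapE.
exists (biso_inv Th f), (biso_inv Th g), v; congr (_ - _ ⊠ _).
by rewrite dactE biso_invK.
Qed.

End ComoduleToModule.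

Lemma intertwined_unique V (lam : essmod H V) (eta eta' : blin (V ⊗ A) (V ⊗ A)) :
  intertwined lam eta -> intertwined lam eta' -> eta =1 eta'.
Proof.
move=> h h'; apply: tens_ind; [by blinear|by blinear|] => v y.
by have [x <-] := act_onto lam v; tensor_ind x => k w; rewrite h h'.
Qed.

(** On an orbit this is [phi_regular_coact]. *)
Lemma intertwined_dact V (lam : essmod H V) (eta : esscomod A V) :
  intertwined lam eta -> dact eta =1 lam.
Proof.
move=> h; apply: tens_ind; [by blinear|by blinear|] => k v.
have [x <-] := act_onto lam v; tensor_ind x => l w.
by rewrite dactE hitE h slice_r_tmap bcomp_bid (phi_regular_coact phi_Th ThM) act_onE act_mul.
Qed.

Lemma intertwined_colinear V W (lamV : essmod H V) (lamW : essmod H W)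
    (etaV : esscomod A V) (etaW : esscomod A W) (f : blin V W) :
  intertwined lamV etaV -> intertwined lamW etaW ->
  linear_over lamV lamW f -> colinear etaV etaW f.
Proof.
move=> hV hW lf z; tensor_ind z => v y.
have [x <-] := act_onto lamV v; tensor_ind x => l w.
rewrite tmap_idr lf hV hW tmap_comp; apply: tmap_eq => // k.
by rewrite bcompE !act_onE lf.
Qed.

Lemma dact_linear V W (etaV : esscomod A V) (etaW : esscomod A W) (f : blin V W) h v :
  colinear etaV etaW f -> f (dact etaV (h ⊠ v)) = dact etaW (h ⊠ f v).
Proof.
by move=> cf; rewrite !dactE !hitE -(tmap_idr T f) cf slice_r_tmap bcomp_bid.
Qed.

(** * Tensor products *)

Section TensorProduct.
Variables (V W : bornType R) (etaV : esscomod A V) (etaW : esscomod A W).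
Local Notation C1 := (coleg13 W etaV).
Local Notation C2 := (coleg23 V etaW).
Local Notation tc := (tensor_coact etaV etaW).

Lemma tensor_coactE z : tc z = C1 (C2 z). Proof. by []. Qed.

Lemma tensor_coactK :
  cancel tc (bcomp (coleg23 V (biso_inv etaW)) (coleg13 W (biso_inv etaV))).
Proof.
move=> z; rewrite tensor_coactE bcompE.
by rewrite (coleg13K _ (biso_funK etaV)) (coleg23K _ (biso_funK etaW)).
Qed.

Lemma tensor_coactVK :
  cancel (bcomp (coleg23 V (biso_inv etaW)) (coleg13 W (biso_inv etaV))) tc.
Proof.
move=> z; rewrite tensor_coactE bcompE.
by rewrite (coleg23K _ (biso_invK etaW)) (coleg13K _ (biso_invK etaV)).
Qed.

Lemma tensor_coact_mul y z : tc (tmap T (bid _) (rmulb y) z) =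
  tmap T (bid _) (rmulb y) (tc z).
Proof.
move: z; apply: (tens_ext3 (f := bcomp tc (tmap T (bid _) (rmulb y)))
  (g := bcomp (tmap T (bid _) (rmulb y)) tc)) => v w a.
rewrite [LHS]bcompE [RHS]bcompE tmap_idl !tensor_coactE !coleg23E.
rewrite -(tmap_idl T (rmulb y)) coact_mul -tmap_interchange.
set u := tmap _ (pairl _ _) _ _; move: u => u.
move: u; apply: (tens_ext3 (f := bcomp C1 (tmap T (bid _) (rmulb y)))
  (g := bcomp (tmap T (bid _) (rmulb y)) C1)) => v' w' a'.
rewrite [LHS]bcompE [RHS]bcompE tmap_idl !coleg13E -(tmap_idl T (rmulb y)) coact_mul.
exact/esym/tmap_interchange.
Qed.

Lemma coleg13_coassoc z : tmap T (bid _) (gamma_r A) (leg12 C1 z) =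
  leg12 C1 (leg13 C1 (tmap T (bid _) (gamma_r A) z)).
Proof.
move: z; apply: tens_ind; [by blinear|by blinear|] => x u.
tensor_ind x => v w; rewrite -[(v ⊠ w) ⊠ u](tmap_idr T (pairr V w)) tmap_interchange.
rewrite !(leg12_intertwine (coleg13_pairr etaV w), leg13_intertwine (coleg13_pairr etaV w)).
by rewrite tmap_interchange coact_coassoc_gamma.
Qed.

Lemma coleg23_coassoc z : tmap T (bid _) (gamma_r A) (leg12 C2 z) =
  leg12 C2 (leg13 C2 (tmap T (bid _) (gamma_r A) z)).
Proof.
move: z; apply: tens_ind; [by blinear|by blinear|] => x u.
tensor_ind x => v w; rewrite -[(v ⊠ w) ⊠ u](tmap_idr T (pairl W v)) tmap_interchange.
rewrite !(leg12_intertwine (coleg23_pairl etaW v), leg13_intertwine (coleg23_pairl etaW v)).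
by rewrite tmap_interchange coact_coassoc_gamma.
Qed.

(** The two maps act on disjoint legs: V with the second copy of A, W with the first. *)
Lemma coleg_comm z : leg13 C1 (leg12 C2 z) = leg12 C2 (leg13 C1 z).
Proof.
move: z; apply: tens_ind3; [by blinear|by blinear|] => x a b.
tensor_ind x => v w.
pose comm (r : V ⊗ A) (p : W ⊗ A) := tmap T (bid (V ⊗ W)) tswap (tmid (r ⊠ p)).
transitivity (comm (etaV (v ⊠ b)) (etaW (w ⊠ a))).
  rewrite leg12E coleg23E; set p := etaW _; move: p => p.
  rewrite /comm; tensor_ind p => w' a'; rewrite tmap_idr tmap_idl leg13E coleg13E.
  set r := etaV _; move: r => r; tensor_ind r => v' b'.
  by rewrite tmidE !tmapE tswapE.
rewrite leg13E coleg13E; set r := etaV _; move: r => r.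
rewrite /comm; tensor_ind r => v' b'; rewrite tmap_idr tmap_idl leg12E coleg23E.
set p := etaW _; move: p => p; tensor_ind p => w' a'.
by rewrite tmidE !tmapE tswapE.
Qed.

(** Exchanging the middle factors of C1_12 C2_12 C1_13 C2_13 leaves one pentagon for V and one for
    W. *)
Lemma tensor_coact_coassoc z : tmap T (bid _) (gamma_r A) (leg12 tc z) =
  leg12 tc (leg13 tc (tmap T (bid _) (gamma_r A) z)).
Proof.
by rewrite !leg12_comp leg13_comp coleg13_coassoc coleg23_coassoc coleg_comm.
Qed.

Lemma tensor_comodule : exists eta : esscomod A (V ⊗ W), eta =1 tc.
Proof.
pose tcB := Biso tensor_coactK tensor_coactVK.
by exists (EssComod (coact := tcB) tensor_coact_mul (coassoc_of_gamma tensor_coact_coassoc)).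
Qed.

(** The tensor product of two orbit maps carries the statement back to regular modules, where it is
    [phi_regular_coact_comult]. *)
Lemma tensor_module (lamV : essmod H V) (lamW : essmod H W) (eta : esscomod A (V ⊗ W)) :
  intertwined lamV etaV -> intertwined lamW etaW -> eta =1 tc ->
  forall x z u, dact eta (x ⊠ act2 lamV lamW (z ⊠ u)) = act2 lamV lamW (Delta_mul x z ⊠ u).
Proof.
move=> hV hW etaE x z u; tensor_ind u => v w.
pose f := tmap T (act_on lamV v) (act_on lamW w).
have act2E z' : act2 lamV lamW (z' ⊠ (v ⊠ w)) = f z'.
  by tensor_ind z' => k l; rewrite /act2 bcompE tmidE !tmapE.
rewrite !act2E dactE hitE etaE; tensor_ind z => k l.
have fs X : f (slice_r _ (phi A) X) = slice_r _ (phi A) (tmap T f (bid A) X).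
  by rewrite slice_r_tmap bcomp_bid.
rewrite -(phi_regular_coact_comult phi_Th) fs; congr (slice_r _ _ _).
rewrite /f tmapE tensor_coactE !coleg23E hW.
set m := regular_coact (l ⊠ _); move: m => m; tensor_ind m => l' y.
rewrite !tmap_idr !coleg13E hV !tmap_comp; apply: tmap_eq => // k'.
by rewrite !bcompE [RHS]tmapE.
Qed.
End TensorProduct.

End Correspondence.
End ModulesComodules.

Theorem theorem8p3 (R : realType) (T : tensor_product R)
  (H Hd Hdd : bqg T) (d : dual_of H Hd) (dd : dual_of Hd Hdd)
  (* the identification of H with its bidual: P(f)(w) = w(f) *)
  (P : biso H Hdd)
  (P_eval : forall (f : H) (w : Hd), dual_ev dd (P f) w = dual_ev d w f)
  (P_iso : bqg_iso P) :
  (* D, as a map from essential H-modules to essential comodules of the dual *)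
  exists DM : forall V : bornType R, essmod H V -> esscomod Hd V,
  (* D, as a map from essential comodules of the dual to essential H-modules *)
  exists DC : forall V : bornType R, esscomod Hd V -> essmod H V,
    (forall (V : bornType R) (lam : essmod H V), is_D_mod d lam (DM V lam)) /\
    (forall (V : bornType R) (eta : esscomod Hd V),
       DC V eta =1 act_along P (D_comod dd eta)) /\
    (* mutually inverse on objects *)
    (forall (V : bornType R) (lam : essmod H V), DC V (DM V lam) =1 lam) /\
    (forall (V : bornType R) (eta : esscomod Hd V), DM V (DC V eta) =1 eta) /\
    (* functorial, with both functors the identity on morphisms *)
    (forall (V W : bornType R) (lamV : essmod H V) (lamW : essmod H W)
       (f : blin V W), linear_over lamV lamW f ->
       colinear (DM V lamV) (DM W lamW) f) /\
    (forall (V W : bornType R) (etaV : esscomod Hd V) (etaW : esscomod Hd W)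
       (f : blin V W), colinear etaV etaW f ->
       linear_over (DC V etaV) (DC W etaW) f) /\
    (* compatible with tensor products *)
    (forall (V W : bornType R) (lamV : essmod H V) (lamW : essmod H W),
       exists lam : essmod H (tobj T V W),
         is_tensor_module lamV lamW lam /\
         DM (tobj T V W) lam =1 tensor_coact (DM V lamV) (DM W lamW)) /\
    (forall (V W : bornType R) (etaV : esscomod Hd V) (etaW : esscomod Hd W),
       exists eta : esscomod Hd (tobj T V W),
         eta =1 tensor_coact etaV etaW /\
         is_tensor_module (DC V etaV) (DC W etaW) (DC (tobj T V W) eta)).
Proof.
pose th := bcomp (biso_inv (Fl dd)) P.
pose thi := bcomp (biso_inv P) (Fl dd).
have thK : cancel th thi by move=> h; rewrite /th /thi /= biso_invK biso_funK.
have thVK : cancel thi th by move=> h; rewrite /th /thi /= biso_invK biso_funK.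
pose Th := Biso thK thVK.
have Fl_Th h : Fl dd (Th h) = P h by rewrite /= biso_invK.
have phi_Th w h : phi Hd (amul Hd (tpair T w (Th h))) = dual_ev d w h.
  by rewrite -(FlE dd) Fl_Th P_eval.
have ThM h k : Th (amul H (tpair T h k)) =
    slice_r Hd (phi Hd) (biso_inv (gamma_l Hd) (tpair T (Th h) (Th k))).
  have [PM _ _] := P_iso.
  rewrite -[LHS](biso_funK (Fl dd)) Fl_Th PM -!Fl_Th.
  by rewrite (dual_mul dd) biso_funK.
(* The coaction is chosen from an existence statement; [intertwined] determines it. *)
pose DM (V : bornType R) (lam : essmod H V) : esscomod Hd V := sval (cid (coact_exists d lam)).
have DMP (V : bornType R) (lam : essmod H V) : intertwined d lam (DM V lam).
  exact: svalP (cid (coact_exists d lam)).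
pose DC (V : bornType R) (eta : esscomod Hd V) : essmod H V :=
  EssMod (dact_mul ThM eta) (dact_essential ThM eta).
have DCP (V : bornType R) (eta : esscomod Hd V) : intertwined d (DC V eta) eta.
  exact: dact_intertwined.
exists DM, DC; split.
  move=> V lam f y; move: y; apply: tens_ind; [by blinear|by blinear|] => h v.
  rewrite DMP regular_coact_Fl tassocVE tmapE bcompE tswapE.
  set z := biso_inv _ _; move: z => z; tensor_ind z => k l.
  by rewrite tswapE tassocE !tmapE tswapE tmapE.
split.
  move=> V eta; apply: tens_ind; [by blinear|by blinear|] => h v.
  by rewrite [LHS]dactE /act_along /D_comod !bcompE !tmap_idr tswapE.
split; first by move=> V lam; exact: (intertwined_dact phi_Th ThM (DMP V lam)).
split; first by move=> V eta; exact: (intertwined_unique (DMP V _) (DCP V eta)).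
split.
  by move=> V W lamV lamW f; exact: (intertwined_colinear (DMP V lamV) (DMP W lamW)).
split; first by move=> V W etaV etaW f cf h v; exact: dact_linear.
split.
  (* The tensor module is constructed from the tensor comodule, so that its essentiality comes from
     [dact_essential]; uniqueness then identifies its coaction. *)
  move=> V W lamV lamW; have [eta etaE] := tensor_comodule (DM V lamV) (DM W lamW).
  exists (DC _ eta); split.
    by move=> x z u; exact: (tensor_module phi_Th (DMP V lamV) (DMP W lamW) etaE).
  by move=> z; rewrite -etaE; exact: (intertwined_unique (DMP _ _) (DCP _ eta)).
move=> V W etaV etaW; have [eta etaE] := tensor_comodule etaV etaW.
exists eta; split => // x z u.
exact: (tensor_module phi_Th (DCP V etaV) (DCP W etaW) etaE).
Qed.
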